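(* There is a polynomial-time $2$-approximation algorithm for the Flexible Graph Connectivity problem $\mathrm{FGC}$: given any feasible instance $(G=(V,E),\mathscr{S},\mathscr{U},c)$, it outputs a feasible edge-set $F\subseteq E$ with $c(F)\le 2\cdot\mathrm{OPT}$, where $\mathrm{OPT}$ is the minimum cost of a feasible edge-set.
   Context: An instance of $\mathrm{FGC}$ consists of an undirected connected graph $G=(V,E)$ (multiedges allowed, no self-loops), a partition $E=\mathscr{S}\,\dot\cup\,\mathscr{U}$ into safe edges $\mathscr{S}$ and unsafe edges $\mathscr{U}$, and nonnegative edge costs $c:E\to\mathbb{R}_{\ge 0}$. An edge-set $F\subseteq E$ (a sub-multiset of $E$, i.e. no edge used more times than it occurs in $G$) is feasible if for every unsafe edge $e\in F\cap\mathscr{U}$ the graph $(V,F\setminus\{e\})$ is connected. The cost of $F$ is $c(F)=\sum_{e\in F}c_e$, and the goal is to find a feasible $F$ of minimum cost.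
   Formalization: Feasible here also requires that the graph (V,F) itself be connected; with the quoted condition alone the empty edge-set would be feasible in every instance and OPT would always be 0. Polynomial time is counted in arithmetic operations, bounded by a polynomial in |V|+|E|. *)

(* Defs.v *)
From HB Require Import structures.
From mathcomp Require Import all_boot all_order all_algebra.

Set Implicit Arguments.
Unset Strict Implicit.
Unset Printing Implicit Defensive.

Import Order.TTheory GRing.Theory Num.Theory.
Local Open Scope ring_scope.

(** * Flexible graph connectivity *)

(** Vertices and edges are numbered, as in the input of an algorithm.  Parallel
    edges are distinct indices with the same ends, so a sub-multiset of the edges
    is a set of indices.  The orientation of [ends e] has no meaning. *)
Record fgc_instance (R : realFieldType) := FGCInstance {
  nv : nat;
  ne : nat;
  ends : 'I_ne -> 'I_nv * 'I_nv;
  safe : {set 'I_ne};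
  ecost : 'I_ne -> R
}.

Section FGC.

Variables (R : realFieldType) (I : fgc_instance R).

Definition unsafe : {set 'I_(ne I)} := ~: safe I.

Definition adj (F : {set 'I_(ne I)}) : rel 'I_(nv I) :=
  fun u v => [exists e in F, (ends e == (u, v)) || (ends e == (v, u))].

Definition connectedg (F : {set 'I_(ne I)}) : bool :=
  [forall u, forall v, connect (adj F) u v].

Definition fgc_wf : Prop :=
  [/\ (0 < nv I)%N,
      (forall e : 'I_(ne I), (ends e).1 != (ends e).2),
      connectedg setT
    & forall e : 'I_(ne I), 0 <= ecost e].

(** The first conjunct is the case where no edge fails; without it the empty
    set would be feasible for every instance. *)
Definition feasible (F : {set 'I_(ne I)}) : bool :=
  connectedg F && [forall e in F :&: unsafe, connectedg (F :\ e)].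

Definition cost (F : {set 'I_(ne I)}) : R := \sum_(e in F) ecost e.

(** Costs being nonnegative, the default value [cost setT] is an upper bound on
    all the costs, so it does not affect the minimum: see [OPTP]. *)
Definition OPT : R := \big[Order.min/cost setT]_(F | feasible F) cost F.

Lemma OPTP : fgc_wf -> (exists F, feasible F) ->
  (exists2 F, feasible F & cost F = OPT) /\
  (forall F, feasible F -> OPT <= cost F).
Proof.
case=> _ _ _ c_ge0 [F0 F0f]; split=> [|F Ff]; last exact: bigmin_le_cond.
have leT (F : {set 'I_(ne I)}) : feasible F -> cost F <= cost setT.
  move=> _; rewrite /cost big_mkcond [leRHS]big_mkcond.
  by apply: ler_sum => e _; rewrite inE; case: ifP.
have [F Ff eqF] := eq_bigmin F0 _ _ F0f leT.
by exists F; rewrite // /OPT eqF.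
Qed.

End FGC.

(** * Random access machine

    Programs are structured programs of a uniform-cost random access machine
    with finitely many (named) zero-initialised arrays of natural numbers and
    finitely many arrays of elements of [R]; [NGet a i] is the cell [i] of the
    array [a] and scalars are cells with a constant index.  The only operations
    on naturals are addition, truncated subtraction and comparison, and the only
    ones on [R] are addition, subtraction and comparison: without
    multiplication, numbers whose size is exponential in the number of steps
    cannot be created, so polynomial uniform cost is polynomial time. *)

Inductive nexp :=
| NConst of nat
| NGet of nat & nexp
| NAdd of nexp & nexp
| NSub of nexp & nexp.

Inductive rexp :=
| RZero
| RGet of nat & nexp
| RAdd of rexp & rexp
| RSub of rexp & rexp.

Inductive bexp :=
| BLeN of nexp & nexp
| BLeR of rexp & rexp
| BNot of bexp
| BAnd of bexp & bexp.

Inductive prog :=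
| Skip
| NSet of nat & nexp & nexp (* array, index, value *)
| RSet of nat & nexp & rexp (* array, index, value *)
| Seq of prog & prog
| If of bexp & prog & prog
| While of bexp & prog.

Section Semantics.

Variable R : realFieldType.

Record state := State {
  nmem : nat -> nat -> nat;
  rmem : nat -> nat -> R
}.

Definition upd (T : Type) (m : nat -> nat -> T) (a i : nat) (x : T) :=
  fun b j => if (b == a) && (j == i) then x else m b j.

Fixpoint neval (s : state) (e : nexp) : nat :=
  match e with
  | NConst n => n
  | NGet a i => nmem s a (neval s i)
  | NAdd e1 e2 => (neval s e1 + neval s e2)%N
  | NSub e1 e2 => (neval s e1 - neval s e2)%N
  end.

Fixpoint reval (s : state) (e : rexp) : R :=
  match e with
  | RZero => 0
  | RGet a i => rmem s a (neval s i)
  | RAdd e1 e2 => reval s e1 + reval s e2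
  | RSub e1 e2 => reval s e1 - reval s e2
  end.

Fixpoint beval (s : state) (b : bexp) : bool :=
  match b with
  | BLeN e1 e2 => (neval s e1 <= neval s e2)%N
  | BLeR e1 e2 => reval s e1 <= reval s e2
  | BNot b1 => ~~ beval s b1
  | BAnd b1 b2 => beval s b1 && beval s b2
  end.

(** [exec P s t s']: started in [s], [P] halts in [s'] after [t] steps, a step
    being an assignment, a [Skip] or the evaluation of a test.  As expressions
    are part of the program, evaluating one takes a bounded number of machine
    operations. *)
Inductive exec : prog -> state -> nat -> state -> Prop :=
| ExecSkip s : exec Skip s 1 s
| ExecNSet s a i e :
    exec (NSet a i e) s 1
      (State (upd (nmem s) a (neval s i) (neval s e)) (rmem s))
| ExecRSet s a i e :
    exec (RSet a i e) s 1
      (State (nmem s) (upd (rmem s) a (neval s i) (reval s e)))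
| ExecSeq P Q s1 s2 s3 t u :
    exec P s1 t s2 -> exec Q s2 u s3 -> exec (Seq P Q) s1 (t + u) s3
| ExecIfT b P Q s s' t :
    beval s b -> exec P s t s' -> exec (If b P Q) s t.+1 s'
| ExecIfF b P Q s s' t :
    ~~ beval s b -> exec Q s t s' -> exec (If b P Q) s t.+1 s'
| ExecWhileF b P s : ~~ beval s b -> exec (While b P) s 1 s
| ExecWhileT b P s1 s2 s3 t u :
    beval s1 b -> exec P s1 t s2 -> exec (While b P) s2 u s3 ->
    exec (While b P) s1 (t + u).+1 s3.

Lemma exec_det P s t1 s1 t2 s2 :
  exec P s t1 s1 -> exec P s t2 s2 -> t1 = t2 /\ s1 = s2.
Proof.
move=> H; elim: H t2 s2 => {P s t1 s1}.
- by move=> s t2 s2 H; inversion H.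
- by move=> s a i e t2 s2 H; inversion H.
- by move=> s a i e t2 s2 H; inversion H.
- move=> P Q s1 s2 s3 t u _ IH1 _ IH2 t2 s2' H; inversion H; subst.
  have [-> ?] := IH1 _ _ ltac:(eassumption); subst.
  by have [-> ->] := IH2 _ _ ltac:(eassumption).
- move=> b P Q s s' t bT _ IH t2 s2 H; inversion H; subst.
    by have [-> ->] := IH _ _ ltac:(eassumption).
  by case: (negP ltac:(eassumption) bT).
- move=> b P Q s s' t bF _ IH t2 s2 H; inversion H; subst.
    by case: (negP bF).
  by have [-> ->] := IH _ _ ltac:(eassumption).
- move=> b P s bF t2 s2 H; inversion H; subst => //.
  by case: (negP bF).
- move=> b P s1 s2 s3 t u bT _ IH1 _ IH2 t2 s2' H; inversion H; subst.
    by case: (negP ltac:(eassumption) bT).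
  have [-> ?] := IH1 _ _ ltac:(eassumption); subst.
  by have [-> ->] := IH2 _ _ ltac:(eassumption).
Qed.

(** ** Input and output conventions *)

Definition tab (T : Type) (x0 : T) (n : nat) (f : 'I_n -> T) (i : nat) : T :=
  if insub i is Some j then f j else x0.

(** Array 0 of naturals holds the numbers of vertices and edges, arrays 1 and 2
    the ends of the edges, array 3 the indicator of the safe edges; array 0 of
    [R] holds the edge costs. *)
Definition encode (I : fgc_instance R) : state :=
  State
    (fun a i => match a with
       | 0%N => nth 0%N [:: nv I; ne I] i
       | 1%N => tab 0%N (fun e : 'I_(ne I) => val (ends e).1) i
       | 2%N => tab 0%N (fun e : 'I_(ne I) => val (ends e).2) i
       | 3%N => tab 0%N (fun e : 'I_(ne I) => nat_of_bool (e \in safe I)) i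
       | _ => 0%N
       end)
    (fun a i => match a with
       | 0%N => tab 0 (@ecost _ I) i
       | _ => 0
       end).

(** The output is the set of edges whose cell in array 4 is not zero. *)
Definition output (I : fgc_instance R) (s : state) : {set 'I_(ne I)} :=
  [set e : 'I_(ne I) | nmem s 4 e != 0%N].

End Semantics.

(* Main.v *)
(** Every edge is replaced by its two orientations, in two copies [c = 0, 1] of the
    graph.  The sets of arcs that are forests in both copies form a graphic matroid.
    The sets of arcs with at most two arcs entering a vertex, none entering the root,
    and never both copies of an orientation of an unsafe edge, form a laminar
    matroid.  A common independent set of size [2 (n - 1)] has at least two arcs
    entering every vertex set avoiding the root, because at most [2 (|U| - 1)] of the
    [2 |U|] arcs with head in [U] lie inside [U]; hence its edges are feasible.
    Conversely the orientations of a feasible edge set contain two disjoint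
    arborescences, hence such a common base, which uses every edge at most twice as
    the copies are forests.  So a common base of minimum cost is a 2-approximation.

    It is found by successive augmentations along closed walks through an artificial
    element in the exchange graph that are shortest, first in cost and then in number
    of arcs.  Optimality is certified by a splitting of the cost into two weights for
    which the current set is of minimum weight in each matroid, and the capped
    distances in the exchange graph update the splitting. *)
Require Import Defs.
From HB Require Import structures.
From mathcomp Require Import all_boot all_order all_algebra.
From mathcomp Require Import ring lra zify.

Set Implicit Arguments.
Unset Strict Implicit.
Unset Printing Implicit Defensive.

Import Order.TTheory GRing.Theory Num.Theory.
Local Open Scope ring_scope.

(** * Matroids *)

(** A safe edge may appear in both copies with the same orientation because alone it is enough for a
    cut; an unsafe edge may not, so the two arcs entering a vertex set then come from two different
    edges.

    The artificial element can be added to every independent set of either matroid. Adjoined to the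
    current set, it turns an augmenting path into a closed walk of exchanges that removes it, so one
    statement about simultaneous swaps at constant cardinality serves both matroids.

    The obstacle is that swaps which are possible one at a time need not be possible together.
    Shortcuts of the walk are what could spoil them, and minimality in the number of arcs, after
    minimality in cost, excludes the shortcuts of equal length. The heavier ones are handled by the
    order in which the swaps are made.

    The splitting lives in the proof only. The program computes distances by number of steps, with
    arc lengths of both signs; the splitting shows that these lengths are nonnegative up to a
    potential. *)

Record matroid (T : finType) (ind : pred {set T}) : Prop := Matroid {
  ind_sub : forall X Y : {set T}, X \subset Y -> ind Y -> ind X;
  ind_aug : forall X Y : {set T}, ind X -> ind Y -> (#|X| < #|Y|)%N ->
    exists2 y, y \in Y :\: X & ind (y |: X)
}.

Definition swap (T : finType) (B : {set T}) (y x : T) : {set T} := x |: (B :\ y).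

Section MatroidTheory.

Variables (T : finType) (ind : pred {set T}).
Hypothesis matI : matroid ind.
Implicit Types (B X Y Z : {set T}) (x y z : T).

Lemma card_swap B y x : y \in B -> x \notin B -> #|swap B y x| = #|B|.
Proof.
move=> yB xB; rewrite /swap cardsU1 !inE (negPf xB) andbF /= (cardsD1 y B) yB.
by [].
Qed.

Lemma ind_grow Z B : ind Z -> ind B -> (#|Z| <= #|B|)%N ->
  exists Z', [/\ Z \subset Z', Z' \subset Z :|: B, #|Z'| = #|B| & ind Z'].
Proof.
move=> iZ iB; move: {2}(#|B| - #|Z|)%N (erefl (#|B| - #|Z|)%N) => d.
elim: d Z iZ => [|d IH] Z iZ dE leZB.
  exists Z; split; rewrite ?subsetUl //; apply/eqP.
  by rewrite eqn_leq leZB -subn_eq0 dE.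
have ltZB : (#|Z| < #|B|)%N by rewrite -subn_gt0 dE.
have [y /setDP[yB yZ] iyZ] := ind_aug matI iZ iB ltZB.
have cZ : #|y |: Z| = #|Z|.+1 by rewrite cardsU1 yZ.
have [||Z' [s1 s2 s3 s4]] := IH _ iyZ; rewrite ?cZ ?subnS ?dE //.
exists Z'; split=> //; first by rewrite (subset_trans _ s1) ?subsetUr.
rewrite (subset_trans s2) // -setUA subUset subxx andbT sub1set inE yB.
exact: orbT.
Qed.

(** This turns an augmentation of a subset into an arc of the exchange graph: [x |: Z] grows inside
    [x |: B] to the size of [B], and the element of [B] left out is the one to exchange for [x]. *)
Lemma ind_swap_out B Z x : ind B -> x \notin B -> Z \proper B -> ind (x |: Z) ->
  exists2 y, y \in B :\: Z & ind (swap B y x).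
Proof.
move=> iB xB ZB iZ.
have xZ : x \notin Z by apply: contra xB; apply: (subsetP (proper_sub ZB)).
have [|Z' [s1 s2 s3 s4]] := ind_grow iZ iB.
  by rewrite cardsU1 xZ; apply: proper_card.
have xZ' : x \in Z' by apply: (subsetP s1); rewrite setU11.
have /subsetPn[y yB yZ'] : ~~ (B \subset Z').
  apply/negP=> sB; have : (#|x |: B| <= #|Z'|)%N.
    by apply: subset_leq_card; rewrite subUset sub1set xZ'.
  by rewrite cardsU1 xB s3 ltnn.
exists y.
  by rewrite inE yB andbT; apply: contra yZ' => yZ; apply: (subsetP s1); rewrite setU1r.
suff -> : swap B y x = Z' by [].
apply/esym/eqP; rewrite eqEcard card_swap // s3 leqnn andbT.
apply/subsetP=> z zZ'; rewrite !inE; have := subsetP s2 _ zZ'.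
rewrite !inE; case: eqP => //= _ zZB; apply/andP; split.
  by apply: contraNneq yZ' => <-.
by case/orP: zZB => // /(subsetP (proper_sub ZB)).
Qed.

(* Exchanging in one pair whose removed element is spanned by no later added
   element leaves the exchange structure among the later pairs unchanged. *)
Lemma ind_swaps B (ps : seq (T * T)) : ind B ->
  uniq (unzip1 ps) -> uniq (unzip2 ps) ->
  (forall p, p \in ps -> [/\ p.1 \in B, p.2 \notin B & ind (swap B p.1 p.2)]) ->
  pairwise (fun p q => ~~ ind (swap B p.1 q.2)) ps ->
  ind ((B :\: [set y in unzip1 ps]) :|: [set x in unzip2 ps]).
Proof.
elim: ps B => [|[y x] ps IH] B iB.
  move=> _ _ _ _; rewrite (_ : _ :|: _ = B) //.
  by apply/setP=> z; rewrite !inE orbF.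
move=> /=/andP[yps u1] /andP[xps u2] Hps /andP[/allP /= py pps].
have [/= yB xB iyx] := Hps _ (mem_head _ _).
set B1 := swap B y x.
have cB1 : #|B1| = #|B| by rewrite card_swap.
have psP p : p \in ps -> [/\ p.1 \in B, p.2 \notin B, p.1 != y & p.2 != x].
  move=> pp; have [pB p'B _] : [/\ p.1 \in B, p.2 \notin B & ind (swap B p.1 p.2)].
    by apply: Hps; rewrite inE pp orbT.
  split=> //; first by apply: contraNneq yps => <-; apply: map_f.
  by apply: contraNneq xps => <-; apply: map_f.
(* Each direction augments the common part [Z] of the two swapped sets. Since [q.2] cannot replace
   [y] in [B], adding back [p.1] is impossible, so the augmentation must bring in the wanted element
   [y] or [x]. *)
have eqi p q : p \in ps -> q \in ps -> ind (swap B1 p.1 q.2) = ind (swap B p.1 q.2).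
  move=> pp qp; have [pB _ py' _] := psP _ pp; have [_ qB _ qx] := psP _ qp.
  have nq : ~~ ind (swap B y q.2) by have := py _ qp.
  have xp : x != p.1 by apply: contraNneq xB => ->.
  pose Z := q.2 |: (B :\ y :\ p.1).
  have cZ : (#|Z| < #|B|)%N.
    rewrite /Z cardsU1 !inE (negPf qB) !andbF add1n.
    by rewrite (cardsD1 y B) yB (cardsD1 p.1 (B :\ y)) !inE py' pB.
  apply/idP/idP=> i1.
    have iZ : ind Z.
      apply: ind_sub matI _ _ _ i1; apply/subsetP=> z; rewrite !inE.
      by case: (z == q.2) => //= /and3P[-> -> ->]; rewrite orbT.
    have [z /setDP[zB zZ] izZ] := ind_aug matI iZ iB cZ.
    move: zZ; rewrite !inE zB andbT negb_or negb_and !negbK => /andP[zq /orP[]/eqP zE].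
      rewrite zE in izZ; case/negP: nq; apply: ind_sub matI _ _ _ izZ.
      apply/subsetP=> w; rewrite !inE; case: (w == q.2); rewrite ?orbT //=.
      by case: (w == p.1) => //=.
    rewrite zE in izZ; apply: ind_sub matI _ _ _ izZ.
    apply/subsetP=> w; rewrite !inE; case: (w == q.2); rewrite ?orbT //=.
    by case: (w == y) => //=.
  have iZ : ind Z.
    apply: ind_sub matI _ _ _ i1; apply/subsetP=> z; rewrite !inE.
    by case: (z == q.2) => //= /and3P[-> _ ->].
  rewrite -cB1 in cZ.
  have [z /setDP[zB zZ] izZ] := ind_aug matI iZ iyx cZ.
  move: zZ zB; rewrite !inE negb_or => /andP[zq].
  case: (altP (z =P x)) => [zx _ _|zx /= h /andP[zy zB]].
    rewrite zx in izZ; apply: ind_sub matI _ _ _ izZ.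
    apply/subsetP=> w; rewrite !inE; case: (w == q.2); rewrite ?orbT //=.
    by case: (w == x) => //=; rewrite ?andbT //= => /and3P[-> -> ->].
  move: h; rewrite zy zB /= andbT negbK => /eqP zE; rewrite zE in izZ.
  case/negP: nq; apply: ind_sub matI _ _ _ izZ.
  apply/subsetP=> w; rewrite !inE; case: (w == q.2); rewrite ?orbT //=.
  by case: (w == p.1) => //=.
have := IH B1 iyx u1 u2;
  rewrite (_ : (_ :\: _) :|: _ = (B :\: [set y0 in unzip1 ((y,x)::ps)]) :|: [set x0 in
    unzip2 ((y,x)::ps)]).
  apply.
    move=> p pp; have [pB p'B py' px] := psP _ pp; split.
    - by rewrite !inE py' pB orbT.
    - by rewrite !inE (negPf px) (negPf p'B) andbF.
    - by rewrite eqi //; case: (Hps p); rewrite // inE pp orbT.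
  rewrite (@eq_in_pairwise _ (mem ps) _ (fun p q => ~~ ind (swap B p.1 q.2))) //.
    by move=> p q pp qp /=; rewrite eqi.
apply/setP=> z; rewrite !inE; case: (altP (z =P x)) => [->|zx] //=.
  rewrite orbT andbT; apply/orP; left; apply/negP=> /mapP[p /psP[pB _ _ _] xp].
  by rewrite xp pB in xB.
by case: (z == y); rewrite //= ?andbF.
Qed.

(** * Weighted exchanges *)

Section Weights.

Variables (R : realFieldType) (w : T -> R).

Definition locally_min B :=
  forall y x, y \in B -> x \notin B -> ind (swap B y x) -> w y <= w x.

Lemma sum_swap B y x : y \in B -> x \notin B ->
  \sum_(z in swap B y x) w z = \sum_(z in B) w z - w y + w x.
Proof.
move=> yB xB; rewrite /swap big_setU1 ?inE ?(negPf xB) ?andbF //=.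
by rewrite [in RHS](big_setD1 y) //= [w y + _]addrC addrK addrC.
Qed.

(* With [y] of largest weight in [B :\: X], an element [x] of [X] replaceable for
   [y] in [B] weighs at least as much as whatever replaces [x] in [X], so no
   symmetric exchange property is needed. *)
Lemma locally_min_min B : ind B -> locally_min B ->
  forall X, ind X -> #|X| = #|B| -> \sum_(z in B) w z <= \sum_(z in X) w z.
Proof.
move=> iB lB X; move: {2}#|B :\: X| (erefl #|B :\: X|) => d.
elim: d X => [|d IH] X dE iX cX.
  suff -> : B = X by [].
  apply/eqP; rewrite eqEcard cX leqnn andbT -setD_eq0; exact/eqP/cards0_eq.
have /set0Pn[y0 y0P] : B :\: X != set0 by rewrite -card_gt0 dE.
have [y yP ymax] := Order.TotalTheory.arg_maxP w y0P.
have [yB yX] := setDP yP.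
have iBy : ind (B :\ y) by apply: ind_sub matI _ _ (subD1set _ _) iB.
have [|x /setDP[xX xBy] ix] := ind_aug matI iBy iX.
  by rewrite cX (cardsD1 y B) yB.
have xy : x != y by apply: contraNneq yX => <-.
have xB : x \notin B by move: xBy; rewrite !inE xy.
have le_yx := lB _ _ yB xB ix.
have iXx : ind (X :\ x) by apply: ind_sub matI _ _ (subD1set _ _) iX.
have [|z /setDP[zB zXx] iz] := ind_aug matI iXx iB.
  by rewrite -cX (cardsD1 x X) xX.
have zx : z != x by apply: contraNneq xB => <-.
have zX : z \notin X by move: zXx; rewrite !inE zx.
have le_zy : w z <= w y by apply: ymax; apply/setDP.
apply: (@le_trans _ _ (\sum_(u in swap X x z) w u)).
  apply: IH => //; last by rewrite card_swap.
  apply: succn_inj; rewrite -dE (cardsD1 z (B :\: X)) !inE zX zB add1n; congr _.+1.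
  apply: eq_card => u; rewrite !inE; case: (altP (u =P z)) => //= uz.
  by case: (altP (u =P x)) => //= ->; rewrite (negPf xB) andbF.
by rewrite sum_swap // -addrA gerDl addrC subr_le0 (le_trans le_zy).
Qed.

(** Sort the pairs by decreasing weight, equal weights by index. If an earlier [y i] could be
    exchanged for a later [x j], local minimality would give [w (y i) <= w (x j)], hence equal
    weights and [i < j], against the last hypothesis. So the order required by [ind_swaps] is
    found. *)
Lemma ind_weighted_swaps B (s : seq nat) (y x : nat -> T) :
  ind B -> locally_min B -> uniq s -> uniq (map y s) -> uniq (map x s) ->
  (forall i, i \in s ->
     [/\ y i \in B, x i \notin B, w (y i) = w (x i) & ind (swap B (y i) (x i))]) ->
  (forall i j, i \in s -> j \in s -> (i < j)%N ->
     ind (swap B (y i) (x j)) -> w (y i) < w (x j)) ->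
  ind ((B :\: [set z in map y s]) :|: [set z in map x s]).
Proof.
move=> iB lB us uy ux sP short.
pose leT i j := (w (y j) < w (y i)) || (w (y i) == w (y j)) && (i <= j)%N.
have leT_tot : total leT.
  move=> i j; rewrite /leT; case: (ltgtP (w (y i)) (w (y j))) => //= _.
  exact: leq_total.
have leT_tr : transitive leT.
  move=> j i k; rewrite /leT => /orP[lt1|/andP[/eqP e1 l1]] /orP[lt2|/andP[/eqP e2 l2]].
  - by rewrite (lt_trans lt2).
  - by rewrite -e2 lt1.
  - by rewrite e1 lt2.
  - by rewrite e1 e2 eqxx (leq_trans l1 l2) orbT.
pose s' := sort leT s; pose ps := [seq (y i, x i) | i <- s'].
have mem_s' : s' =i s by move=> i; rewrite mem_sort.
have ps1 : unzip1 ps = map y s' by rewrite /unzip1 -map_comp.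
have ps2 : unzip2 ps = map x s' by rewrite /unzip2 -map_comp.
have Pm (f : nat -> T) : perm_eq (map f s') (map f s).
  by apply: perm_map; rewrite perm_sort.
have := @ind_swaps B ps iB; rewrite ps1 ps2.
have eqs (f : nat -> T) : [set z in map f s'] = [set z in map f s].
  by apply/setP=> z; rewrite !inE (perm_mem (Pm f)).
rewrite !eqs; apply; rewrite ?(perm_uniq (Pm _)) //.
  by move=> p /mapP[i]; rewrite mem_s' => /sP[? ? _ ?] ->.
rewrite pairwise_map.
have := sort_sorted leT_tot s; rewrite sorted_pairwise // -/s' => pw1.
have : uniq s' by rewrite sort_uniq.
rewrite uniq_pairwise => pw2.
have pw : pairwise [rel i j | leT i j && (i != j)] s' by rewrite pairwise_relI pw1.
apply: (@sub_in_pairwise _ (mem s')) pw; last exact/allP.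
move=> i j si' sj' /= /andP[lij nij]; apply/negP=> iij.
have si : i \in s by rewrite -mem_s'.
have sj : j \in s by rewrite -mem_s'.
have [yi xi wi ii] := sP _ si; have [yj xj wj ij] := sP _ sj.
have := lB _ _ yi xj iij; rewrite -wj => le1.
move: lij; rewrite /leT ltNge le1 /= => /andP[/eqP wij lij].
have := short i j si sj; rewrite ltn_neqAle nij lij => /(_ isT iij).
by rewrite -wj wij ltxx.
Qed.

End Weights.

End MatroidTheory.

(** * Shortest closed walks *)

Section Walks.

Variables (R : realFieldType) (T : finType) (e : rel T) (s : T) (red : T -> T -> R).
Hypothesis red_ge0 : forall u v, e u v -> 0 <= red u v.
Implicit Types (q : seq T) (u v : T).

Definition walk q := path e s q && (s \notin q).

Fixpoint weight u q : R :=
  if q is v :: q' then red u v + weight v q' else 0.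

Definition cweight q := weight s q + red (last s q) s.

(** The default [s] matters: index [(size q).+1] gives [s] again, so the closing arc of a closed
    walk is a step like the others. *)
Definition vtx q i := nth s (s :: q) i.

Lemma weight_cat u q1 q2 : weight u (q1 ++ q2) = weight u q1 + weight (last u q1) q2.
Proof. by elim: q1 u => [|v q1 IH] u /=; rewrite ?add0r // IH addrA. Qed.

Lemma weight_ge0 u q : path e u q -> 0 <= weight u q.
Proof.
by elim: q u => //= v q IH u /andP[euv pq]; rewrite addr_ge0 ?red_ge0 ?IH.
Qed.

Lemma last_take q i : (i <= size q)%N -> last s (take i q) = vtx q i.
Proof.
rewrite /vtx; case: i => [|i] lei; first by rewrite take0.
by rewrite (take_nth s) // last_rcons.
Qed.

Lemma walk_splice q q2 i : walk q -> (i <= size q)%N ->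
  path e (vtx q i) q2 -> s \notin q2 -> walk (take i q ++ q2).
Proof.
move=> /andP[pq sq] lei p2 s2; rewrite /walk cat_path last_take // p2 andbT.
rewrite mem_cat negb_or s2 andbT; move: pq sq.
rewrite -{1 2}(cat_take_drop i q) cat_path mem_cat negb_or.
by case/andP=> -> _ /andP[-> _].
Qed.

Lemma path_drop q i : walk q -> (i <= size q)%N ->
  path e (vtx q i) (drop i q) && (s \notin drop i q).
Proof.
move=> /andP[+ +] lei; rewrite -{1 2}(cat_take_drop i q) cat_path mem_cat negb_or.
by rewrite last_take // => /andP[_ ->] /andP[_ ->].
Qed.

Lemma weight_split q i : (i <= size q)%N ->
  weight s q = weight s (take i q) + weight (vtx q i) (drop i q).
Proof. by move=> lei; rewrite -{1}(cat_take_drop i q) weight_cat last_take. Qed.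

Lemma last_drop q i : (i <= size q)%N -> last (vtx q i) (drop i q) = last s q.
Proof. by move=> lei; rewrite -[in RHS](cat_take_drop i q) last_cat last_take. Qed.

Lemma walk_cut q : walk q -> ~~ uniq q ->
  exists q', [/\ walk q', last s q' = last s q, (size q' < size q)%N
               & weight s q' <= weight s q].
Proof.
move=> wq /(uniqPn s)[i [j [ltij ltj eij]]].
have lei : (i.+1 <= size q)%N by apply: ltn_trans ltj.
have eu : vtx q i.+1 = vtx q j.+1 by rewrite /vtx /=.
have /andP[pd sd] := path_drop wq ltj.
exists (take i.+1 q ++ drop j.+1 q); split.
- by apply: walk_splice => //; rewrite eu.
- by rewrite last_cat last_take // eu last_drop.
- rewrite size_cat size_takel // size_drop.
  by rewrite -[ltnRHS](subnKC ltj) ltn_add2r ltnS.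
rewrite weight_cat last_take // eu (weight_split ltj) lerD2r.
have tE : take j.+1 q = take i.+1 q ++ drop i.+1 (take j.+1 q).
  by rewrite -{1}(cat_take_drop i.+1 (take j.+1 q)) take_takel // ltnS ltnW.
rewrite tE weight_cat lerDl; apply: weight_ge0.
case/andP: wq; rewrite -{1}(cat_take_drop j.+1 q) cat_path => /andP[+ _] _.
by rewrite {1}tE cat_path => /andP[].
Qed.

Lemma walk_uniq q : walk q ->
  exists q', [/\ walk q', last s q' = last s q, uniq q' & weight s q' <= weight s q].
Proof.
have [n] := ubnP (size q); elim: n q => // n IH q /ltnSE leq wq.
have [uq|nuq] := boolP (uniq q); first by exists q.
have [q1 [w1 l1 s1 we1]] := walk_cut wq nuq.
have [|q2 [w2 l2 s2 we2]] := IH q1 _ w1; first by apply: leq_trans leq.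
by exists q2; split=> //; [rewrite l2|apply: le_trans we1].
Qed.

Lemma walk_uniq_size q : walk q -> uniq q -> (size q < #|T|)%N.
Proof.
move=> /andP[_ sq] uq; have us : uniq (s :: q) by rewrite /= sq.
by rewrite -[(size q).+1]/(size (s :: q)) -(card_uniqP us) max_card.
Qed.

Lemma potential_exists (L : R) :
  (forall q, walk q -> uniq q -> e (last s q) s -> L <= cweight q) ->
  exists p : T -> R,
    [/\ (forall v, v != s -> e s v -> p v <= red s v),
        (forall u v, u != s -> v != s -> e u v -> p v <= p u + red u v)
      & (forall u, u != s -> e u s -> L <= p u + red u s)].
Proof.
move=> Lmin.
(* Starting the minimum from [L] caps the distance. This gives a value to unreachable elements, and
   a capped value satisfies all the inequalities because [red] is nonnegative on arcs. *)
pose p v := \big[Order.min/L]_(k < #|T|)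
  \big[Order.min/L]_(t : k.-tuple T | walk t && (last s t == v)) weight s t.
have ple q : walk q -> p (last s q) <= weight s q.
  move=> /walk_uniq[q' [wq' <- uq' leq]]; apply: le_trans leq.
  have ltq := walk_uniq_size wq' uq'.
  apply: (bigmin_inf (Ordinal ltq)) => //=.
  by apply: (bigmin_inf (in_tuple q')); rewrite /= ?wq' ?eqxx.
have pL v : p v <= L by apply: bigmin_le_id.
have pat v : p v = L \/ exists q, [/\ walk q, last s q = v & weight s q = p v].
  pose K x := x = L \/ exists q, [/\ walk q, last s q = v & weight s q = x].
  have Kmin x y : K x -> K y -> K (Order.min x y) by rewrite minEle; case: ifP.
  apply: (@big_ind _ K) => [|//|k _]; first by left.
  apply: (@big_ind _ K) => [|//|t /andP[wt /eqP lt]]; first by left.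
  by right; exists t.
have lastE q v : walk (rcons q v) -> p v <= weight s q + red (last s q) v.
  by move=> /ple; rewrite last_rcons -cats1 weight_cat /= addr0.
have ext q v : walk q -> v != s -> e (last s q) v -> walk (rcons q v).
  move=> /andP[pq sq] vs ev; rewrite /walk rcons_path pq ev mem_rcons inE negb_or.
  by rewrite eq_sym vs.
exists p; split=> [v vs ev|u v us vs euv|u us eus].
- by have := lastE [::] v (ext [::] v isT vs ev); rewrite add0r.
- have [->|[q [wq lq <-]]] := pat u.
    by apply: le_trans (pL v) _; rewrite lerDl red_ge0.
  by rewrite -lq; apply/lastE/ext; rewrite ?lq.
have [->|[q [wq lq <-]]] := pat u; first by rewrite lerDl red_ge0.
have [q' [wq' lq' uq' le']] := walk_uniq wq.
apply: le_trans (Lmin q' wq' uq' _) _; rewrite /cweight lq' lq //.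
by rewrite lerD2r.
Qed.

Hypothesis ess : e s s = false.

(* [inp] and [out] are the distances capped at the length of the shortest closed
   walk; they differ at [s] only, which is both the source and the target. *)
Lemma tight_potential q :
  walk q -> e (last s q) s ->
  (forall q', walk q' -> e (last s q') s -> (size q' < #|T|)%N ->
     cweight q <= cweight q' /\ (cweight q' = cweight q -> (size q <= size q')%N)) ->
  (size q < #|T|)%N ->
  [/\ uniq q &
  exists inp out : T -> R,
    [/\ forall v, v != s -> inp v = out v,
        forall u v, e u v -> inp v <= out u + red u v,
        forall i, (i <= size q)%N ->
          inp (vtx q i.+1) = out (vtx q i) + red (vtx q i) (vtx q i.+1)
      & forall i j, (i.+1 < j <= (size q).+1)%N -> e (vtx q i) (vtx q j) ->
          inp (vtx q j) < out (vtx q i) + red (vtx q i) (vtx q j)]].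
Proof.
move=> wq eq qmin ltq; set L := cweight q.
have uq : uniq q.
  apply/negPn/negP=> /(walk_cut wq)[q' [wq' lq' sq' leq']].
  have [||le1 le2] := qmin q' wq'; rewrite ?lq' //; first exact: ltn_trans ltq.
  have := le2; rewrite leqNgt sq' => h; apply/notF/h/le_anti.
  by rewrite le1 andbT /cweight lq' lerD2r.
split=> //.
have [q' wq' uq' eq'|p [p1 p2 p3]] := @potential_exists L.
  by have [] := qmin q' wq' eq' (walk_uniq_size wq' uq').
set k := size q.
have vnil : q != [::] by apply: contraTneq eq => ->; rewrite /= ess.
have k_gt0 : (0 < k)%N by rewrite /k; case: (q) vnil.
have vS i : (0 < i <= k)%N -> vtx q i != s.
  case: i => // i /= lti; apply: contraNneq (proj2 (andP wq)) => vs.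
  by have := mem_nth s lti; rewrite [nth s q i]vs.
have v0 : vtx q 0 = s by [].
have vk : vtx q k = last s q by rewrite -last_take // take_size.
have vk1 : vtx q k.+1 = s by rewrite /vtx nth_default.
have evv i : (i < k)%N -> e (vtx q i) (vtx q i.+1).
  by move=> lti; apply: (pathP s (proj1 (andP wq))).
pose P i := weight s (take i q).
have PS i : (i < k)%N -> P i.+1 = P i + red (vtx q i) (vtx q i.+1).
  move=> lti; rewrite /P (take_nth s) // -cats1 weight_cat /= addr0.
  by rewrite last_take ?(ltnW lti).
have P0 : P 0%N = 0 by rewrite /P take0.
have LE : L = P k + red (vtx q k) s by rewrite /L /cweight vk /P take_size.
pose out v := if v == s then 0 else p v.
pose inp v := if v == s then L else p v.
have outP u v : e u v -> inp v <= out u + red u v.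
  rewrite /inp /out; case: (altP (v =P s)) => [->|vs]; case: (altP (u =P s)) => [->|us].
  - by rewrite ess.
  - exact: p3.
  - by rewrite add0r; apply: p1.
  - exact: p2.
(* Along the walk [out] is bounded above by the prefix weight, by induction from the start, and
   below by it, by induction from the end, where the closing arc returns the total [L]. Hence all
   arcs of the walk are tight. *)
have le1 i : (i <= k)%N -> out (vtx q i) <= P i.
  elim: i => [|i IH] lei; first by rewrite v0 /out eqxx P0.
  have := outP _ _ (evv _ lei); rewrite /inp /out (negPf (vS i.+1 _)) // => h.
  by apply: le_trans h _; rewrite PS // lerD2r IH // ltnW.
have le2 j : (j <= k)%N -> P (k - j)%N <= out (vtx q (k - j)).
  elim: j => [|j IH] lej.
    have := outP _ _ eq; rewrite /inp eqxx LE -vk subn0 lerD2r.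
    by [].
  have ltj : (k - j.+1 < k)%N by rewrite ltn_subrL.
  have kj : (k - j.+1).+1 = (k - j)%N by rewrite -subSn // subSS.
  have := outP _ _ (evv _ ltj); rewrite kj => h.
  have := PS _ ltj; rewrite kj => h2.
  have h3 := IH (ltnW lej).
  have kj0 : vtx q (k - j) != s by apply: vS; rewrite subn_gt0 lej leq_subr.
  have : P (k - j.+1)%N + red (vtx q (k - j.+1)) (vtx q (k - j)) <=
         out (vtx q (k - j.+1)) + red (vtx q (k - j.+1)) (vtx q (k - j)).
    rewrite -h2; apply: le_trans h3 _; apply: le_trans h.
    by rewrite /out /inp (negPf kj0).
  by rewrite lerD2r.
have outE i : (i <= k)%N -> out (vtx q i) = P i.
  move=> lei; apply: le_anti; rewrite le1 //=.
  by have := le2 (k - i)%N; rewrite leq_subr subKn // => ->.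
have inpE i : (0 < i <= k)%N -> inp (vtx q i) = P i.
  move=> /[dup] /vS /negPf vs /andP[_ lei]; rewrite -outE //.
  by rewrite /inp /out vs.
have inpk : inp (vtx q k.+1) = L by rewrite vk1 /inp eqxx.
exists inp, out; split=> //.
- by move=> v; rewrite /inp /out => /negPf ->.
- move=> i; rewrite leq_eqVlt => /orP[/eqP->|lti].
    by rewrite inpk outE // vk1 LE.
  by rewrite inpE // outE ?(ltnW lti) // PS.
(* Equality on a shortcut would give a closed walk of the same weight with fewer arcs, whether the
   shortcut leads straight back to [s] or to a later element of [q]. *)
move=> i j /andP[ltij lej] eij; rewrite lt_neqAle outP // andbT.
apply/negP=> /eqP eqP.
have lti : (i < k)%N by rewrite -ltnS (leq_trans ltij).
move: lej eij eqP; rewrite leq_eqVlt => /orP[/eqP jk|ltj] eij.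
  rewrite jk in eij *; rewrite inpk outE ?(ltnW lti) // vk1 => eqL.
  have w' : walk (take i q).
    by have := @walk_splice q [::] i wq (ltnW lti) isT isT; rewrite cats0.
  have l' : last s (take i q) = vtx q i by rewrite last_take // ltnW.
  have sz : size (take i q) = i by rewrite size_takel // ltnW.
  rewrite vk1 in eij.
  have [] := qmin _ w'; rewrite ?l' ?sz ?(ltn_trans lti) //.
  move=> _; rewrite /cweight l' -/(P i) -eqL.
  by move=> /(_ erefl); rewrite leqNgt lti.
case: j => // j in ltij eij ltj *; rewrite ltnS in ltj.
rewrite inpE // outE ?(ltnW lti) // => eqL.
have /andP[pd sd] := path_drop wq ltj.
have dE : drop j q = vtx q j.+1 :: drop j.+1 q by rewrite (drop_nth s).
have w' : walk (take i q ++ drop j q).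
  apply: walk_splice; rewrite ?(ltnW lti) // dE /= ?eij //.
  by rewrite inE negb_or sd andbT eq_sym vS.
have l' : last s (take i q ++ drop j q) = last s q.
  by rewrite last_cat dE /= last_drop.
have sz : (size (take i q ++ drop j q) < size q)%N.
  rewrite size_cat size_takel ?(ltnW lti) // size_drop.
  by rewrite -[ltnRHS](subnKC (ltnW ltj)) ltn_add2r.
have [] := qmin _ w'; rewrite ?l' ?(ltn_trans sz) //.
move=> _; rewrite /cweight l' weight_cat last_take ?(ltnW lti) // dE /=.
rewrite addrA -/(P i) -eqL /P -weight_split //.
by move=> /(_ erefl); rewrite -dE leqNgt sz.
Qed.

End Walks.

(** * Weighted matroid intersection *)

Section Intersection.

Variables (R : realFieldType) (T : finType) (s : T) (c : T -> R).
Variables (ind1 ind2 : pred {set T}).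
Hypotheses (mat1 : matroid ind1) (mat2 : matroid ind2).
Hypotheses (ind1U : forall X, ind1 X -> ind1 (s |: X))
           (ind2U : forall X, ind2 X -> ind2 (s |: X)).
Implicit Types (I J B X : {set T}) (q : seq T) (u v : T).

Definition exarc B : rel T := fun u v =>
  [&& u \in B, v \notin B & ind1 (swap B u v)]
  || [&& u \notin B, v \in B & ind2 (swap B v u)].

Definition closed_walk B q := walk (exarc B) s q && exarc B (last s q) s.

(** For a repetition-free [q] this is the change of cost from [I] to [toggle I q]. *)
Definition alen I q : R := \sum_(v <- q) (if v \in I then - c v else c v).

Definition best_walk I q :=
  [/\ closed_walk (s |: I) q, (size q < #|T|)%N
    & forall q', closed_walk (s |: I) q' -> (size q' < #|T|)%N ->
        alen I q <= alen I q' /\ (alen I q' = alen I q -> (size q <= size q')%N)].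

Definition toggle I q : {set T} := [set v | (v \in I) (+) (v \in q)].

Definition min_indep (ind : pred {set T}) (w : T -> R) I :=
  forall X, s \notin X -> ind X -> #|X| = #|I| ->
    \sum_(v in I) w v <= \sum_(v in X) w v.

(** The weights [w1] and [w2] form a weight splitting in the sense of Frank: minimality in each
    matroid adds up to minimality for [c] among the common independent sets of size [k]. *)
Definition extreme k I :=
  [/\ #|I| = k, s \notin I, ind1 I /\ ind2 I
    & exists w1 w2 : T -> R,
        [/\ forall v, v != s -> w1 v + w2 v = c v, min_indep ind1 w1 I
          & min_indep ind2 w2 I]].

Lemma exarc_alt B u v : exarc B u v -> (v \in B) = (u \notin B).
Proof. by case/orP=> /and3P[h1 h2 _]; rewrite ?h1 ?(negPf h1) ?h2 ?(negPf h2). Qed.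

Lemma sum_setDU B (w : T -> R) (r : seq nat) (y x : nat -> T) :
  uniq (map y r) -> uniq (map x r) ->
  (forall i, i \in r -> y i \in B) -> (forall i, i \in r -> x i \notin B) ->
  \sum_(z in (B :\: [set z in map y r]) :|: [set z in map x r]) w z =
  \sum_(z in B) w z + \sum_(i <- r) (w (x i) - w (y i)).
Proof.
move=> uy ux yB xB; set Y := [set z in map y r]; set X := [set z in map x r].
have sumS (f : nat -> T) : uniq (map f r) ->
    \sum_(z in [set z in map f r]) w z = \sum_(i <- r) w (f i).
  by move=> uf; rewrite -(big_map f xpredT w) big_uniq //=; apply: eq_bigl => z;
    rewrite inE.
have YB : Y \subset B by apply/subsetP=> z; rewrite inE => /mapP[i /yB ? ->].
have dX : [disjoint B :\: Y & X].
  rewrite -setI_eq0; apply/eqP/setP=> z; rewrite !inE; apply/negP.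
  by move=> /andP[/andP[_ zB]] /mapP[i /xB h zE]; rewrite zE (negPf h) in zB.
rewrite (eq_bigl (fun z => (z \in B :\: Y) || (z \in X))); last by move=> z; rewrite inE.
rewrite bigU //= sumS // [in RHS](big_setID Y) /= (setIidPr YB) sumS // sumrB.
by ring.
Qed.

Section MinIndep.

Variables (ind : pred {set T}) (w : T -> R) (I : {set T}) (m : R).
Hypotheses (matI : matroid ind) (sI : s \notin I).
Hypotheses (wI : min_indep ind w I) (mw : forall v, m <= w v).

(** Giving [s] a weight below all others makes every exchange that removes [s] harmless; the
    remaining exchanges are exchanges of [I]. *)
Lemma min_indep_local :
  locally_min ind (fun v => if v == s then m else w v) (s |: I).
Proof.
move=> y x; rewrite !inE negb_or => yB /andP[xs xI] iyx; rewrite (negPf xs).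
case: eqP yB iyx => [->//|/eqP ys] /= yI iyx.
have sub : swap I y x \subset swap (s |: I) y x.
  by apply/subsetP=> z; rewrite !inE => /orP[->//|/andP[-> ->]]; rewrite !orbT.
have := wI _ (ind_sub matI sub iyx); rewrite !inE (negPf sI) andbF orbF eq_sym xs.
rewrite card_swap // sum_swap // => /(_ isT erefl).
by rewrite -addrA lerDl addrC subr_ge0.
Qed.

End MinIndep.

(** The two weights are shifted by the capped distances with opposite signs. Their sum stays [c] off
    [s], where [inp] and [out] agree, and [s |: I] stays locally minimal in each matroid. Every swap
    along the walk becomes neutral and every shortcut strictly costly, so [ind_weighted_swaps]
    applies; the new set has the same shifted weights as [s |: I], hence is minimal too. *)
Lemma extreme_step k I q : extreme k I -> best_walk I q ->
  uniq q /\ extreme k.+1 (toggle I q).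
Proof.
move=> [cI sI [iI1 iI2] [w1 [w2 [w12 min1 min2]]]] [/andP[wq eq] ltq qmin].
set B := s |: I in wq eq qmin *.
have sB : s \in B by rewrite setU11.
have iB1 : ind1 B by apply: ind1U.
have iB2 : ind2 B by apply: ind2U.
have cB : #|B| = k.+1 by rewrite cardsU1 sI cI.
have memB v : v != s -> (v \in B) = (v \in I) by rewrite !inE => /negPf ->.
pose m (w : T -> R) := \big[Order.min/0]_v w v.
have mP w v : m w <= w v by apply: bigmin_le.
pose W1 v := if v == s then m w1 else w1 v.
pose W2 v := if v == s then m w2 else w2 v.
have loc1 := min_indep_local mat1 sI min1 (mP w1).
have loc2 := min_indep_local mat2 sI min2 (mP w2).
rewrite -/W1 -/B in loc1; rewrite -/W2 -/B in loc2.
(* The length of an arc is the increase in weight of its swap, in the weight of the matroid that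
   provides the arc; local minimality makes it nonnegative. *)
pose red u v := if u \in B then W1 v - W1 u else W2 u - W2 v.
have red_ge0 u v : exarc B u v -> 0 <= red u v.
  rewrite /red; case/orP=> /and3P[uB vB iuv].
    by rewrite uB subr_ge0; apply: loc1.
  by rewrite (negPf uB) subr_ge0; apply: loc2.
(* On arcs [red] is [el] up to differences of the potential [h], which cancel around a closed walk.
   So minimizing [alen] over closed walks is minimizing the nonnegative lengths [red], up to the
   constant [el s]. *)
pose el v := if v \in B then - (W1 v + W2 v) else W1 v + W2 v.
pose h u := if u \in B then - W1 u else W2 u.
have redE u v : exarc B u v -> red u v = h u - h v + el v.
  move/exarc_alt; rewrite /red /h /el => ->; case: (u \in B) => /=.
    by ring.
  by ring.
have wE u q' : path (exarc B) u q' ->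
    weight red u q' = h u - h (last u q') + \sum_(v <- q') el v.
  elim: q' u => [|v q' IH] u /=; first by rewrite big_nil subrr addr0.
  case/andP=> euv pq; rewrite redE // IH // big_cons.
  by ring.
have ess : exarc B s s = false by rewrite /exarc sB.
have cwE q' : closed_walk B q' -> cweight s red q' = alen I q' + el s.
  case/andP=> /andP[pq sq] el'; rewrite /cweight wE // redE //.
  rewrite [LHS](_ : _ = \sum_(v <- q') el v + el s); last by ring.
  congr (_ + _); rewrite /alen.
  apply: eq_big_seq => v vq; have vs : v != s by apply: contraNneq sq => <-.
  by rewrite /el memB // /W1 /W2 (negPf vs) w12.
have cq : closed_walk B q by apply/andP.
have [||||uq [inp [out [io pot tight short]]]] :=
    @tight_potential R T (exarc B) s red red_ge0 ess q => //.
  move=> q' w' e' lt'; have cq' : closed_walk B q' by apply/andP.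
  rewrite !cwE // lerD2r; have [le1 le2] := qmin q' cq' lt'.
  by split=> // /addIr.
pose V1 v := W1 v - out v; pose V2 v := W2 v + inp v.
have nB v : v \notin B -> v != s by apply: contraNneq => ->.
have lV1 : locally_min ind1 V1 B.
  move=> y x yB xB iyx; have := pot y x; rewrite /exarc yB xB iyx /= => /(_ isT).
  rewrite /red yB io ?nB // /V1 => le1.
  by lra.
have lV2 : locally_min ind2 V2 B.
  move=> y x yB xB iyx; have := pot x y.
  rewrite /exarc yB xB iyx orbT /= => /(_ isT).
  by rewrite /red (negPf xB) -io ?nB // /V2 => le1; lra.
set n := size q; pose u := vtx s q.
have un1 : u n.+1 = s by rewrite /u /vtx nth_default.
have arcu i : (i <= n)%N -> exarc B (u i) (u i.+1).
  rewrite leq_eqVlt => /orP[/eqP->|lti]; last exact: (pathP s (proj1 (andP wq))).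
  by rewrite un1 /u -last_take // take_size.
have uB i : (i <= n.+1)%N -> (u i \in B) = ~~ odd i.
  by elim: i => [|i IH] lei //=; rewrite (exarc_alt (arcu i lei)) IH ?(ltnW lei).
pose l := n./2.
have nE : n = l.*2.+1.
  have := uB _ (leqnn _); rewrite un1 sB /= negbK => on.
  by rewrite -[LHS]odd_double_half -on.
have us : uniq (s :: q) by rewrite /= uq andbT; case/andP: wq.
have uinj i j : (i <= n)%N -> (j <= n)%N -> u i = u j -> i = j.
  by move=> lei lej /eqP; rewrite nth_uniq // => /eqP.
have uinj' i j : (0 < i <= n.+1)%N -> (0 < j <= n.+1)%N -> u i = u j -> i = j.
  have aux a b : (0 < a <= n.+1)%N -> (0 < b <= n)%N -> u a = u b -> a = b.
    move=> /andP[a0]; rewrite leq_eqVlt => /orP[/eqP->|lta] /andP[b0 leb] eab.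
      by have := uinj 0 b isT leb; rewrite -eab un1 => /(_ erefl) h'; rewrite -h' in b0.
    exact: uinj.
  move=> hi /andP[j0]; rewrite leq_eqVlt => /orP[/eqP->|ltj] eij; last first.
    by apply: aux; rewrite // j0.
  case/andP: hi => i0; rewrite leq_eqVlt => /orP[/eqP//|lti].
  by apply/esym/aux; rewrite ?i0 ?ltnS ?leqnn // -eij.
have usurj v : v \in s :: q -> exists2 i, (i <= n)%N & v = u i.
  by move=> vq; exists (index v (s :: q));
    rewrite /u /vtx ?nth_index // -ltnS -[n.+1]/(size (s :: q)) index_mem.
have umem i : (i <= n.+1)%N -> u i \in s :: q.
  rewrite leq_eqVlt => /orP[/eqP->|lti]; first by rewrite un1 mem_head.
  exact: mem_nth.
have setE (r : seq nat) (y x : nat -> T) :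
    (forall v, (v \in map y r) = (v \in s :: q) && (v \in B)) ->
    (forall v, (v \in map x r) = (v \in s :: q) && (v \notin B)) ->
  (B :\: [set z in map y r]) :|: [set z in map x r] = toggle I q.
  move=> hy hx; apply/setP=> v; rewrite !in_setU !in_setD !in_set hy hx.
  have [->|vs] := eqVneq v s.
    by rewrite sB mem_head /= (negPf sI); case/andP: wq => _ /negPf ->.
  by rewrite memB // in_set1 in_cons (negPf vs) /=; case: (v \in I); case: (v \in q).
have lbound i : i \in iota 0 l.+1 -> (i <= l)%N by rewrite mem_iota add0n ltnS.
have dbl i : (i <= l)%N -> (i.*2.+1 <= n)%N by rewrite nE ltnS leq_double.
(* The walk alternates between arcs of the first and of the second matroid. Arcs of the second lead
   from the element added to the element removed, so their pairs are numbered backwards: in both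
   numberings, exchanging [y i] for [x j] with [i < j] is then a forward shortcut. The element [s]
   is [y1 0] and [y2 0]. *)
pose y1 i := u i.*2; pose x1 i := u i.*2.+1.
pose y2 i := u (l - i).*2.+2; pose x2 i := u (l - i).*2.+1.
pose r := iota 0 l.+1.
have hy1 v : (v \in map y1 r) = (v \in s :: q) && (v \in B).
  apply/mapP/andP=> [[i /lbound lei ->]|[/usurj[j lej ->]]].
    by rewrite umem ?uB ?odd_double // ltnW // ltnW // ltnS dbl.
  rewrite uB ?leqW // => /negPf oj; exists j./2.
    by rewrite mem_iota add0n ltnS half_leq.
  by rewrite /y1 -[in LHS](odd_double_half j) oj.
have hx1 v : (v \in map x1 r) = (v \in s :: q) && (v \notin B).
  apply/mapP/andP=> [[i /lbound lei ->]|[/usurj[j lej ->]]].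
    by rewrite umem ?uB ?leqW ?dbl //= odd_double.
  rewrite uB ?leqW // negbK => oj; exists j./2.
    by rewrite mem_iota add0n ltnS half_leq.
  by rewrite /x1 -[in LHS](odd_double_half j) oj.
have hy2 v : (v \in map y2 r) = (v \in s :: q) && (v \in B).
  apply/mapP/andP=> [[i /lbound lei ->]|[/usurj[j lej ->]]].
    by rewrite umem ?uB ?ltnS ?dbl ?leq_subr //= odd_double.
  rewrite uB ?leqW // => /negPf oj.
  have jE : j = j./2.*2 by rewrite -[LHS]odd_double_half oj.
  have [j0|j0] := posnP j./2.
    exists 0%N; first by rewrite mem_iota.
    by rewrite /y2 subn0 jE j0 -nE un1.
  have lj : (j./2.-1 <= l)%N by rewrite (leq_trans (leq_pred _)) // half_leq.
  exists (l - j./2.-1)%N; first by rewrite mem_iota add0n ltnS leq_subr.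
  by rewrite /y2 subKn // -doubleS prednK // -jE.
have hx2 v : (v \in map x2 r) = (v \in s :: q) && (v \notin B).
  apply/mapP/andP=> [[i /lbound lei ->]|[/usurj[j lej ->]]].
    by rewrite umem ?uB ?leqW ?dbl ?leq_subr //= odd_double.
  rewrite uB ?leqW // negbK => oj; exists (l - j./2)%N.
    by rewrite mem_iota add0n ltnS leq_subr.
  by rewrite /x2 subKn ?half_leq // -[in LHS](odd_double_half j) oj.
have uy1 : uniq (map y1 r).
  rewrite map_inj_in_uniq ?iota_uniq // => i j /lbound li /lbound lj h'.
  by apply: double_inj; apply: uinj h'; rewrite ltnW // dbl.
have ux1 : uniq (map x1 r).
  rewrite map_inj_in_uniq ?iota_uniq // => i j /lbound li /lbound lj h'.
  by apply: double_inj; apply: succn_inj; apply: uinj h'; rewrite dbl.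
have linj i j : (i <= l)%N -> (j <= l)%N -> (l - i = l - j)%N -> i = j.
  by move=> li lj h'; rewrite -(subKn li) h' subKn.
have uy2 : uniq (map y2 r).
  rewrite map_inj_in_uniq ?iota_uniq // => i j /lbound li /lbound lj h'.
  apply: linj => //; apply: double_inj; do 2 apply: succn_inj.
  by apply: uinj' h'; rewrite /= ltnS dbl ?leq_subr.
have ux2 : uniq (map x2 r).
  rewrite map_inj_in_uniq ?iota_uniq // => i j /lbound li /lbound lj h'.
  apply: linj => //; apply: double_inj; apply: succn_inj.
  by apply: uinj h'; rewrite dbl ?leq_subr.
have E1 := setE r y1 x1 hy1 hx1; have E2 := setE r y2 x2 hy2 hx2.
have P1 i : i \in r -> [/\ y1 i \in B, x1 i \notin B, V1 (y1 i) = V1 (x1 i)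
    & ind1 (swap B (y1 i) (x1 i))].
  move=> /lbound li; have lei := dbl _ li.
  have yB : y1 i \in B by rewrite uB ?odd_double // ltnW // ltnW.
  have xB : x1 i \notin B by rewrite uB /= ?odd_double ?leqW.
  have := arcu _ (ltnW lei); rewrite -/(y1 i) -/(x1 i) => ar.
  split=> //; last by move: ar; rewrite /exarc yB xB orbF.
  have := tight _ (ltnW lei); rewrite -/u -/(y1 i) -/(x1 i) /V1 -(io (x1 i)) ?nB // => ->.
  by rewrite /red yB; ring.
have P2 i : i \in r -> [/\ y2 i \in B, x2 i \notin B, V2 (y2 i) = V2 (x2 i)
    & ind2 (swap B (y2 i) (x2 i))].
  move=> /lbound li; have lei := dbl _ (leq_subr i l).
  have yB : y2 i \in B by rewrite uB /= ?odd_double ?ltnS.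
  have xB : x2 i \notin B by rewrite uB /= ?odd_double ?leqW.
  have := arcu _ lei; rewrite -/(y2 i) -/(x2 i) => ar.
  split=> //; last by move: ar; rewrite /exarc yB (negPf xB).
  have := tight _ lei; rewrite -/u -/(y2 i) -/(x2 i) /V2 -(io (x2 i)) ?nB // => ->.
  by rewrite /red (negPf xB); ring.
have iT1 : ind1 (toggle I q).
  rewrite -E1; apply: (ind_weighted_swaps mat1 iB1 lV1) => //; first exact: iota_uniq.
  move=> i j /lbound li /lbound lj ltij iij.
  have [yB _ _ _] : [/\ y1 i \in B, x1 i \notin B, V1 (y1 i) = V1 (x1 i)
    & ind1 (swap B (y1 i) (x1 i))] by apply: P1; rewrite mem_iota add0n ltnS.
  have [_ xB _ _] : [/\ y1 j \in B, x1 j \notin B, V1 (y1 j) = V1 (x1 j)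
    & ind1 (swap B (y1 j) (x1 j))] by apply: P1; rewrite mem_iota add0n ltnS.
  have := short i.*2 j.*2.+1;
    rewrite ltnS ltn_double ltij ltnS (ltnW (dbl _ lj)) /= => /(_ isT).
  rewrite -/u -/(y1 i) -/(x1 j) /exarc yB xB iij => /(_ isT).
  by rewrite /red yB io ?nB // /V1 => lt1; lra.
have iT2 : ind2 (toggle I q).
  rewrite -E2; apply: (ind_weighted_swaps mat2 iB2 lV2) => //; first exact: iota_uniq.
  move=> i j /lbound li /lbound lj ltij iij.
  have [yB _ _ _] : [/\ y2 i \in B, x2 i \notin B, V2 (y2 i) = V2 (x2 i)
    & ind2 (swap B (y2 i) (x2 i))] by apply: P2; rewrite mem_iota add0n ltnS.
  have [_ xB _ _] : [/\ y2 j \in B, x2 j \notin B, V2 (y2 j) = V2 (x2 j)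
    & ind2 (swap B (y2 j) (x2 j))] by apply: P2; rewrite mem_iota add0n ltnS.
  have := short (l - j).*2.+1 (l - i).*2.+2.
  have -> : ((l - j).*2.+2 < (l - i).*2.+2 <= n.+1)%N.
    by rewrite nE; clear -ltij li lj; lia.
  move=> /(_ isT).
  rewrite -/u -/(y2 i) -/(x2 j) /exarc yB xB iij orbT => /(_ isT).
  by rewrite /red (negPf xB) -io ?nB // /V2 => lt1; lra.
have sumT1 (w : T -> R) : (forall i, i \in r -> w (y1 i) = w (x1 i)) ->
    \sum_(z in toggle I q) w z = \sum_(z in B) w z.
  move=> hw; rewrite -E1 sum_setDU //; try by move=> i /P1[].
  rewrite [X in _ + X]big_seq [X in _ + X]big1 ?addr0 // => i /hw ->.
  exact: subrr.
have sumT2 (w : T -> R) : (forall i, i \in r -> w (y2 i) = w (x2 i)) ->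
    \sum_(z in toggle I q) w z = \sum_(z in B) w z.
  move=> hw; rewrite -E2 sum_setDU //; try by move=> i /P2[].
  rewrite [X in _ + X]big_seq [X in _ + X]big1 ?addr0 // => i /hw ->.
  exact: subrr.
(* The weight identity for the constant weight [1] is equality of cardinalities. *)
have cT : #|toggle I q| = k.+1.
  have := sumT1 (fun=> 1) (fun _ _ => erefl); rewrite !sumr_const cB => /eqP.
  by rewrite eqr_nat => /eqP.
split=> //; split=> //; first by rewrite inE (negPf sI); case/andP: wq.
exists V1, V2; split.
- by move=> v vs; rewrite /V1 /V2 io // /W1 /W2 (negPf vs) -w12 //; ring.
- move=> X sX iX cX; rewrite sumT1; last by move=> i /P1[].
  by apply: (locally_min_min mat1) => //; rewrite cX cT cB.
- move=> X sX iX cX; rewrite sumT2; last by move=> i /P2[].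
  by apply: (locally_min_min mat2) => //; rewrite cX cT cB.
Qed.

(** Let [U] be the elements reached from [s] when no closed walk exists. An element of [J] outside
    [U] extending [I :\: U] in the first matroid would be reached through an exchange; one of [J]
    inside [U] extending [I :&: U] in the second would reach a further element of [I], or close the
    walk at [s]. So [J] is no larger than [I] on either side of [U]. *)
Lemma closed_walk_exists I J : s \notin I -> ind1 I -> ind2 I ->
  s \notin J -> ind1 J -> ind2 J -> (#|I| < #|J|)%N ->
  exists2 q, closed_walk (s |: I) q & (size q < #|T|)%N.
Proof.
move=> sI i1 i2 sJ j1 j2 ltIJ; set B := s |: I.
pose e' : rel T := fun u v => exarc B u v && (v != s).
pose U := [set v | (v != s) && connect e' s v].
have [/exists_inP[u]|noex] := boolP [exists u in U, exarc B u s].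
  rewrite inE => /andP[us /connectP[p pp uE]] eus.
  move: pp uE; case/shortenP=> p' pp' up' _ uE.
  have wp : walk (exarc B) s p'.
    rewrite /walk; move: up' => /= /andP[-> _]; rewrite andbT.
    by apply: sub_path pp' => a b /andP[].
  exists p'; first by rewrite /closed_walk wp -uE.
  by apply: walk_uniq_size wp _; move: up' => /= /andP[].
have cl u v : u \in s |: U -> exarc B u v -> v \in U.
  move=> uU euv; have vs : v != s.
    apply: contraNneq noex => vs; apply/exists_inP; exists u; last by rewrite -vs.
    move: uU; rewrite !inE => /orP[/eqP us|//]; move: euv.
    by rewrite vs us /exarc !inE eqxx.
  have cu : connect e' s u by move: uU; rewrite !inE => /orP[/eqP->|/andP[]].
  by rewrite inE vs (connect_trans cu) // connect1 // /e' euv.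
have pB (Z : {set T}) : Z \subset I -> Z \proper B.
  move=> ZI; apply/properP; split; first by rewrite (subset_trans ZI) ?subsetUr.
  by exists s; [rewrite setU11|apply: contra sI; apply/subsetP].
have le1 : (#|J :\: U| <= #|I :\: U|)%N.
  rewrite leqNgt; apply/negP=> lt1.
  have iI1 : ind1 (I :\: U) by apply: ind_sub mat1 _ _ (subsetDl _ _) i1.
  have jI1 : ind1 (J :\: U) by apply: ind_sub mat1 _ _ (subsetDl _ _) j1.
  have [x /setDP[/setDP[xJ xU] xI] ix] := ind_aug mat1 iI1 jI1 lt1.
  have xs : x != s by apply: contraNneq sJ => <-.
  have xI' : x \notin I by move: xI; rewrite inE xU.
  have xB : x \notin B by rewrite !inE negb_or xs.
  have [y /setDP[yB yI] iyx] :=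
    ind_swap_out mat1 (ind1U i1) xB (pB _ (subsetDl I U)) ix.
  case/negP: xU; apply: (cl y); last by rewrite /exarc yB xB iyx.
  move: yB yI; rewrite in_setD !in_setU1 => /orP[->//|yI].
  by rewrite yI andbT negbK => ->; rewrite orbT.
have le2 : (#|J :&: U| <= #|I :&: U|)%N.
  rewrite leqNgt; apply/negP=> lt1.
  have iI2 : ind2 (I :&: U) by apply: ind_sub mat2 _ _ (subsetIl _ _) i2.
  have jI2 : ind2 (J :&: U) by apply: ind_sub mat2 _ _ (subsetIl _ _) j2.
  have [x /setDP[/setIP[xJ xU] xI] ix] := ind_aug mat2 iI2 jI2 lt1.
  have xs : x != s by apply: contraNneq sJ => <-.
  have xI' : x \notin I by move: xI; rewrite inE xU andbT.
  have xB : x \notin B by rewrite !inE negb_or xs.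
  have [y /setDP[yB yI] iyx] :=
    ind_swap_out mat2 (ind2U i2) xB (pB _ (subsetIl I U)) ix.
  have exy : exarc B x y by rewrite /exarc yB xB iyx orbT.
  have yU : y \in U by apply: cl exy; rewrite inE xU orbT.
  move: yB yI; rewrite in_setI yU andbT in_setU1 => /orP[/eqP ys _|->//].
  by move: yU; rewrite ys inE eqxx.
by move: ltIJ; rewrite ltnNge -(cardsID U J) -(cardsID U I) leq_add.
Qed.

Lemma extreme0 : ind1 set0 -> ind2 set0 -> extreme 0 set0.
Proof.
move=> i1 i2; split; rewrite ?cards0 ?inE //; exists c, (fun=> 0); split.
- by move=> v _; rewrite addr0.
- by move=> X _ _; rewrite cards0 => /cards0_eq ->.
- by move=> X _ _; rewrite cards0 => /cards0_eq ->.
Qed.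

Lemma extreme_min k I J : extreme k I -> s \notin J -> ind1 J -> ind2 J ->
  #|J| = k -> \sum_(v in I) c v <= \sum_(v in J) c v.
Proof.
move=> [cI sI _ [w1 [w2 [w12 m1 m2]]]] sJ j1 j2 cJ.
have E X : s \notin X -> \sum_(v in X) c v = \sum_(v in X) w1 v + \sum_(v in X) w2 v.
  move=> sX; rewrite -big_split /=; apply: eq_bigr => v vX; rewrite w12 //.
  by apply: contraNneq sX => <-.
by rewrite !E // lerD ?m1 ?m2 ?cJ ?cI.
Qed.

End Intersection.

(** * Graphic matroids *)

Section ClosureMatroid.

Variables (T : finType) (cl : {set T} -> pred T).
Implicit Types (X Y : {set T}) (x y z : T).
Hypothesis cl_mem : forall X x, x \in X -> cl X x.
Hypothesis cl_sub : forall X Y x, X \subset Y -> cl X x -> cl Y x.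
Hypothesis cl_trans :
  forall X Y x, (forall y, y \in Y -> cl X y) -> cl Y x -> cl X x.
Hypothesis cl_exchange :
  forall X x y, cl (y |: X) x -> ~~ cl X x -> cl (x |: X) y.

Definition cl_indep X := [forall x in X, ~~ cl (X :\ x) x].

Lemma cl_indepU1 X y : cl_indep X -> ~~ cl X y -> cl_indep (y |: X).
Proof.
move=> /forall_inP iX ncl; have yX : y \notin X by apply: contra ncl; apply: cl_mem.
apply/forall_inP=> z; rewrite !inE => /orP[/eqP->|zX]; first by rewrite setU1K.
have zy : z != y by apply: contraNneq yX => <-.
apply: contra ncl => h; rewrite -(setD1K zX).
apply: cl_exchange; last exact: iX.
rewrite (_ : y |: X :\ z = (y |: X) :\ z) //; apply/setP=> t; rewrite !inE.
by case: (altP (t =P y)) => [->|] //=; rewrite eq_sym zy.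
Qed.

Lemma cl_indep_sub X Y : X \subset Y -> cl_indep Y -> cl_indep X.
Proof.
move=> sXY /forall_inP iY; apply/forall_inP=> x xX.
apply: contra (iY x (subsetP sXY x xX)); apply: cl_sub; exact: setSD.
Qed.

(** The elements of [Y] outside [X] are replaced one by one by elements of [X]. A replacement for
    [y] exists, for otherwise [Y :\ y] would span [X] and with it [y]. *)
Lemma steinitz X Y : cl_indep Y -> (forall y, y \in Y -> cl X y) -> (#|Y| <= #|X|)%N.
Proof.
move: {2}#|Y :\: X| (erefl #|Y :\: X|) => d.
elim: d Y => [|d IH] Y dE iY spY.
  by apply: subset_leq_card; rewrite -setD_eq0; apply/eqP/cards0_eq.
have /set0Pn[y /setDP[yY yX]] : Y :\: X != set0 by rewrite -card_gt0 dE.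
have ny : ~~ cl (Y :\ y) y by move/forall_inP: iY; apply.
have [x xX nx] : exists2 x, x \in X & ~~ cl (Y :\ y) x.
  apply/exists_inP; apply: contraNT ny; rewrite negb_exists_in => /forall_inP h.
  by apply: cl_trans (spY y yY) => x xX; apply/negPn/h.
have iY' : cl_indep (x |: Y :\ y).
  by apply: cl_indepU1 => //; apply: cl_indep_sub iY; apply: subD1set.
have xY : x \notin Y :\ y by apply: contra nx; apply: cl_mem.
have cY : #|x |: Y :\ y| = #|Y| by rewrite cardsU1 xY (cardsD1 y Y) yY.
rewrite -cY; apply: IH => //.
  apply: succn_inj; rewrite -dE (cardsD1 y (Y :\: X)) !inE yY yX add1n; congr _.+1.
  by apply: eq_card => z; rewrite !inE; case: (altP (z =P x)) => [->|_] /=;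
    rewrite ?xX ?andbF // andbCA.
by move=> z; rewrite !inE => /orP[/eqP->|/andP[_ /spY//]]; apply: cl_mem.
Qed.

Lemma cl_matroid : matroid cl_indep.
Proof.
split; first exact: cl_indep_sub.
move=> X Y iX iY ltXY.
have [y yY ny] : exists2 y, y \in Y & ~~ cl X y.
  apply/exists_inP; apply: contraLR ltXY; rewrite negb_exists_in -leqNgt => /forall_inP h.
  by apply: steinitz => // y yY; apply/negPn/h.
exists y; last exact: cl_indepU1.
by rewrite inE yY andbT; apply: contra ny; apply: cl_mem.
Qed.

End ClosureMatroid.

(** * The cycle matroid of a graph *)

Section Graphic.

Variables (T V : finType) (f g : T -> V).
Implicit Types (X Y : {set T}) (x y : T) (u v : V) (U : {set V}).

Definition gadj X : rel V := fun u v =>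
  [exists x in X, [&& f x == u & g x == v] || [&& f x == v & g x == u]].

Definition spanned X x := connect (gadj X) (f x) (g x).

Definition forest := cl_indep spanned.

Lemma gadj_sym X : symmetric (gadj X).
Proof. by move=> u v; apply: eq_existsb => x; rewrite orbC. Qed.

Lemma gconn_sym X : connect_sym (gadj X).
Proof. exact: sym_connect_sym (gadj_sym X). Qed.

Lemma gadjP X u v : reflect
  (exists2 x, x \in X & (u = f x /\ v = g x) \/ (u = g x /\ v = f x)) (gadj X u v).
Proof.
apply: (iffP exists_inP) => [][x xX].
  by case/orP=> /andP[/eqP <- /eqP <-]; exists x => //; [left|right].
by case=> [][-> ->]; exists x; rewrite ?eqxx ?orbT.
Qed.

Lemma gconn_ind X (Q : V -> Prop) u v : Q u ->
  (forall a b, Q a -> gadj X a b -> Q b) -> connect (gadj X) u v -> Q v.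
Proof.
move=> Qu step /connectP[p + ->]; elim: p u Qu => //= a p IH u Qu /andP[ua].
by apply: IH; apply: step ua.
Qed.

Lemma spanned_mem X x : x \in X -> spanned X x.
Proof. by move=> xX; apply/connect1/gadjP; exists x => //; left. Qed.

Lemma gconn_trans X Y u v : (forall y, y \in Y -> spanned X y) ->
  connect (gadj Y) u v -> connect (gadj X) u v.
Proof.
move=> sp; apply: connect_sub => a b /gadjP[x xY [][-> ->]]; first exact: sp.
by rewrite gconn_sym; apply: sp.
Qed.

Lemma gconn_subset X Y u v : X \subset Y ->
  connect (gadj X) u v -> connect (gadj Y) u v.
Proof.
by move=> sXY; apply: gconn_trans => x xX; apply: spanned_mem; apply: (subsetP sXY).
Qed.

(** A connection has to cross the new edge at most once, in one of two directions. The formula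
    yields the exchange property and later the correctness of merging component labels. *)
Lemma gconnU1 X x u v : connect (gadj (x |: X)) u v =
  [|| connect (gadj X) u v,
      connect (gadj X) u (f x) && connect (gadj X) (g x) v
    | connect (gadj X) u (g x) && connect (gadj X) (f x) v].
Proof.
have sub a b : connect (gadj X) a b -> connect (gadj (x |: X)) a b.
  by apply: gconn_subset; apply: subsetUr.
have sx : connect (gadj (x |: X)) (f x) (g x) by apply: spanned_mem; rewrite setU11.
apply/idP/idP; last first.
  case/or3P=> [|/andP[h1 h2]|/andP[h1 h2]]; first exact: sub.
    by apply: connect_trans (sub _ _ h1) (connect_trans sx (sub _ _ h2)).
  apply: connect_trans (sub _ _ h1) (connect_trans _ (sub _ _ h2)).
  by rewrite gconn_sym.
have stp a b : gadj (x |: X) a b ->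
    gadj X a b \/ (a = f x /\ b = g x) \/ (a = g x /\ b = f x).
  case/gadjP=> y; rewrite !inE => /orP[/eqP->|yX] h; first by right.
  by left; apply/gadjP; exists y.
apply: (gconn_ind (Q := fun b => [|| connect (gadj X) u b,
    connect (gadj X) u (f x) && connect (gadj X) (g x) b
  | connect (gadj X) u (g x) && connect (gadj X) (f x) b])); first by rewrite connect0.
move=> a b Qa /stp[ab|[[aE bE]|[aE bE]]].
- have cab := connect1 ab; case/or3P: Qa => [h|/andP[h1 h2]|/andP[h1 h2]].
  + by rewrite (connect_trans h cab).
  + by rewrite h1 (connect_trans h2 cab) !orbT.
  + by rewrite h1 (connect_trans h2 cab) !orbT.
- rewrite aE in Qa; rewrite bE; case/or3P: Qa => [h|/andP[h1 h2]|/andP[h1 h2]].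
  + by rewrite h connect0 orbT.
  + by rewrite h1 connect0 orbT.
  + by rewrite h1.
rewrite aE in Qa; rewrite bE; case/or3P: Qa => [h|/andP[h1 h2]|/andP[h1 h2]].
+ by rewrite h connect0 !orbT.
+ by rewrite h1.
+ by rewrite h1 connect0 !orbT.
Qed.

Lemma spanned_exchange X x y : spanned (y |: X) x -> ~~ spanned X x -> spanned (x |: X) y.
Proof.
rewrite /spanned !gconnU1 => /or3P[->//|/andP[h1 h2]|/andP[h1 h2]] _; apply/or3P.
  by apply: Or32; rewrite gconn_sym h1 gconn_sym h2.
by apply: Or33; rewrite h2 h1.
Qed.

Lemma spanned_sub X Y x : X \subset Y -> spanned X x -> spanned Y x.
Proof. exact: gconn_subset. Qed.

Lemma spanned_trans X Y x : (forall y, y \in Y -> spanned X y) -> spanned Y x ->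
  spanned X x.
Proof. exact: gconn_trans. Qed.

Lemma forest_matroid : matroid forest.
Proof.
apply: cl_matroid; [exact: spanned_mem|exact: spanned_sub|exact: spanned_trans|].
exact: spanned_exchange.
Qed.

Lemma forestU1 X x : x \notin X -> forest (x |: X) = forest X && ~~ spanned X x.
Proof.
move=> xX; apply/idP/andP=> [h|[h1 h2]].
  split; first by apply: ind_sub forest_matroid _ _ _ h; apply: subsetUr.
  by move/forall_inP: h => /(_ x (setU11 _ _)); rewrite setU1K.
by apply: cl_indepU1 h1 h2; [exact: spanned_mem|exact: spanned_exchange].
Qed.

Lemma forest0 : forest set0.
Proof. by apply/forall_inP=> x; rewrite inE. Qed.

Lemma gconn_closed X U u v : (forall x, x \in X -> (f x \in U) = (g x \in U)) ->
  connect (gadj X) u v -> u \in U -> v \in U.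
Proof.
move=> h + uU; apply: (gconn_ind (Q := fun b => b \in U)) => // a b aU /gadjP[x xX
  [][aE bE]].
  by rewrite bE -h // -aE.
by rewrite bE h // -aE.
Qed.

(** Removing an edge [x] from the forest separates its ends, so [U] splits into the component [S] of
    [f x] and a rest containing [g x]; no other edge crosses, and induction applies to both
    sides. *)
Lemma forest_card X U : forest X -> U != set0 ->
  (forall x, x \in X -> (f x \in U) && (g x \in U)) -> (#|X| < #|U|)%N.
Proof.
have [n] := ubnP #|X|; elim: n X U => // n IH X U /ltnSE leX fX U0 inU.
have [->|/set0Pn[x xX]] := eqVneq X set0; first by rewrite cards0 card_gt0.
pose X' := X :\ x; pose S := [set v in U | connect (gadj X') (f x) v].
have cX : #|X| = #|X'|.+1 by rewrite (cardsD1 x) xX.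
have nx : ~~ spanned X' x by move/forall_inP: fX; apply.
have [fU gU] := andP (inU x xX).
have fX' : forest X' by apply: ind_sub forest_matroid _ _ (subD1set _ _) fX.
have inX' y : y \in X' -> (f y \in S) = (g y \in S).
  move=> yX'; have /andP[h1 h2] := inU y (subsetP (subD1set _ _) y yX').
  rewrite !inE h1 h2 /=; have := spanned_mem yX' => h.
  apply/idP/idP=> h'; first exact: connect_trans h.
  by apply: connect_trans h' _; rewrite gconn_sym.
pose Y := [set y in X' | f y \in S].
have leY : (#|Y| < #|S|)%N.
  apply: IH.
  - by rewrite (leq_trans _ leX) // cX ltnS subset_leq_card //; apply/subsetP=> y;
    rewrite inE => /andP[].
  - by apply: ind_sub forest_matroid _ _ _ fX'; apply/subsetP=> y; rewrite inE => /andP[].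
  - by apply/set0Pn; exists (f x); rewrite inE fU connect0.
  - by move=> y; rewrite inE => /andP[yX' h]; rewrite -inX' // h.
have leZ : (#|X' :\: Y| < #|U :\: S|)%N.
  apply: IH.
  - by rewrite (leq_trans _ leX) // cX ltnS subset_leq_card // subsetDl.
  - by apply: ind_sub forest_matroid _ _ _ fX'; apply: subsetDl.
  - by apply/set0Pn; exists (g x); rewrite in_setD gU andbT inE gU.
  - move=> y /setDP[yX']; rewrite [y \in Y]inE yX' /= => h;
    have /andP[h1 h2] := inU y (subsetP (subD1set _ _) y yX').
    by rewrite !in_setD h1 h2 -inX' // h.
have sS : S \subset U by apply/subsetP=> v; rewrite inE => /andP[].
have sY : Y \subset X' by apply/subsetP=> v; rewrite inE => /andP[].
rewrite cX -(cardsID Y X') -(cardsID S U) (setIidPr sS) (setIidPr sY).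
by clear -leY leZ; lia.
Qed.

End Graphic.

(** * Adjoining a coloop *)

Section OptionMatroid.

Variables (A : finType) (ind : pred {set A}).

(** Ignoring [None] makes it a coloop: this is the artificial element of the exchange graph. *)
Definition oind (X : {set option A}) : bool := ind (Some @^-1: X).

Lemma card_oset (X : {set option A}) : #|X| = ((None \in X) + #|Some @^-1: X|)%N.
Proof.
rewrite (cardsD1 None X); congr addn; rewrite -[RHS](card_imset _ Some_inj).
apply: eq_card => [][a|]; rewrite !inE; last by apply/esym/negP=> /imsetP[].
by rewrite mem_imset ?inE //; apply: Some_inj.
Qed.

Lemma preimU1_None (X : {set option A}) : Some @^-1: (None |: X) = Some @^-1: X.
Proof. by apply/setP=> a; rewrite !inE. Qed.

Lemma preimU1_Some (X : {set option A}) a : Some @^-1: (Some a |: X) = a |: Some @^-1: X.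
Proof. by apply/setP=> b; rewrite !inE. Qed.

Lemma oind_None X : oind X -> oind (None |: X).
Proof. by rewrite /oind preimU1_None. Qed.

Lemma oind_matroid : matroid ind -> matroid oind.
Proof.
move=> mI; split=> [X Y sXY|X Y iX iY ltXY].
  by apply: ind_sub mI _ _ _; apply: preimsetS.
have [NY|NY] := boolP (None \in Y :\: X).
  by exists None => //; apply: oind_None.
have [|a] := ind_aug mI iX iY.
  move: ltXY NY; rewrite !card_oset !inE.
  by case: (None \in X); case: (None \in Y) => //= *; apply: ltnW.
rewrite !inE => /andP[aX aY] ia; exists (Some a); first by rewrite !inE aX.
by rewrite /oind preimU1_Some.
Qed.

End OptionMatroid.

(** * Disjoint arborescences *)

Section Arborescences.

Variables (V A : finType) (tl hd : A -> V) (r : V).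
Implicit Types (D S : {set A}) (U X Y : {set V}) (a b : A).

Definition enters X a := (hd a \in X) && (tl a \notin X).

Definition indeg D X : nat := \sum_(a in D) enters X a.

Definition arborescence U S :=
  [/\ r \in U, forall a, a \in S -> [/\ tl a \in U, hd a \in U & hd a != r],
      forall v, v \in U -> v != r -> #|[set a in S | hd a == v]| = 1%N
    & forest tl hd S].

Lemma indeg_gt0 D X : (0 < indeg D X)%N -> exists2 a, a \in D & enters X a.
Proof.
move=> h; apply/exists_inP; apply: contraTT h; rewrite negb_exists_in => /forall_inP h.
by rewrite /indeg big1 // => a /h /negPf ->.
Qed.

Lemma indeg_ge2P D X : reflect
  (exists a b, [/\ a \in D, b \in D, a != b, enters X a & enters X b])
  (1 < indeg D X)%N.
Proof.
apply: (iffP idP) => [h|[a [b [aD bD ab ea eb]]]]; last first.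
  by rewrite /indeg (bigD1 a) // (bigD1 b) ?bD ?[b == a]eq_sym //= ea eb.
have [a aD ea] := indeg_gt0 (ltnW h).
have : (0 < indeg (D :\ a) X)%N.
  by move: h; rewrite /indeg (big_setD1 a) //= ea.
by case/indeg_gt0=> b; rewrite !inE => /andP[ba bD] eb; exists a, b; rewrite eq_sym.
Qed.

Lemma indeg_submod D X Y :
  (indeg D (X :&: Y) + indeg D (X :|: Y) <= indeg D X + indeg D Y)%N.
Proof.
rewrite /indeg -!big_split /=; apply: leq_sum => a _; rewrite /enters !inE.
by do !case: (_ \in _).
Qed.

Lemma indegD1 D X a : a \in D -> indeg D X = (enters X a + indeg (D :\ a) X)%N.
Proof. by move=> aD; rewrite /indeg (big_setD1 a). Qed.

Lemma arborescence1 : arborescence [set r] set0.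
Proof.
split; rewrite ?inE //; last exact: forest0.
- by move=> a; rewrite in_set0.
- by move=> v; rewrite inE => ->.
Qed.

Lemma arborescenceU1 U S a : arborescence U S -> tl a \in U -> hd a \notin U ->
  arborescence (hd a |: U) (a |: S).
Proof.
move=> [rU inS degS fS] tU hU.
have aS : a \notin S by apply: contra hU => /inS[].
split; first by rewrite inE rU orbT.
- move=> b; rewrite !inE => /orP[/eqP->|/inS[-> -> ->]]; last by rewrite !orbT.
  by rewrite tU eqxx orbT; split=> //; apply: contraNneq hU => ->.
- move=> v; rewrite in_setU1 => vU vr; have [vh|vh] := eqVneq v (hd a).
    rewrite (_ : [set _ in _ | _] = [set a]) ?cards1 //; apply/setP=> b; rewrite !inE vh.
    have [->|_] /= := eqVneq b a; first by rewrite eqxx.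
    by apply/andP=> [][/inS[_ bU _] /eqP hb]; rewrite -hb bU in hU.
  rewrite -(degS v) //; last by move: vU; rewrite (negPf vh).
  apply: eq_card => b; rewrite !inE; have [->|_] //= := eqVneq b a.
  by rewrite [hd a == v]eq_sym (negPf vh) andbF.
rewrite forestU1 // fS; apply: contra hU => /gconn_closed; apply=> // b /inS[-> ->].
by [].
Qed.

Lemma arborescence_grow D U S : 
  (forall X, X != set0 -> r \notin X -> (0 < indeg D X)%N) ->
  S \subset D -> arborescence U S ->
  exists2 S' : {set A}, S' \subset D & arborescence setT S'.
Proof.
move=> cutD; have [n] := ubnP #|~: U|; elim: n U S => // n IH U S /ltnSE leU sD arb.
have [U0|U0] := eqVneq (~: U) set0.
  by exists S => //; rewrite -(setCK U) U0 setC0 in arb.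
have rU : r \notin ~: U by rewrite inE negbK; case: arb.
have [a aD] := indeg_gt0 (cutD _ U0 rU); rewrite /enters !inE negbK => /andP[hU tU].
apply: IH (arborescenceU1 arb tU hU); last by rewrite subUset sub1set aD.
apply: leq_trans leU; apply: proper_card; apply/properP; split.
  by rewrite setCS subsetUr.
by exists (hd a); rewrite !inE // eqxx.
Qed.

(* Lovász's proof of Edmonds' disjoint arborescences theorem for two
   arborescences: grow the first one keeping every root cut of the remaining
   arcs nonempty. *)
Lemma disjoint_arborescences_grow D U S :
  (forall X, X != set0 -> r \notin X -> (1 < indeg D X)%N) ->
  S \subset D -> arborescence U S ->
  (forall X, X != set0 -> r \notin X -> (0 < indeg (D :\: S) X)%N) ->
  exists S1 S2 : {set A}, [/\ S1 \subset D, S2 \subset D, [disjoint S1 & S2],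
    arborescence setT S1 & arborescence setT S2].
Proof.
move=> cutD; have [n] := ubnP #|~: U|; elim: n U S => // n IH U S /ltnSE leU sD arb cutS.
have [U0|U0] := eqVneq (~: U) set0.
  have arbT : arborescence setT S by rewrite -(setCK U) U0 setC0 in arb.
  have [S2 sS2 arb2] := arborescence_grow cutS (sub0set _) arborescence1.
  exists S, S2; split=> //; first by apply: subset_trans sS2 (subsetDl _ _).
  rewrite disjoint_sym disjoints_subset (subset_trans sS2) //.
  by apply/subsetP=> a; rewrite !inE => /andP[].
have [rU inS _ _] := arb.
set D' := D :\: S in cutS.
(* No arc of [S] has its head outside [U], so a set disjoint from [U] keeps all its entering arcs in
   [D']. *)
have out2 X : X != set0 -> [disjoint X & U] -> (1 < indeg D' X)%N.
  move=> X0 dXU; have rX : r \notin X by rewrite (disjointFl dXU rU).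
  rewrite (leq_trans (cutD X X0 rX)) // /indeg (big_setID S) /= big1 ?add0n //.
  move=> a /setIP[_ /inS[_ hU _]]; rewrite /enters.
  by have := disjointFl dXU hU => ->.
(* Adding an arc that leaves [U] can only hurt a set entered by no other arc of [D']. A set
   contained in [U] is not entered by such an arc and need not be considered. *)
pose tight X := [&& r \notin X, ~~ (X \subset U) & (indeg D' X <= 1)%N].
suff [a [aD' tU hU atight]] : exists a, [/\ a \in D', tl a \in U, hd a \notin U
    & forall Y, tight Y -> ~~ enters Y a].
  have aD : a \in D by move: aD'; rewrite inE => /andP[].
  apply: IH (arborescenceU1 arb tU hU) _.
  - apply: leq_trans leU; apply: proper_card; apply/properP; split.
      by rewrite setCS subsetUr.
    by exists (hd a); rewrite !inE // eqxx.
  - by rewrite subUset sub1set aD.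
  move=> Y Y0 rY; have -> : D :\: (a |: S) = D' :\ a.
    by apply/setP=> b; rewrite !inE negb_or andbA.
  have := indegD1 Y aD'; have [ea|ea] := boolP (enters Y a); last first.
    by rewrite add0n => <-; apply: cutS.
  have : ~~ tight Y by apply: contraL ea; apply: atight.
  rewrite /tight rY /= negb_and negbK -ltnNge => /orP[sYU|lt1].
    by move: ea; rewrite /enters => /andP[/(subsetP sYU)]; rewrite (negPf hU).
  by move=> h; rewrite h in lt1.
have [/existsP[X0 tX0]|notight] := boolP [exists X, tight X]; last first.
  have rU' : r \notin ~: U by rewrite inE negbK.
  have [a aD] := indeg_gt0 (cutS _ U0 rU'); rewrite /enters !inE negbK => /andP[hU tU].
  exists a; split=> // Y tY; case/negP: notight; apply/existsP; by exists Y.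
have [X /and3P[rX sX dX] Xmin] := arg_minnP (fun X : {set V} => #|X|) tX0.
have XU0 : X :\: U != set0 by rewrite setD_eq0.
(* In a minimal tight [X], more arcs enter [X :\: U] than [X]. One of them therefore comes from
   [X :&: U], which is the arc to add. *)
have ltX : (indeg D' X < indeg D' (X :\: U))%N.
  apply: leq_ltn_trans dX (out2 _ XU0 _).
  by rewrite disjoints_subset; apply/subsetP=> v; rewrite !inE => /andP[].
have [a aD' /andP[eXU nX]] : exists2 a, a \in D' & enters (X :\: U) a && ~~ enters X a.
  apply/exists_inP; apply: contraLR ltX; rewrite negb_exists_in -leqNgt => /forall_inP h.
  by apply: leq_sum => a /h; case: (enters _ a); case: (enters _ a).
move: eXU nX; rewrite /enters !inE => /andP[/andP[hU hX]].
rewrite hX /= negbK negb_and negbK => + tX; rewrite tX orbF => tU.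
exists a; split=> // Y /and3P[rY sY dY]; apply/negP=> /andP[hY tY].
have rI : r \notin X :&: Y by rewrite inE (negPf rX).
have rUn : r \notin X :|: Y by rewrite inE (negPf rX).
have hI : hd a \in X :&: Y by rewrite inE hX.
have Un0 : X :|: Y != set0 by apply/set0Pn; exists (hd a); rewrite inE hX.
(* If the arc entered a tight [Y], submodularity, with an arc entering [X :|: Y], would make
   [X :&: Y] tight. It is smaller than [X] since it lacks the tail of the arc. *)
have tI : tight (X :&: Y).
  rewrite /tight rI /=; apply/andP; split.
    by apply/subsetPn; exists (hd a).
  have := indeg_submod D' X Y; have := cutS _ Un0 rUn.
  by move: dX dY; clear; lia.
have := Xmin _ tI; rewrite leqNgt => /negP; apply; apply: proper_card.
by apply/properP; split; [exact: subsetIl|exists (tl a); rewrite ?inE // (negPf tY) andbF].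
Qed.

Lemma disjoint_arborescences D :
  (forall X, X != set0 -> r \notin X -> (1 < indeg D X)%N) ->
  exists S1 S2 : {set A}, [/\ S1 \subset D, S2 \subset D, [disjoint S1 & S2],
    arborescence setT S1 & arborescence setT S2].
Proof.
move=> cutD; apply: (disjoint_arborescences_grow cutD (sub0set _) arborescence1).
by move=> X X0 rX; rewrite setD0 ltnW // cutD.
Qed.

End Arborescences.

(** * The two matroids of an instance *)

Lemma card_fibers (A B : finType) (h : A -> B) (X : {set A}) :
  #|X| = (\sum_b #|[set a in X | h a == b]|)%N.
Proof.
rewrite -sum1_card (partition_big h predT) //=; apply: eq_bigr => b _.
by rewrite -sum1_card; apply: eq_bigl => a; rewrite inE.
Qed.

Lemma fiber_lt (A B : finType) (h : A -> B) (X Y : {set A}) : (#|X| < #|Y|)%N ->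
  exists b, (#|[set a in X | h a == b]| < #|[set a in Y | h a == b]|)%N.
Proof.
move=> lt; apply/existsP; apply: contraLR lt; rewrite negb_exists -leqNgt => /forallP le.
by rewrite (card_fibers h X) (card_fibers h Y); apply: leq_sum => b _; rewrite leqNgt.
Qed.

Section Reduction.

Variables (R : realFieldType) (G : fgc_instance R).
Local Notation n := (nv G).
Local Notation E := 'I_(ne G).

(* An arc [(e, d, c)] is the edge [e] directed towards its first end if [d] holds
   and towards its second one otherwise, in the copy [c] of the graph. *)
Local Notation A := (E * bool * bool)%type.

Definition ahd (a : A) : 'I_n := if a.1.2 then (ends a.1.1).1 else (ends a.1.1).2.
Definition atl (a : A) : 'I_n := if a.1.2 then (ends a.1.1).2 else (ends a.1.1).1.

Definition ind1 : pred {set A} :=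
  forest (fun a : A => (a.2, atl a)) (fun a : A => (a.2, ahd a)).

(** The root is vertex [0]; its zero capacity forbids arcs entering it. *)
Definition capacity (v : 'I_n) : nat := if val v == 0%N then 0%N else 2%N.

Definition ind2 (X : {set A}) : bool :=
  [forall v, #|[set a in X | ahd a == v]| <= capacity v]%N
  && [forall e, forall d, (e \in unsafe G) ==>
        ~~ (((e, d, false) \in X) && ((e, d, true) \in X))].

Lemma ind2P (X : {set A}) : reflect
  ((forall v, #|[set a in X | ahd a == v]| <= capacity v)%N /\
   forall e d, e \in unsafe G -> (e, d, false) \in X -> (e, d, true) \in X -> False)
  (ind2 X).
Proof.
apply: (iffP andP) => [][].
  move=> /forallP h1 /forallP h2; split=> // e d ue x1 x2.
  by have := forallP (h2 e) d; rewrite ue x1 x2.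
move=> h1 h2; split; first exact/forallP.
by apply/forallP=> e; apply/forallP=> d; apply/implyP=> ue; apply/negP=> /andP[]; apply: h2.
Qed.

Lemma matroid1 : matroid ind1.
Proof. exact: forest_matroid. Qed.

(** Both copies of an orientation have the same head, so the constraints are nested. A head where
    [Y] has more arcs than [X], and then an orientation at that head where [Y] has more, provide
    [y]: an arc of [X] over that orientation would leave room in [Y] only if [Y] had both copies,
    which is excluded for an unsafe edge. *)
Lemma matroid2 : matroid ind2.
Proof.
split=> [X Y sXY /ind2P[h1 h2]|X Y /ind2P[h1 h2] /ind2P[k1 k2] ltXY].
  apply/ind2P; split=> [v|e d ue /(subsetP sXY) x1 /(subsetP sXY) x2];
    last exact: h2 ue x1 x2.
  apply: leq_trans (h1 v); apply: subset_leq_card; apply/subsetP=> a; rewrite !inE.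
  by case/andP=> /(subsetP sXY) -> ->.
have [v ltv] := fiber_lt ahd ltXY.
set Xv := [set a in X | ahd a == v] in ltv; set Yv := [set a in Y | ahd a == v] in ltv.
have [p ltp] := fiber_lt (fun a : A => a.1) ltv.
set Xp := [set a in Xv | a.1 == p] in ltp; set Yp := [set a in Yv | a.1 == p] in ltp.
have /subsetPn[y] : ~~ (Yp \subset Xp).
  by apply/negP=> /subset_leq_card; rewrite leqNgt ltp.
rewrite !inE => /andP[/andP[yY /eqP yv] /eqP yp]; rewrite yv yp !eqxx !andbT => yX.
exists y; first by rewrite inE yX.
apply/ind2P; split=> [u|e d ue].
  have [uv|uv] := eqVneq u v.
    rewrite uv; apply: leq_trans (k1 v); apply: leq_trans ltv.
    rewrite (_ : [set a in y |: X | ahd a == v] = y |: Xv) ?cardsU1; last first.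
      by apply/setP=> a; rewrite !inE; have [->|] //= := eqVneq a y; rewrite yv eqxx.
    by case: (y \notin Xv).
  apply: leq_trans (h1 u); apply: subset_leq_card; apply/subsetP=> a; rewrite !inE.
  by have [->|] //= := eqVneq a y; rewrite yv eq_sym (negPf uv).
have key b : b \in X -> b.1 = p -> p.1 \in unsafe G -> False.
  move=> bX bp up; have hb : ahd b = v by rewrite -yv /ahd bp -yp.
  have bXp : b \in Xp by rewrite !inE bX hb bp !eqxx.
  have lt1 : (1 < #|Yp|)%N by apply: leq_ltn_trans ltp; rewrite card_gt0; apply/set0Pn;
    exists b.
  have sub : Yp \subset [set (p, false); (p, true)].
    apply/subsetP=> [][p' c']; rewrite !inE /= => /andP[_ /eqP->].
    by case: c'; rewrite eqxx ?orbT.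
  have eY : Yp = [set (p, false); (p, true)].
    by apply/eqP; rewrite eqEcard sub cards2 (leq_trans _ lt1) //; case: (_ != _).
  apply: (k2 p.1 p.2 up).
    have : (p, false) \in Yp by rewrite eY !inE eqxx.
    by rewrite !inE -surjective_pairing => /andP[/andP[]].
  have : (p, true) \in Yp by rewrite eY !inE eqxx orbT.
  by rewrite !inE -surjective_pairing => /andP[/andP[]].
rewrite !in_setU1 => /orP[/eqP e1|x1] /orP[/eqP e2|x2].
- by rewrite -e1 in e2.
- by apply: (key _ x2); rewrite -yp -e1.
- by apply: (key _ x1); rewrite -yp -e2.
- exact: h2 ue x1 x2.
Qed.

Lemma ind1_0 : ind1 set0. Proof. exact: forest0. Qed.

Lemma ind2_0 : ind2 set0.
Proof.
apply/ind2P; split=> [v|e d _]; last by rewrite inE.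
by rewrite (_ : [set _ in _ | _] = set0) ?cards0 //; apply/setP=> a; rewrite !inE.
Qed.

(** In one copy the two orientations of an edge are parallel and close a cycle, so the arcs over an
    edge are told apart by their copy. This is the source of the factor two. *)
Lemma ind1_edge_card X e : ind1 X -> (#|[set a in X | a.1.1 == e]| <= 2)%N.
Proof.
move=> /forall_inP fX; rewrite -card_bool.
rewrite -(@card_in_imset _ _ (fun a : A => a.2)) ?max_card //.
move=> [[e1 d1] c1] [[e2 d2] c2];
  rewrite !inE /= => /andP[x1 /eqP e1E] /andP[x2 /eqP e2E] cE.
rewrite {}e1E in x1 *; rewrite {}e2E in x2 *; rewrite {}cE in x1 *.
have [->//|dd] := eqVneq d1 d2; case/negP: (fX _ x1).
have x2' : (e, d2, c2) \in X :\ (e, d1, c2).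
  by rewrite !inE x2 andbT; apply: contraNneq dd => -[->].
have := spanned_mem (fun a : A => (a.2, atl a)) (fun a : A => (a.2, ahd a)) x2'.
rewrite /spanned gconn_sym; congr (connect _ (_, _) (_, _)); rewrite /atl /ahd /=.
  by case: (d1) (d2) dd => [][].
by case: (d1) (d2) dd => [][].
Qed.

Definition acost (X : {set A}) : R := \sum_(a in X) ecost a.1.1.

Lemma acostE X : acost X = \sum_(e : E) ecost e *+ #|[set a in X | a.1.1 == e]|.
Proof.
rewrite /acost (partition_big (fun a : A => a.1.1) predT) //=; apply: eq_bigr => e _.
rewrite -sumr_const; apply: eq_big => [a|a /andP[_ /eqP->]] //; first by rewrite inE.
Qed.

Definition used (X : {set A}) : {set E} := [set e | [exists a in X, a.1.1 == e]].

Lemma cost_used_le X : (forall e : E, 0 <= ecost e) -> cost (used X) <= acost X.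
Proof.
move=> c0; rewrite acostE /cost big_mkcond; apply: ler_sum => e _.
case: ifP => [|_]; last by rewrite mulrn_wge0.
rewrite inE => /exists_inP[a aX ae].
have : (0 < #|[set a in X | a.1.1 == e]|)%N.
  by rewrite card_gt0; apply/set0Pn; exists a; rewrite inE aX.
by case: #|_| => // k _; rewrite mulrS lerDl mulrn_wge0.
Qed.

Lemma acost_le X (F : {set E}) : (forall e : E, 0 <= ecost e) -> ind1 X ->
  (forall a, a \in X -> a.1.1 \in F) -> acost X <= 2 * cost F.
Proof.
move=> c0 iX XF; rewrite acostE /cost [in leRHS]big_mkcond mulr_sumr.
apply: ler_sum => e _; case: ifP => eF.
  rewrite mulrC mulr_natr ler_wpMn2l //; exact: ind1_edge_card.
rewrite (_ : [set _ in _ | _] = set0) ?cards0 ?mulr0 //; apply/setP=> a; rewrite !inE.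
by apply/negP=> /andP[/XF aF /eqP ae]; rewrite -ae aF in eF.
Qed.

(** * From feasible edge sets to common bases and back *)

Section Root.

Hypothesis n_gt0 : (0 < n)%N.
Let r : 'I_n := Ordinal n_gt0.

Lemma capacityE v : capacity v = if v == r then 0%N else 2%N.
Proof. by []. Qed.

Lemma enters_dir X e d1 d2 c1 c2 :
  enters atl ahd X (e, d1, c1) -> enters atl ahd X (e, d2, c2) -> d1 = d2.
Proof.
rewrite /enters /atl /ahd /=; case: d1 d2 => [][] //.
  by move=> /andP[_ /negPf->]. 
by move=> /andP[_ /negPf->].
Qed.

Lemma adj_arc (F : {set E}) u v : adj F u v ->
  exists2 e, e \in F & exists d, forall c, atl (e, d, c) = u /\ ahd (e, d, c) = v.
Proof.
case/exists_inP=> e eF; case/orP=> /eqP ee; exists e => //.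
  by exists false => c; rewrite /atl /ahd /= ee.
by exists true => c; rewrite /atl /ahd /= ee.
Qed.

Lemma arc_adj (F : {set E}) (a : A) : a.1.1 \in F -> adj F (atl a) (ahd a).
Proof.
move=> aF; apply/exists_inP; exists a.1.1 => //; rewrite /atl /ahd.
by case: (a.1.2); rewrite -surjective_pairing eqxx ?orbT.
Qed.

Lemma connected_cut (F : {set E}) (X : {set 'I_n}) : connectedg F -> X != set0 ->
  r \notin X -> exists2 e, e \in F & exists d, forall c, enters atl ahd X (e, d, c).
Proof.
move=> /forallP/(_ r)/forallP cF /set0Pn[x xX] rX.
have /connectP[p pp xE] := cF x.
elim: p r rX pp xE => [|v p IH] u uX /=; first by move=> _ xE; rewrite -xE xX in uX.
case/andP=> uv pp xE; have [vX|vX] := boolP (v \in X); last exact: IH pp xE.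
have [e eF [d h]] := adj_arc uv; exists e => //; exists d => c.
by have [h1 h2] := h c; rewrite /enters h1 h2 vX.
Qed.

Lemma common_base (F : {set E}) : feasible F ->
  exists X, [/\ ind1 X, ind2 X, #|X| = (n.-1).*2 & forall a, a \in X -> a.1.1 \in F].
Proof.
case/andP=> cF /forall_inP uF.
(* Here the last component only counts multiplicity: a safe edge has two parallel arcs per
   orientation, an unsafe edge one. A cut then contains a doubled safe edge, or an unsafe edge and,
   after deleting it, a second edge. *)
pose D := [set a : A | (a.1.1 \in F) && (~~ a.2 || (a.1.1 \in safe G))].
have [X X0 rX|S1 [S2 [sS1 sS2 dS arb1 arb2]]] := @disjoint_arborescences _ _ atl ahd r D.
  apply/indeg_ge2P; have [e eF [d h]] := connected_cut cF X0 rX.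
  have [sf|usf] := boolP (e \in safe G).
    exists (e, d, false), (e, d, true).
    by split; rewrite ?h // ?inE /= ?eF ?sf // xpair_eqE andbF.
  have [|e' ] := connected_cut (uF e _) X0 rX; first by rewrite !inE eF.
  rewrite !inE => /andP[ee e'F] [d' h'].
  exists (e, d, false), (e', d', false).
  split; rewrite ?h ?h' // ?inE /= ?eF ?e'F //.
  by apply: contraNneq ee => -[->].
pose S c := if c then S2 else S1.
have arb c : arborescence atl ahd r setT (S c) by case: c.
have SD c a : a \in S c -> a \in D by case: c; apply/subsetP.
(* The last component changes its meaning: the arcs of the arborescence [S c] are moved to copy [c]
   of the graph, whatever their multiplicity label was. An unsafe orientation has a single label in
   [D], so disjointness keeps it out of one copy. *)
pose X := [set a : A | [exists c, (a.1, c) \in S a.2]].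
have XP p c : reflect (exists c', (p, c') \in S c) ((p, c) \in X).
  by rewrite inE /=; apply: existsP.
have fib v : v != r -> exists p1 p2, [set a in X | ahd a == v] = [set (p1, false);
  (p2, true)].
  move=> vr.
  have aux c : exists p c', [set a in S c | ahd a == v] = [set (p, c')].
    have [_ _ /(_ v (in_setT _) vr) /eqP/cards1P[[p c'] pE] _] := arb c.
    by exists p, c'.
  have [p1 [c1 E1]] := aux false; have [p2 [c2 E2]] := aux true.
  exists p1, p2; apply/setP=> [][p c]; rewrite in_set.
  have char c0 : ((p, c0) \in X) && (ahd (p, c0) == v) = (p == if c0 then p2 else p1).
    apply/andP/eqP=> [[/XP[c' pS] hv]|->].
      have : (p, c') \in [set a in S c0 | ahd a == v] by rewrite inE pS.
      by case: c0 pS hv => pS hv; rewrite ?E1 ?E2 inE => /eqP[].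
    case: c0.
      have : (p2, c2) \in [set a in S true | ahd a == v] by rewrite E2 inE.
      by rewrite inE => /andP[pS hv]; split=> //; apply/XP; exists c2.
    have : (p1, c1) \in [set a in S false | ahd a == v] by rewrite E1 inE.
    by rewrite inE => /andP[pS hv]; split=> //; apply/XP; exists c1.
  by rewrite char !inE !xpair_eqE; case: c; rewrite ?andbF ?andbT ?orbF.
have fibr : [set a in X | ahd a == r] = set0.
  apply/setP=> [][p c]; rewrite in_set in_set0; apply/negP=> /andP[/XP[c' pS] hv].
  by have [_ /(_ _ pS)[_ _ /negP hr] _ _] := arb c.
exists X; split.
- apply/forall_inP=> [][p c] pX; have /XP[c' pS] := pX.
  have [_ _ _ /forall_inP/(_ _ pS)] := arb c; apply: contra; rewrite /spanned /= => cx.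
  (* A connection in the union of the two copies never leaves copy [c], so it projects to a
     connection inside [S c]. *)
  pose Q (y : bool * 'I_n) :=
    y.1 = c /\ connect (gadj atl ahd (S c :\ (p, c'))) (atl (p, c')) y.2.
  suff : Q (c, ahd (p, c)) by case.
  move: cx.
  apply: (@gconn_ind _ _ _ _ _ Q (c, atl (p, c))).
    by split=> //; exact: connect0 (atl (p, c')).
  move=> [k1 u1] [k2 u2] [/= -> h] /gadjP[[p0 c0]].
  rewrite in_setD1 => /andP[pp /XP[c0' p0S]].
  have p0p : p0 = p -> c0 = c -> False by move=> e1 e2; rewrite e1 e2 eqxx in pp.
  have sp cc : cc = c -> c0 = cc -> connect (gadj atl ahd (S c :\ (p, c'))) (atl (p0,
    c0')) (ahd (p0, c0')).
    move=> e1 e2; rewrite e1 in e2; rewrite e2 in p0S p0p.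
    apply: spanned_mem; rewrite in_setD1 p0S andbT; apply/eqP=> -[e3 _]; exact: p0p.
  case=> [][[e1 e2] [e3 e4]]; rewrite -e1 in e3; rewrite /Q /= e3; split=> //.
    by apply: connect_trans h _; rewrite e2 e4; apply: (sp c).
  by apply: connect_trans h _; rewrite e2 e4 gconn_sym; apply: (sp c).
- apply/ind2P; split=> [v|e d ue /XP[c1 p1] /XP[c2 p2]].
    rewrite capacityE; have [->|/fib[p1 [p2 ->]]] := eqVneq v r.
      by rewrite fibr cards0.
    by rewrite cards2; case: (_ != _).
  have := SD _ _ p1; have := SD _ _ p2; rewrite !inE /=.
  move: ue; rewrite inE => /negPf ->;
    rewrite !orbF => /andP[_ /negPf e2] /andP[_ /negPf e1].
  by have := disjointFr dS p1; rewrite e1 -[X in (_, X)]e2 [_ \in S2]p2.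
- rewrite (card_fibers ahd X) (bigD1 r) //= fibr cards0 add0n.
  rewrite (eq_bigr (fun=> 2%N)) => [|v /fib[p1 [p2 ->]]]; last first.
    by rewrite cards2 xpair_eqE andbF.
  rewrite sum_nat_const (eq_card (B := predC1 r)) // cardC1 card_ord.
  by rewrite muln2.
- by move=> [p c] /XP[c' /SD]; rewrite inE => /andP[].
Qed.

Lemma common_base_cut X (U : {set 'I_n}) : ind1 X -> ind2 X -> #|X| = (n.-1).*2 ->
  U != set0 -> r \notin U -> (1 < indeg atl ahd X U)%N.
Proof.
move=> i1 i2 cX U0 rU.
have [h1 _] := ind2P _ i2.
(* The capacities add up to the cardinality of [X], so each of them is attained. *)
have fib v : v != r -> #|[set a in X | ahd a == v]| = 2%N.
  have le2 u : u != r -> (#|[set a in X | ahd a == u]| <= 2)%N.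
    by move=> ur; have := h1 u; rewrite capacityE (negPf ur).
  move=> vr; apply/eqP; rewrite eqn_leq le2 //= leqNgt; apply/negP=> ltv.
  have : (#|X| < (n.-1).*2)%N.
    rewrite (card_fibers ahd X) (bigD1 r) //=.
    have := h1 r; rewrite capacityE eqxx leqn0 => /eqP ->; rewrite add0n.
    have -> : (n.-1).*2 = (\sum_(u | u != r) 2)%N.
      by rewrite sum_nat_const (eq_card (B := predC1 r)) // cardC1 card_ord muln2.
    rewrite [ltnLHS](bigD1 v) //= [ltnRHS](bigD1 v) //= -addSn leq_add //.
    by apply: leq_sum => u /andP[ur _]; apply: le2.
  by rewrite cX ltnn.
pose XU := [set a in X | ahd a \in U].
have cXU : #|XU| = (#|U|.*2)%N.
  rewrite (card_fibers ahd XU) (bigID (mem U)) /= [X in (_ + X)%N]big1 ?addn0; last first.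
    move=> v vU; apply/eqP; rewrite cards_eq0; apply/eqP/setP=> a; rewrite !inE.
    by apply/negP=> /andP[/andP[_ aU] /eqP av]; rewrite av (negPf vU) in aU.
  rewrite (eq_bigr (fun=> 2%N)) ?sum_nat_const ?muln2 // => v vU.
  rewrite -(fib v); last by apply: contraNneq rU => <-.
  by apply: eq_card => a; rewrite !inE; have [->|] := eqVneq (ahd a) v;
    rewrite ?vU ?andbF ?andbT.
pose IN c := [set a in X | [&& ahd a \in U, atl a \in U & a.2 == c]].
have cIN c : (#|IN c| < #|U|)%N.
  have -> : #|U| = #|setX [set c] U| by rewrite cardsX cards1 mul1n.
  apply: (@forest_card _ _ (fun a : A => (a.2, atl a)) (fun a : A => (a.2, ahd a))).
  - by apply: ind_sub matroid1 _ _ _ i1; apply/subsetP=> a; rewrite inE => /andP[].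
  - by have /set0Pn[u uU] := U0; apply/set0Pn; exists (c, u); rewrite !inE eqxx.
  - by move=> a; rewrite !inE => /and4P[_ -> -> ->].
have dE : indeg atl ahd X U = #|[set a in X | enters atl ahd U a]|.
  rewrite /indeg -sum1_card [RHS](eq_bigl (fun a => (a \in X) && enters atl ahd U a)).
    by rewrite [RHS]big_mkcondr; apply: eq_bigr => a _; case: (enters _ _ _ _).
  by move=> a; rewrite inE.
have leU : (#|XU| <= #|[set a in X | enters atl ahd U a]| + (#|IN false| + #|IN true|))%N.
  apply: leq_trans (leq_add (leqnn _) (leq_card_setU _ _)).
  apply: leq_trans (leq_card_setU _ _); apply: subset_leq_card; apply/subsetP=> a.
  by rewrite !inE /enters => /andP[-> ->] /=; case: (atl a \in U) => //=; case: (a.2).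
rewrite dE; move: leU (cIN true) (cIN false); rewrite cXU.
by move: #|IN _| #|IN _| #|U| #|[set a in _ | _]| => k1 k2 k3 k4; lia.
Qed.

(** Opposite orientations of an edge never enter the same set, so two distinct arcs entering [U]
    over the same edge are the two copies of one orientation. For an unsafe edge [ind2] excludes
    this, and one of the two arcs survives its deletion. *)
Lemma used_feasible X : ind1 X -> ind2 X -> #|X| = (n.-1).*2 -> feasible (used X).
Proof.
move=> i1 i2 cX; have [_ h2] := ind2P _ i2.
have conn (F : {set E}) :
    (forall U : {set 'I_n}, U != set0 -> r \notin U ->
       exists2 a : A, a.1.1 \in F & enters atl ahd U a) -> connectedg F.
  move=> cut; suff cr v : connect (adj F) r v.
    have sym : connect_sym (adj F).
      by apply: sym_connect_sym => u v; apply: eq_existsb => e; rewrite orbC.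
    apply/forallP=> u; apply/forallP=> v; apply: connect_trans (cr v).
    by rewrite sym.
  apply/negPn/negP=> nv; pose U := [set u | ~~ connect (adj F) r u].
  have [||a aF] := cut U; rewrite ?inE ?negbK ?connect0 //.
    by apply/set0Pn; exists v; rewrite inE.
  rewrite /enters !inE negbK => /andP[/negP h1 h3]; apply: h1.
  exact: connect_trans h3 (connect1 (arc_adj aF)).
have memu a : a \in X -> a.1.1 \in used X.
  by move=> aX; rewrite inE; apply/exists_inP; exists a.
apply/andP; split.
  apply: conn => U U0 rU;
    have /indeg_ge2P[a [b [aX _ _ ea _]]] := common_base_cut i1 i2 cX U0 rU.
  by exists a => //; apply: memu.
apply/forall_inP=> e; rewrite inE => /andP[eu ue]; apply: conn => U U0 rU.
have /indeg_ge2P[a [b [aX bX ab ea eb]]] := common_base_cut i1 i2 cX U0 rU.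
have [ae|ae] := eqVneq a.1.1 e; last by exists a; rewrite ?in_setD1 ?ae ?memu.
have [be|be] := eqVneq b.1.1 e; last by exists b; rewrite ?in_setD1 ?be ?memu.
case: a b ab aX bX ae be ea eb => [[e1 d1] c1] [[e2 d2] c2] /= ab aX bX e1E e2E ea eb.
rewrite {}e1E in ab aX ea; rewrite {}e2E in ab bX eb.
have dd := enters_dir ea eb; rewrite {}dd in ab aX ea.
by case: c1 c2 ab aX bX {ea eb} => [][]; rewrite ?eqxx // => _ aX bX; case: (h2 e d2 ue).
Qed.

End Root.

End Reduction.

(** * Timed execution *)

Fixpoint nmods (P : prog) : seq nat :=
  match P with
  | Skip | RSet _ _ _ => [::]
  | NSet a _ _ => [:: a]
  | Seq P1 P2 | If _ P1 P2 => nmods P1 ++ nmods P2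
  | While _ P1 => nmods P1
  end.

Fixpoint rmods (P : prog) : seq nat :=
  match P with
  | Skip | NSet _ _ _ => [::]
  | RSet a _ _ => [:: a]
  | Seq P1 P2 | If _ P1 P2 => rmods P1 ++ rmods P2
  | While _ P1 => rmods P1
  end.

(* The running time of a program all of whose loops are left after at most [b]
   iterations. *)
Fixpoint ptime (b : nat) (P : prog) : nat :=
  match P with
  | Skip | NSet _ _ _ | RSet _ _ _ => 1
  | Seq P1 P2 => (ptime b P1 + ptime b P2)%N
  | If _ P1 P2 => (ptime b P1 + ptime b P2).+1
  | While _ P1 => (b * (ptime b P1).+1).+1
  end.

Lemma ptime_poly P : exists p : {poly nat}, forall b, (ptime b P <= p.[b])%N.
Proof.
elim: P => [|a i e|a i e|P1 [p1 h1] P2 [p2 h2]|c P1 [p1 h1] P2 [p2 h2]|c P1 [p1 h1]].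
- by exists 1%R => b; rewrite hornerC.
- by exists 1%R => b; rewrite hornerC.
- by exists 1%R => b; rewrite hornerC.
- by exists (p1 + p2) => b; rewrite hornerD; apply: leq_add.
- by exists (p1 + p2 + 1) => b; rewrite !hornerD hornerC /= -addn1 !leq_add.
exists ('X * (p1 + 1) + 1) => b; rewrite hornerD hornerC hornerM hornerX hornerD hornerC /=.
by rewrite -addn1 leq_add // leq_mul // -addn1 leq_add.
Qed.

Definition For (i l j : nat) (P : prog) : prog :=
  Seq (NSet i (NConst 0) (NConst 0))
    (While (BNot (BLeN (NGet l (NConst j)) (NGet i (NConst 0))))
       (Seq P (NSet i (NConst 0) (NAdd (NGet i (NConst 0)) (NConst 1))))).

Section Runs.

Variables (R : realFieldType) (b : nat).
Implicit Types (s : state R) (P : prog).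

Definition setn s a i x : state R := State (upd (nmem s) a i x) (rmem s).
Definition setr s a i x : state R := State (nmem s) (upd (rmem s) a i x).

Definition same (na ra : seq nat) s s' :=
  (forall a i, a \notin na -> nmem s' a i = nmem s a i) /\
  (forall a i, a \notin ra -> rmem s' a i = rmem s a i).

Definition runs P s (Q : state R -> Prop) :=
  exists t s', [/\ exec P s t s', (t <= ptime b P)%N & Q s'].

Lemma same_trans na ra s1 s2 s3 : same na ra s1 s2 -> same na ra s2 s3 -> same na ra s1 s3.
Proof. by move=> [h1 h2] [k1 k2]; split=> a i h; rewrite ?k1 ?k2 ?h1 ?h2. Qed.

Lemma same_sub na ra na' ra' s s' : {subset na <= na'} -> {subset ra <= ra'} ->
  same na ra s s' -> same na' ra' s s'.
Proof.
move=> h1 h2 [k1 k2]; split=> a i h; [apply: k1|apply: k2].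
  by apply: contra h; apply: h1.
by apply: contra h; apply: h2.
Qed.

Lemma same_setn a i x s : same [:: a] [::] s (setn s a i x).
Proof. by split=> // c j; rewrite inE /setn /= /upd => /negPf ->. Qed.

Lemma same_setr a i x s : same [::] [:: a] s (setr s a i x).
Proof. by split=> // c j; rewrite inE /setr /= /upd => /negPf ->. Qed.

(** The frame rule: it spares the loop invariants all the arrays that the program text does not
    assign. *)
Lemma exec_same P s t s' : exec P s t s' -> same (nmods P) (rmods P) s s'.
Proof.
elim=> {P s t s'} //= [s a i e|s a i e|P1 P2 s1 s2 s3 _ _ _ h1 _ h2|c P1 P2 s s' t _ _
  h|c P1 P2 s s' t _ _ h|c P1 s1 s2 s3 _ _ _ _ h1 _ h2].
- exact: same_setn.
- exact: same_setr.
- by apply: same_trans (same_sub _ _ h1) (same_sub _ _ h2) => x; rewrite mem_cat => ->;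
  rewrite ?orbT.
- by apply: same_sub h => x; rewrite mem_cat => ->.
- by apply: same_sub h => x; rewrite mem_cat => ->; rewrite orbT.
- exact: same_trans h1 h2.
Qed.

Lemma runs_weaken P s (Q Q' : state R -> Prop) : runs P s Q ->
  (forall s', same (nmods P) (rmods P) s s' -> Q s' -> Q' s') -> runs P s Q'.
Proof.
by move=> [t [s' [h1 h2 h3]]] h; exists t, s'; split=> //; apply: h h3; apply: exec_same h1.
Qed.

Lemma runs_skip s (Q : state R -> Prop) : Q s -> runs Skip s Q.
Proof. by move=> Qs; exists 1%N, s; split=> //; apply: ExecSkip. Qed.

Lemma runs_nset s a i e (Q : state R -> Prop) :
  Q (setn s a (neval s i) (neval s e)) -> runs (NSet a i e) s Q.
Proof. by move=> Qs; exists 1%N; eexists; split; [apply: ExecNSet| |exact: Qs]. Qed.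

Lemma runs_rset s a i e (Q : state R -> Prop) :
  Q (setr s a (neval s i) (reval s e)) -> runs (RSet a i e) s Q.
Proof. by move=> Qs; exists 1%N; eexists; split; [apply: ExecRSet| |exact: Qs]. Qed.

Lemma runs_seq P1 P2 s (Q : state R -> Prop) :
  runs P1 s (fun s1 => runs P2 s1 Q) -> runs (Seq P1 P2) s Q.
Proof.
move=> [t1 [s1 [e1 l1 [t2 [s2 [e2 l2 Qs]]]]]]; exists (t1 + t2)%N, s2.
by split=> //; [apply: ExecSeq e1 e2|apply: leq_add].
Qed.

Lemma runs_seqw P1 P2 s (Q1 Q : state R -> Prop) : runs P1 s Q1 ->
  (forall s1, same (nmods P1) (rmods P1) s s1 -> Q1 s1 -> runs P2 s1 Q) ->
  runs (Seq P1 P2) s Q.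
Proof. by move=> h1 h2; apply: runs_seq; apply: runs_weaken h1 h2. Qed.

Lemma runs_if c P1 P2 s (Q : state R -> Prop) :
  (beval s c -> runs P1 s Q) -> (~~ beval s c -> runs P2 s Q) -> runs (If c P1 P2) s Q.
Proof.
move=> h1 h2; have [bc|bc] := boolP (beval s c).
  have [t [s' [e l Qs]]] := h1 bc; exists t.+1, s'; split=> //; first exact: ExecIfT.
  by rewrite /= ltnS (leq_trans l) ?leq_addr.
have [t [s' [e l Qs]]] := h2 bc; exists t.+1, s'; split=> //; first exact: ExecIfF.
by rewrite /= ltnS (leq_trans l) ?leq_addl.
Qed.

(** The invariant is indexed by the number of iterations still to come, which gives termination and
    the time bound together. *)
Lemma runs_while (Inv : nat -> state R -> Prop) c P n s : (n <= b)%N -> Inv n s ->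
  (forall k s', (k < n)%N -> Inv k.+1 s' -> beval s' c /\ runs P s' (Inv k)) ->
  (forall s', Inv 0%N s' -> ~~ beval s' c) ->
  runs (While c P) s (Inv 0%N).
Proof.
move=> le_nb Is step stop.
suff loop k s1 : (k <= n)%N -> Inv k s1 -> exists t s',
    [/\ exec (While c P) s1 t s', (t <= (k * (ptime b P).+1).+1)%N & Inv 0%N s'].
  have [t [s' [e l Is']]] := loop n s (leqnn n) Is.
  by exists t, s'; split=> //; rewrite (leq_trans l) //= ltnS leq_mul.
elim: k s1 => [|k IH] {Is}s lek Is.
  by exists 1%N, s; split=> //; apply: ExecWhileF; apply: stop.
have [bc [t [s1 [e1 l1 I1]]]] := step k s lek Is.
have [u [s2 [e2 l2 I2]]] := IH s1 (ltnW lek) I1.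
exists (t + u).+1, s2; split=> //; first exact: ExecWhileT e2.
by rewrite ltnS mulSn addSn (leq_trans (leq_add l1 l2)) // addnS.
Qed.

Lemma runs_for i l j P n (Inv : nat -> state R -> Prop) s :
  (n <= b)%N -> i \notin nmods P -> l \notin i :: nmods P -> nmem s l j = n ->
  Inv 0%N (setn s i 0 0) ->
  (forall k s', (k < n)%N -> same (i :: nmods P) (rmods P) s s' ->
     nmem s' i 0%N = k -> Inv k s' ->
     runs P s' (fun s'' => Inv k.+1 (setn s'' i 0 k.+1))) ->
  runs (For i l j P) s (Inv n).
Proof.
move=> le_nb iP lP nE I0 step; have li : l != i by move: lP; rewrite inE negb_or => /andP[].
apply: runs_seq; apply: runs_nset => /=.
pose J k s' := [/\ (k <= n)%N, same (i :: nmods P) (rmods P) s s',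
  nmem s' i 0%N = (n - k)%N & Inv (n - k)%N s'].
apply: runs_weaken (_ : runs _ _ (J 0%N)) _; last first.
  by move=> s' _ [_ _ _]; rewrite subn0.
apply: (@runs_while J _ _ n) => //.
- split; rewrite ?subnn //=; last by rewrite /upd !eqxx.
  by apply: same_sub (same_setn i 0 0 s) => // x; rewrite !inE => ->.
- move=> k s' ltk [lek sm ik Ik]; split.
    rewrite /= (proj1 sm) // nE ik -ltnNge.
    by rewrite ltn_subrL (leq_trans _ ltk).
  have ltn' : (n - k.+1 < n)%N by rewrite ltn_subrL (leq_trans _ ltk).
  apply: runs_seqw (step _ _ ltn' sm ik Ik) _ => s1 sm1 I1.
  have i1 : nmem s1 i 0%N = (n - k.+1)%N by rewrite (proj1 sm1).
  have nkE : (n - k.+1).+1 = (n - k)%N by rewrite -subSn // subSS.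
  apply: runs_nset; rewrite /= i1 addn1 nkE; rewrite nkE in I1; split=> //=.
  + exact: ltnW.
  + apply: same_trans sm _; apply: (same_trans (s2 := s1)).
      by apply: same_sub sm1 => // x xP; rewrite inE xP orbT.
    by apply: same_sub (same_setn i 0 (n - k) s1) => // x; rewrite !inE => ->.
  + by rewrite /upd !eqxx.
- by move=> s' [_ sm ik _]; rewrite /= (proj1 sm) // nE ik subn0 leqnn.
Qed.

End Runs.

(** * Independence tests *)

Local Notation sv a := (NGet a (NConst 0)).
Local Notation assign a e := (NSet a (NConst 0) e).
Local Notation beq e1 e2 := (BAnd (BLeN e1 e2) (BLeN e2 e1)).
Local Notation bnz e := (BNot (BLeN e (NConst 0))).
Local Notation bor c d := (BNot (BAnd (BNot c) (BNot d))).
Local Notation vn := (NGet 0 (NConst 0)).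
Local Notation vM := (NGet 0 (NConst 1)).

(* Memory: arrays 5, 6, 7 hold the tail and head of an arc as vertices of the two
   copies and its head in the graph; 10 is the current set and 11 the set to be
   tested; 12 labels the components of a forest; 13, 14 and the array 2 of reals hold
   reachability, predecessor and distance for each number of steps and each element.
   Cells 20-23 hold the numbers of arcs, of elements, of labels and of rounds, and 40
   the result of an independence test. *)

Definition label_prog := For 30 22 0 (NSet 12 (sv 30) (sv 30)).

Definition relabel_prog :=
  For 31 22 0
    (If (beq (NGet 12 (sv 31)) (sv 41)) (NSet 12 (sv 31) (sv 42)) Skip).

(** An arc whose ends carry the same label closes a cycle; otherwise two components are merged. The
    labels are first copied to cells 41 and 42 because the relabelling loop overwrites array 12. *)
Definition ind1_step :=
  If (bnz (NGet 11 (sv 32)))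
    (Seq (assign 41 (NGet 12 (NGet 5 (sv 32))))
    (Seq (assign 42 (NGet 12 (NGet 6 (sv 32))))
      (If (beq (sv 41) (sv 42)) (assign 40 (NConst 0)) relabel_prog)))
    Skip.

Definition ind1_prog :=
  Seq label_prog (Seq (assign 40 (NConst 1)) (For 32 20 0 ind1_step)).

Definition both_prog (i : nexp) :=
  BAnd (bnz (NGet 11 i)) (bnz (NGet 11 (NAdd i (NAdd vM vM)))).

Definition unsafe_prog :=
  For 33 0 1
    (If (BAnd (BLeN (NGet 3 (sv 33)) (NConst 0))
           (bor (both_prog (sv 33)) (both_prog (NAdd (sv 33) vM))))
       (assign 40 (NConst 0)) Skip).

Definition count_prog :=
  Seq (assign 43 (NConst 0))
    (For 34 20 0
       (If (BAnd (bnz (NGet 11 (sv 34))) (beq (NGet 7 (sv 34)) (sv 35)))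
          (assign 43 (NAdd (sv 43) (NConst 1))) Skip)).

(* [2 - (2 - (v + v))] is the capacity of the vertex [v]: [0] at the root [0] and
   [2] elsewhere. *)
Definition heads_prog :=
  For 35 0 0
    (Seq count_prog
       (If (BLeN (sv 43)
              (NSub (NConst 2) (NSub (NConst 2) (NAdd (sv 35) (sv 35)))))
          Skip (assign 40 (NConst 0)))).

Definition ind2_prog := Seq (assign 40 (NConst 1)) (Seq unsafe_prog heads_prog).

(** It is run when exactly one of the two elements is in the current set: flipping both cells is
    then the swap, and membership of the first one selects the matroid to test. *)
Definition arc_prog :=
  Seq (For 36 21 0 (NSet 11 (sv 36) (NGet 10 (sv 36))))
 (Seq (NSet 11 (sv 50) (NSub (NConst 1) (NGet 10 (sv 50))))
 (Seq (NSet 11 (sv 51) (NSub (NConst 1) (NGet 10 (sv 51))))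
   (If (bnz (NGet 10 (sv 50))) ind1_prog ind2_prog))).

(** * Correctness of the independence tests *)

Section Programs.

Variables (R : realFieldType) (G : fgc_instance R).
Local Notation n := (nv G).
Local Notation m := (ne G).
Local Notation A := ('I_(ne G) * bool * bool)%type.
Local Notation T := (option A).
(** A common bound for all loops, which make at most [4 m + 1] iterations over elements, [2 n] over
    labels and [2 (n - 1)] over rounds. *)
Local Notation b := (4 * (nv G + ne G)).+1.
Local Notation N := (m + m + m + m)%N.
Implicit Types (s : state R) (x u v : T) (a : A) (X B : {set T}).

(** The artificial element comes last, so cell 20 serves both as the number of arcs and as its
    index. The two copies of an orientation are [m + m] cells apart. *)
Definition idx x : nat :=
  if x is Some (e, d, c) then (val e + (if d then m else 0) + (if c then m + m else 0))%N
  else N.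

Arguments idx : simpl never.

Definition lidx (p : bool * 'I_n) : nat := (val p.2 + if p.1 then n else 0)%N.

Definition tcost x : R := if x is Some a then ecost a.1.1 else 0.

Lemma idx_Some_lt a : (idx (Some a) < N)%N.
Proof. by case: a => [[e d] c]; rewrite /idx /=; have := ltn_ord e; case: d; case: c;
  lia. Qed.

Lemma idx_lt x : (idx x < N.+1)%N.
Proof. by case: x => [a|]; rewrite ?leqnn // ltnW // ltnS idx_Some_lt. Qed.

Lemma idx_inj : injective idx.
Proof.
have Sinj : injective (fun a => idx (Some a)).
  move=> [[e1 d1] c1] [[e2 d2] c2]; have := ltn_ord e1; have := ltn_ord e2.
  rewrite /idx /= => l2 l1 h; have [ee [-> ->]] : e1 = e2 /\ d1 = d2 /\ c1 = c2.
    by case: d1 d2 c1 c2 h => [] [] [] [] h; split=> //; try apply: val_inj => /=; lia.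
  by rewrite ee.
move=> [a1|] [a2|] //.
- by move=> /Sinj ->.
- by move=> h; have := idx_Some_lt a1; rewrite h ltnn.
- by move=> h; have := idx_Some_lt a2; rewrite -h ltnn.
Qed.

Lemma idx_Some_surj i : (i < N)%N -> exists a, idx (Some a) = i.
Proof.
move=> lti; have [h1|h1] := ltnP i (m + m); last first.
  have [h2|h2] := ltnP i (m + m + m).
    have h : (i - (m + m) < m)%N by lia.
    by exists (Ordinal h, false, true); rewrite /idx /=; lia.
  have h : (i - (m + m + m) < m)%N by lia.
  by exists (Ordinal h, true, true); rewrite /idx /=; lia.
have [h2|h2] := ltnP i m.
  by exists (Ordinal h2, false, false); rewrite /idx /=; lia.
have h : (i - m < m)%N by lia.
by exists (Ordinal h, true, false); rewrite /idx /=; lia.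
Qed.

Lemma idx_surj i : (i < N.+1)%N -> exists x, idx x = i.
Proof.
rewrite ltnS leq_eqVlt => /orP[/eqP->|/idx_Some_surj[a <-]]; first by exists None.
by exists (Some a).
Qed.

Lemma card_T : #|{: T}| = N.+1.
Proof. by rewrite card_option !card_prod card_bool card_ord; congr _.+1; lia. Qed.

Lemma lidx_lt p : (lidx p < n + n)%N.
Proof. by case: p => c v; rewrite /lidx /=; have := ltn_ord v; case: c; lia. Qed.

Lemma lidx_inj : injective lidx.
Proof.
move=> [c1 v1] [c2 v2]; rewrite /lidx /=; have := ltn_ord v1; have := ltn_ord v2.
move=> l2 l1 h; have [-> vv] : c1 = c2 /\ v1 = v2.
  by case: c1 c2 h => [] [] h; split=> //; try apply: val_inj => /=; lia.
by rewrite vv.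
Qed.

Definition env s :=
  [/\ nmem s 0 0 = n, nmem s 0 1 = m,
      [/\ nmem s 20 0 = N, nmem s 21 0 = N.+1, nmem s 22 0 = (n + n)%N
        & nmem s 23 0 = (n.-1).*2],
      forall e : 'I_m, nmem s 3 e = (e \in safe G)
    & [/\ forall a, nmem s 5 (idx (Some a)) = lidx (a.2, atl a),
          forall a, nmem s 6 (idx (Some a)) = lidx (a.2, ahd a),
          forall a, nmem s 7 (idx (Some a)) = ahd a
        & forall x, rmem s 1 (idx x) = tcost x]].

Lemma env_same na ra s s' : same na ra s s' ->
  all (fun i : nat => i \notin na) [:: 0; 3; 5; 6; 7; 20; 21; 22;
    23]%N && (1%N \notin ra) ->
  env s -> env s'.
Proof.
move=> [h1 h2] /andP[/and5P[a0 a3 a5 a6 /and5P[a7 a20 a21 a22 /andP[a23 _]]] r1].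
move=> [e1 e2 [e3 e4 e5 e6] e7 [e8 e9 e10 e11]].
by split; [| |split| |split] => *; rewrite ?h1 ?h2.
Qed.

Definition holds (a : nat) X s := forall x, nmem s a (idx x) = (x \in X).

Lemma holds_same na ra s s' (a : nat) X : same na ra s s' -> a \notin na ->
  holds a X s -> holds a X s'.
Proof. by move=> [h1 _] ha h x; rewrite h1. Qed.

Lemma label_runs s : env s ->
  runs b label_prog s (fun s' => forall i, (i < n + n)%N -> nmem s' 12 i = i).
Proof.
move=> [_ _ [_ _ eW _] _ _].
apply: (runs_for (n := (n + n)%N)
  (Inv := fun k s' => forall i, (i < k)%N -> nmem s' 12 i = i)) => //; first by lia.
move=> k s' ltk _ ik Ik; apply: runs_nset => /= i lei; rewrite /upd /= ik.
by case: eqP => [->//|/eqP ne]; apply: Ik; rewrite ltn_neqAle ne -ltnS.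
Qed.

Lemma relabel_runs s : env s ->
  runs b relabel_prog s (fun s' => forall i, (i < n + n)%N ->
    nmem s' 12 i = if nmem s 12 i == nmem s 41 0 then nmem s 42 0 else nmem s 12 i).
Proof.
move=> [_ _ [_ _ eW _] _ _].
apply: runs_weaken (_ : runs _ _ _ (fun s' => forall i,
    nmem s' 12 i = if (i < n + n)%N && (nmem s 12 i == nmem s 41 0)
                   then nmem s 42 0 else nmem s 12 i)) _; last first.
  by move=> s' _ h i lti; rewrite h lti.
apply: (runs_for (n := (n + n)%N) (Inv := fun k s' => forall i,
    nmem s' 12 i = if (i < k)%N && (nmem s 12 i == nmem s 41 0)
                   then nmem s 42 0 else nmem s 12 i)) => //; first by lia.
move=> k s' ltk sm ik Ik; have [sm1 _] := sm.
have e1 : nmem s' 41 0 = nmem s 41 0 by apply: sm1.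
have e2 : nmem s' 42 0 = nmem s 42 0 by apply: sm1.
have e3 : nmem s' 12 k = nmem s 12 k by rewrite Ik ltnn.
apply: runs_if; rewrite /= ik e1 e3 -eqn_leq => h.
  apply: runs_nset => /= i; rewrite /upd /= ik e2 ltnS leq_eqVlt.
  by case: eqP => [->|_] /=; rewrite ?h.
apply: runs_skip => /= i; rewrite /upd /= Ik ltnS [in RHS]leq_eqVlt.
by case: (altP (i =P k)) => [->|_] //=; rewrite ltnn (negPf h).

Qed.

(** The right-hand side has the shape of [gconnU1]: replacing the label [x] by [y] has the effect of
    adding an edge on connectedness. *)
Lemma relabelE (P Q x y : nat) : x != y ->
  ((if P == x then y else P) == (if Q == x then y else Q)) =
  [|| P == Q, (P == x) && (y == Q) | (P == y) && (x == Q)].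
Proof.
move=> xy; case: (altP (P =P x)) => [->|Px]; case: (altP (Q =P x)) => [->|Qx].
- by rewrite !eqxx.
- by rewrite [x == Q]eq_sym (negPf Qx) andbF orbF.
- by rewrite eqxx andbT (negPf Px).
- by rewrite [x == Q]eq_sym (negPf Qx) andbF !orbF.
Qed.

Lemma ind1_runs s X : env s -> holds 11 X s ->
  runs b ind1_prog s (fun s' => nmem s' 40 0 = oind (@ind1 _ G) X).
Proof.
move=> es hX; apply: runs_seqw (label_runs es) _ => s1 sm1 lab1.
have es1 : env s1 by apply: env_same sm1 isT es.
have hX1 : holds 11 X s1 by apply: holds_same sm1 _ hX.
apply: runs_seq; apply: runs_nset => /=; set s2 := setn _ _ _ _.
have sm2 : same [:: 40] [::] s1 s2 by apply: same_setn.
have es2 : env s2 by apply: env_same sm2 isT es1.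
have hX2 : holds 11 X s2 by apply: holds_same sm2 _ hX1.
pose XA := Some @^-1: X; pose Xz k := [set a in XA | (idx (Some a) < k)%N].
pose f a := (a.2, atl a); pose g a := (a.2, ahd a).
(* Once a cycle is found the labels no longer describe components, so the second case says nothing
   about them. *)
pose Inv k s' := (nmem s' 40 0 = 1%N /\ ind1 (Xz k) /\
    forall p q, (nmem s' 12 (lidx p) == nmem s' 12 (lidx q)) = connect (gadj f g (Xz
      k)) p q)
  \/ (nmem s' 40 0 = 0%N /\ ~~ ind1 XA).
have XzP k a : (a \in Xz k) = (a \in XA) && (idx (Some a) < k)%N by rewrite [LHS]in_set.
have XzN : Xz N = XA by apply/setP=> a; rewrite XzP idx_Some_lt andbT.
apply: runs_weaken (_ : runs _ _ _ (Inv N)) _; last first.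
  by move=> s' _ [[-> [h _]]|[-> /negPf h]]; rewrite /oind -/XA -?XzN ?h // XzN h.
have [_ _ [eN _ _ _] _ _] := es2.
apply: (runs_for (n := N) (Inv := Inv)) => //; first by lia.
  left; split=> //; have -> : Xz 0%N = set0 by apply/setP=> a; rewrite XzP andbF inE.
  split; first exact: ind1_0.
  move=> p q; rewrite /= /upd /= !lab1 ?lidx_lt // (inj_eq lidx_inj).
  apply/eqP/idP=> [->|]; first exact: connect0.
  apply: (gconn_ind (Q := fun z => p = z)) => // c d _ /gadjP[x].
  by rewrite inE.
move=> k s' ltk sm ik Ik.
have es' : env s' by apply: env_same sm isT es2.
have hX' : holds 11 X s' by apply: holds_same sm _ hX2.
have [a ak] := idx_Some_surj ltk.
have JE : nmem s' 11 k = (a \in XA) by rewrite -ak hX' inE.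
have XzS : Xz k.+1 = if a \in XA then a |: Xz k else Xz k.
  apply/setP=> c; have [ca|ca] := eqVneq c a.
    by rewrite ca; case: ifP => aX; rewrite ?in_setU1 !XzP aX ?eqxx ?ak ?ltnSn.
  have -> : (c \in (if a \in XA then a |: Xz k else Xz k)) = (c \in Xz k).
    by case: ifP; rewrite // in_setU1 (negPf ca).
  rewrite !XzP ltnS leq_eqVlt -[X in _ == X]ak (inj_eq idx_inj).
  by rewrite (inj_eq Some_inj) (negPf ca).
have akX : a \notin Xz k by rewrite XzP ak ltnn andbF.
have [_ _ _ _ [eA eB _ _]] := es'.
apply: runs_if; rewrite /= ik JE -ltnNge; last first.
  rewrite lt0b => /negPf aX; apply: runs_skip; rewrite aX in XzS.
  rewrite /Inv XzS; case: Ik => [[h1 [h2 h3]]|[h1 h2]]; [left|right].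
    by split=> //; split=> // p q; rewrite -h3.
  by split.
rewrite lt0b => aX; rewrite aX in XzS.
apply: runs_seq; apply: runs_nset; rewrite /= ik -ak eA.
apply: runs_seq; apply: runs_nset; rewrite /= /upd /= ik -ak eB.
set s4 := setn _ _ _ _.
have sm4 : same [:: 41; 42] [::] s' s4.
  by split=> // c i; rewrite !inE negb_or => /andP[/negPf c1 /negPf c2];
    rewrite /= /upd c1 c2.
have es4 : env s4 by apply: env_same sm4 isT es'.
have v41 : nmem s4 41 0 = nmem s' 12 (lidx (f a)) by rewrite /= /upd.
have v42 : nmem s4 42 0 = nmem s' 12 (lidx (g a)) by rewrite /= /upd.
have lab4 i : nmem s4 12 i = nmem s' 12 i by apply: (proj1 sm4).
have ok4 : nmem s4 40 0 = nmem s' 40 0 by apply: (proj1 sm4).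
clearbody s4; apply: runs_if; rewrite /= -eqn_leq v41 v42 => heq.
  apply: runs_nset; right; split; first by rewrite /= /upd.
  case: Ik => [[_ [i1 h]]|[]//]; apply/negP=> i2.
  have : ind1 (Xz k.+1).
    apply: ind_sub (matroid1 G) _ _ _ i2; apply/subsetP=> c; rewrite XzP.
    by case/andP.
  by rewrite XzS /ind1 forestU1 // /spanned -h heq andbF.
apply: runs_weaken (relabel_runs es4) _ => s5 sm5 h5.
have ok5 : nmem s5 40 0 = nmem s' 40 0 by rewrite (proj1 sm5).
case: Ik => [[h1 [h2 h3]]|[h1 h2]]; [left|right]; rewrite /= /upd /= ok5 h1; last by [].
split=> //; split.
  by rewrite ak XzS /ind1 forestU1 // [forest _ _ _]h2 /= /spanned -h3.
move=> p q; rewrite !h5 ?lidx_lt // !lab4 v41 v42 relabelE // ak XzS gconnU1 -!h3.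
by [].
Qed.

Lemma forall_ltnS p (P : pred 'I_p) k (ltk : (k < p)%N) :
  [forall i : 'I_p, (i < k.+1)%N ==> P i] =
  [forall i : 'I_p, (i < k)%N ==> P i] && P (Ordinal ltk).
Proof.
apply/forallP/andP=> [h|[/forallP h hk] i].
  split; last by have := h (Ordinal ltk); rewrite /= ltnSn.
  by apply/forallP=> i; apply/implyP=> lti; have := h i; rewrite ltnW.
rewrite ltnS leq_eqVlt; apply/implyP=> /orP[/eqP ik|lti]; last by have := h i; rewrite lti.
by rewrite (_ : i = Ordinal ltk) //; apply: val_inj.
Qed.

Lemma forall_ltn p (P : pred 'I_p) :
  [forall i : 'I_p, (i < p)%N ==> P i] = [forall i, P i].
Proof. by apply: eq_forallb => i; rewrite ltn_ord. Qed.

Definition edge_ok X (e : 'I_m) :=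
  [forall d, (e \in unsafe G) ==>
     ~~ ((Some (e, d, false) \in X) && (Some (e, d, true) \in X))].

Lemma unsafe_runs s X : env s -> holds 11 X s -> nmem s 40 0 = 1%N ->
  runs b unsafe_prog s (fun s' => nmem s' 40 0 = [forall e, edge_ok X e]).
Proof.
move=> es hX ok1; have [_ em _ _ _] := es; rewrite -forall_ltn.
apply: (runs_for (n := m) (Inv := fun k s' =>
  nmem s' 40 0 = [forall e : 'I_m, (e < k)%N ==> edge_ok X e])) => //; first by lia.
  by rewrite /= /upd /= ok1; case: forallP => // h; case: h.
move=> k s' ltk sm ik Ik; rewrite forall_ltnS; set e := Ordinal ltk.
have es' : env s' by apply: env_same sm isT es.
have hX' : holds 11 X s' by apply: holds_same sm _ hX.
have [_ em' _ esafe _] := es'.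
have x00 : nmem s' 11 k = (Some (e, false, false) \in X) by rewrite -hX' /idx /= !addn0.
have x01 : nmem s' 11 (k + (m + m)) = (Some (e, false, true) \in X).
  by rewrite -hX' /idx /= !addn0.
have x10 : nmem s' 11 (k + m) = (Some (e, true, false) \in X).
  by rewrite -hX' /idx /= !addn0.
have x11 : nmem s' 11 (k + m + (m + m)) = (Some (e, true, true) \in X).
  by rewrite -hX' /idx /=.
have sE : nmem s' 3 k = (e \in safe G) by rewrite -esafe.
have okE : edge_ok X e = ~~ ((e \notin safe G) &&
    (((Some (e, false, false) \in X) && (Some (e, false, true) \in X)) ||
     ((Some (e, true, false) \in X) && (Some (e, true, true) \in X)))).
  rewrite /edge_ok; have -> : (e \in unsafe G) = (e \notin safe G) by rewrite inE.
  case: (e \in safe G) => /=; first by apply/forallP.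
  apply/forallP/norP=> [h|[h1 h2] []//].
  by split; [apply: (h false)|apply: (h true)].
apply: runs_if; rewrite /= ik em' x00 x01 x10 x11 sE -!ltnNge !lt0b leqn0 eqb0 negb_and
  !negbK => h.
  apply: runs_nset => /=; rewrite /upd /= okE h andbF //.
by apply: runs_skip; rewrite /= /upd /= Ik okE negb_and negbK negb_or h andbT.
Qed.

Lemma count_runs s X (v : 'I_n) : env s -> holds 11 X s -> nmem s 35 0 = v ->
  runs b count_prog s (fun s' =>
    nmem s' 43 0 = #|[set a in Some @^-1: X | ahd a == v]|).
Proof.
move=> es hX ev; apply: runs_seq; apply: runs_nset => /=; set s2 := setn _ _ _ _.
have sm2 : same [:: 43] [::] s s2 by apply: same_setn.
have es2 : env s2 by apply: env_same sm2 isT es.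
have hX2 : holds 11 X s2 by apply: holds_same sm2 _ hX.
have ev2 : nmem s2 35 0 = v by [].
have c0 : nmem s2 43 0 = 0%N by [].
clearbody s2; have [_ _ [eN _ _ _] _ _] := es2.
pose C k := [set a in Some @^-1: X | (ahd a == v) && (idx (Some a) < k)%N].
have CP k a : (a \in C k) = [&& a \in Some @^-1: X, ahd a == v & (idx (Some a) < k)%N].
  by rewrite [LHS]in_set.
apply: runs_weaken (_ : runs _ _ _ (fun s' => nmem s' 43 0 = #|C N|)) _; last first.
  move=> s' _ ->; apply: eq_card => a; rewrite CP idx_Some_lt andbT.
  by rewrite [RHS]in_set.
apply: (runs_for (n := N) (Inv := fun k s' => nmem s' 43 0 = #|C k|)) => //; first by lia.
  rewrite /= /upd /= c0; apply/esym/eqP; rewrite cards_eq0; apply/eqP/setP=> a.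
  by rewrite CP !andbF inE.
move=> k s' ltk sm ik Ik.
have es' : env s' by apply: env_same sm isT es2.
have hX' : holds 11 X s' by apply: holds_same sm _ hX2.
have ev' : nmem s' 35 0 = v by rewrite (proj1 sm).
have [a ak] := idx_Some_surj ltk.
have [_ _ _ _ [_ _ eH _]] := es'.
have JE : nmem s' 11 k = (a \in Some @^-1: X) by rewrite -ak hX' inE.
have HE : nmem s' 7 k = ahd a by rewrite -ak eH.
have CS : C k.+1 = if (a \in Some @^-1: X) && (ahd a == v) then a |: C k else C k.
  apply/setP=> c; have [->|ca] := eqVneq c a.
    by case: ifP => h; rewrite ?in_setU1 !CP !andbA h ?eqxx ?ak ?ltnSn.
  have -> : (c \in (if (a \in Some @^-1: X) && (ahd a == v) then a |: C k else C k)) =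
    (c \in C k).
    by case: ifP; rewrite // in_setU1 (negPf ca).
  rewrite !CP ltnS leq_eqVlt -[X in idx _ == X]ak (inj_eq idx_inj).
  by rewrite (inj_eq Some_inj) (negPf ca).
have akC : a \notin C k by rewrite CP ak ltnn !andbF.
apply: runs_if; rewrite /= ik JE HE ev' -ltnNge lt0b -eqn_leq (inj_eq val_inj) => h.
  apply: runs_nset; rewrite /= /upd /= Ik CS h cardsU1 akC addn1.
  by [].
by apply: runs_skip; rewrite /= /upd /= Ik CS (negPf h).
Qed.

Lemma heads_runs s X (ok : bool) : env s -> holds 11 X s -> nmem s 40 0 = ok ->
  runs b heads_prog s (fun s' => nmem s' 40 0 = ok &&
    [forall v : 'I_n, #|[set a in Some @^-1: X | ahd a == v]| <= capacity v]%N).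
Proof.
move=> es hX ok1; have [en _ _ _ _] := es; rewrite -forall_ltn.
apply: (runs_for (n := n) (Inv := fun k s' => nmem s' 40 0 = ok &&
  [forall v : 'I_n, (v < k)%N ==>
     (#|[set a in Some @^-1: X | ahd a == v]| <= capacity v)%N])) => //; first by lia.
  rewrite /= /upd /= ok1; case: forallP => [_|h]; first by rewrite andbT.
  by case: h.
move=> k s' ltk sm ik Ik; rewrite forall_ltnS; set v := Ordinal ltk.
have es' : env s' by apply: env_same sm isT es.
have hX' : holds 11 X s' by apply: holds_same sm _ hX.
apply: runs_seqw (@count_runs s' X v es' hX' ik) _ => s1 sm1 h1.
have i1 : nmem s1 35 0 = k by rewrite (proj1 sm1).
have o1 : nmem s1 40 0 = nmem s' 40 0 by rewrite (proj1 sm1).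
have capE : (2 - (2 - (k + k)))%N = capacity v.
  by rewrite [RHS](_ : _ = if k == 0%N then 0%N else 2%N) //; case: eqP; lia.
apply: runs_if; rewrite /= h1 i1 capE => h.
  by apply: runs_skip; rewrite /= /upd /= o1 Ik h andbT.
by apply: runs_nset; rewrite /= /upd /= (negPf h) !andbF.
Qed.

Lemma ind2_runs s X : env s -> holds 11 X s ->
  runs b ind2_prog s (fun s' => nmem s' 40 0 = oind (@ind2 _ G) X).
Proof.
move=> es hX; apply: runs_seq; apply: runs_nset => /=; set s1 := setn _ _ _ _.
have sm1 : same [:: 40] [::] s s1 by apply: same_setn.
have es1 : env s1 by apply: env_same sm1 isT es.
have hX1 : holds 11 X s1 by apply: holds_same sm1 _ hX.
have o1 : nmem s1 40 0 = 1%N by [].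
clearbody s1; apply: runs_seqw (unsafe_runs es1 hX1 o1) _ => s2 sm2 o2.
have es2 : env s2 by apply: env_same sm2 isT es1.
have hX2 : holds 11 X s2 by apply: holds_same sm2 _ hX1.
apply: runs_weaken (heads_runs es2 hX2 o2) _ => s3 _ ->.
rewrite /oind /ind2 andbC; congr (nat_of_bool (_ && _)).
by apply: eq_forallb => e; apply: eq_forallb => d; rewrite !inE.
Qed.

Definition earc B : rel T := exarc (oind (@ind1 _ G)) (oind (@ind2 _ G)) B.

Lemma arc_runs s B u v : env s -> holds 10 B s ->
  nmem s 50 0 = idx u -> nmem s 51 0 = idx v -> (v \in B) = (u \notin B) ->
  runs b arc_prog s (fun s' => nmem s' 40 0 = earc B u v).
Proof.
move=> es hB eu ev uv; have [_ _ [_ eS _ _] _ _] := es.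
apply: runs_seqw (_ : runs _ _ _ (fun s' => forall i, (i < N.+1)%N -> nmem s' 11 i =
  nmem s 10 i)) _.
  apply: (runs_for (n := N.+1) (Inv := fun k s' =>
    forall i, (i < k)%N -> nmem s' 11 i = nmem s 10 i)) => //; first by lia.
  move=> k s' ltk sm ik Ik; apply: runs_nset => i; rewrite /= /upd /= ik ltnS leq_eqVlt.
  by case: eqP => [->|_] //= h; [rewrite (proj1 sm)|apply: Ik].
move=> s1 sm1 c1.
have es1 : env s1 by apply: env_same sm1 isT es.
have hB1 : holds 10 B s1 by apply: holds_same sm1 _ hB.
have u1 : nmem s1 50 0 = idx u by rewrite (proj1 sm1).
have v1 : nmem s1 51 0 = idx v by rewrite (proj1 sm1).
have h1 : holds 11 B s1 by move=> x; rewrite c1 ?idx_lt.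
apply: runs_seq; apply: runs_nset; rewrite /= u1 hB1.
apply: runs_seq; apply: runs_nset; rewrite /= /upd /= v1 hB1.
set s2 := setn _ _ _ _.
have sm2 : same [:: 11] [::] s1 s2.
  by split=> // c i; rewrite !inE => /negPf c2; rewrite /= /upd c2.
have es2 : env s2 by apply: env_same sm2 isT es1.
have hB2 : holds 10 B s2 by apply: holds_same sm2 _ hB1.
have u2 : nmem s2 50 0 = idx u by rewrite (proj1 sm2).
have h2 x : nmem s2 11 (idx x) = (x \in B) (+) ((x == u) || (x == v)).
  rewrite /= /upd /= !(inj_eq idx_inj) h1; have [->|xv] := eqVneq x v.
    by rewrite orbT; case: (v \in B).
  by rewrite orbF; have [->|xu] := eqVneq x u; rewrite ?addbF // addbT; case: (u \in B).
clearbody s2.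
apply: runs_if; rewrite /= u2 hB2 -ltnNge lt0b => uB.
  apply: runs_weaken (_ : runs _ _ _ (fun s' => nmem s' 40 0 = oind (@ind1 _ G) (swap B
    u v))) _.
    apply: ind1_runs => // x; rewrite h2 !inE.
    have [->|xv] := eqVneq x v; first by rewrite orbT uv uB.
    have [->|xu] := eqVneq x u; first by rewrite uB.
    by rewrite addbF.
  by move=> s' _ ->; rewrite /earc /exarc uB uv uB orbF.
apply: runs_weaken (_ : runs _ _ _ (fun s' => nmem s' 40 0 = oind (@ind2 _ G) (swap B v
  u))) _.
  apply: ind2_runs => // x; rewrite h2 !inE.
  have [->|xu] := eqVneq x u; first by rewrite (negPf uB).
  have [->|xv] := eqVneq x v; first by rewrite uv uB.
  by rewrite addbF.
by move=> s' _ ->; rewrite /earc /exarc (negPf uB) uv uB.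
Qed.

End Programs.

Arguments idx_inj {R G}.

(** * Search for an augmenting walk *)

(** The tables consist of consecutive layers with one cell per element. Cells 60 and 61 hold the
    offsets of the previous and of the current layer, updated by addition since the machine cannot
    multiply. *)
Local Notation src := (NAdd (sv 60) (sv 50)).
Local Notation dst := (NAdd (sv 61) (sv 51)).
Local Notation fin := (NAdd (sv 61) (sv 20)).

Definition update_prog :=
  Seq (NSet 13 dst (NConst 1))
 (Seq (RSet 2 dst (RGet 2 src)) (NSet 14 dst (sv 50))).

Definition relax_prog :=
  If (BAnd (bnz (NGet 13 src)) (BNot (beq (NGet 10 (sv 50)) (NGet 10 (sv 51)))))
    (Seq arc_prog
      (If (BAnd (bnz (sv 40))
             (bor (BLeN (NGet 13 dst) (NConst 0))
                  (BNot (BLeR (RGet 2 dst) (RGet 2 src)))))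
         update_prog Skip))
    Skip.

(** The length of an arc depends on its head only, so the best predecessor is selected first and the
    signed cost of the head is added once at the end. *)
Definition row_prog :=
  Seq (NSet 13 dst (NConst 0))
 (Seq (For 50 21 0 relax_prog)
   (If (bnz (NGet 10 (sv 51)))
      (RSet 2 dst (RSub (RGet 2 dst) (RGet 1 (sv 51))))
      (RSet 2 dst (RAdd (RGet 2 dst) (RGet 1 (sv 51)))))).

Definition layer_prog :=
  Seq (assign 61 (NAdd (sv 60) (sv 21))) (For 51 21 0 row_prog).

Definition record_prog :=
  Seq (assign 62 (NConst 1))
 (Seq (RSet 3 (NConst 0) (RGet 2 fin)) (assign 63 (sv 61))).

(** The cell of the artificial element in the new layer describes the closed walks. A record is
    replaced only by a strictly shorter one, so ties keep the walk with fewer arcs; the cell is then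
    cleared so that no walk continues through the artificial element. *)
Definition close_prog :=
  Seq (If (BAnd (bnz (NGet 13 fin))
             (bor (BLeN (sv 62) (NConst 0))
                  (BNot (BLeR (RGet 3 (NConst 0)) (RGet 2 fin)))))
         record_prog Skip)
 (Seq (NSet 13 fin (NConst 0)) (assign 60 (sv 61))).

Definition start_prog :=
  Seq (For 52 21 0 (NSet 13 (sv 52) (NConst 0)))
 (Seq (NSet 13 (sv 20) (NConst 1))
 (Seq (RSet 2 (sv 20) RZero)
 (Seq (assign 60 (NConst 0)) (assign 62 (NConst 0))))).

Definition search_prog :=
  Seq start_prog (For 53 21 0 (Seq layer_prog close_prog)).

(** Predecessors are followed from the closing arc back to layer [0], whose offset is [0]; the
    artificial element itself is never flipped. *)
Definition augment_prog :=
  Seq (assign 64 (NGet 14 (NAdd (sv 63) (sv 20))))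
 (Seq (assign 63 (NSub (sv 63) (sv 21)))
   (While (bnz (sv 63))
     (Seq (NSet 10 (sv 64) (NSub (NConst 1) (NGet 10 (sv 64))))
     (Seq (assign 64 (NGet 14 (NAdd (sv 63) (sv 64))))
       (assign 63 (NSub (sv 63) (sv 21))))))).

(** * Correctness of the search and of the augmentation *)

Section Search.

Variables (R : realFieldType) (G : fgc_instance R).
Local Notation n := (nv G).
Local Notation m := (ne G).
Local Notation A := ('I_(ne G) * bool * bool)%type.
Local Notation T := (option A).
Local Notation b := (4 * (nv G + ne G)).+1.
Local Notation N := (m + m + m + m)%N.
Implicit Types (s : state R) (x u v : T) (q : seq T).

Variable B : {set T}.
Local Notation arc := (@earc R G B).

Definition ell v : R := if v \in B then - tcost v else tcost v.

Definition keep (D : pred nat) s s' := forall i, D i ->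
  [/\ nmem s' 13 i = nmem s 13 i, nmem s' 14 i = nmem s 14 i
    & rmem s' 2 i = rmem s 2 i].

(** One Bellman equation: [r0] and [D0] are reachability and distance in the previous layer, and [c]
    is the cell of [v] in the new one. *)
Definition good (r0 : T -> bool) (D0 : T -> R) (c : nat) v s :=
  (nmem s 13 c != 0%N ->
     exists u, [/\ r0 u, arc u v, rmem s 2 c = D0 u + ell v & nmem s 14 c = idx u]) /\
  (forall u, r0 u -> arc u v -> nmem s 13 c != 0%N /\ rmem s 2 c <= D0 u + ell v).

Lemma keep_trans D s1 s2 s3 : keep D s1 s2 -> keep D s2 s3 -> keep D s1 s3.
Proof. by move=> h1 h2 i Di; have [-> -> ->] := h2 i Di; apply: h1. Qed.

Lemma same_keep na ra D s s' : same na ra s s' ->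
  [&& 13 \notin na, 14 \notin na & 2 \notin ra]%N -> keep D s s'.
Proof. by move=> [h1 h2] /and3P[a1 a2 a3] i _; rewrite !h1 ?h2. Qed.

Lemma row_runs s base v : env G s -> holds 10 B s -> nmem s 60 0 = base ->
  nmem s 61 0 = (base + N.+1)%N -> nmem s 51 0 = idx v ->
  runs b row_prog s (fun s' => keep (predC1 (base + N.+1 + idx v)%N) s s' /\
    good (fun u => nmem s 13 (base + idx u) != 0%N) (fun u => rmem s 2 (base + idx u))
      (base + N.+1 + idx v)%N v s').
Proof.
move=> es hB e60 e61 e51; set c := (base + N.+1 + idx v)%N.
set r0 := fun u => _ != _; set D0 := fun u => rmem _ _ _.
(* The cell being written lies beyond the previous layer, so the values read there are the old ones
   throughout the loop. *)
have nc u : (base + idx u)%N != c.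
  by rewrite /c -addnA eqn_add2l neq_ltn (leq_trans (idx_lt u)) ?leq_addr.
apply: runs_seq; apply: runs_nset; rewrite /= e61 e51 -/c; set s1 := setn _ _ _ _.
have sm1 : same [:: 13] [::] s s1 by apply: same_setn.
have es1 : env G s1 by apply: env_same sm1 isT es.
have hB1 : holds 10 B s1 by apply: holds_same sm1 _ hB.
have k1 : keep (predC1 c) s s1.
  by move=> i /= ic; rewrite /= /upd /= (negPf ic).
have c1 : nmem s1 13 c = 0%N by rewrite /= /upd /= eqxx.
have e60' : nmem s1 60 0 = base by [].
have e61' : nmem s1 61 0 = (base + N.+1)%N by [].
have e51' : nmem s1 51 0 = idx v by [].
clearbody s1; have [_ _ [_ eS _ _] _ _] := es1.
pose Inv k s' := [/\ keep (predC1 c) s s',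
  nmem s' 13 c != 0%N ->
     exists u, [/\ r0 u, arc u v, rmem s' 2 c = D0 u & nmem s' 14 c = idx u]
  & forall u, (idx u < k)%N -> r0 u -> arc u v -> nmem s' 13 c != 0%N /\ rmem s' 2 c <=
    D0 u].
have InvS k s' (x : nat) : Inv k s' -> Inv k (setn s' 50 0 x) by [].
apply: runs_seqw (_ : runs _ _ _ (Inv N.+1)) _.
  apply: (runs_for (n := N.+1) (Inv := Inv)) => //; first by lia.
    by apply: InvS; split=> //; rewrite c1.
  move=> k s' ltk sm ik Ik; have [u uk] := idx_surj ltk.
  have es' : env G s' by apply: env_same sm isT es1.
  have hB' : holds 10 B s' by apply: holds_same sm _ hB1.
  have f60 : nmem s' 60 0 = base by rewrite (proj1 sm).
  have f61 : nmem s' 61 0 = (base + N.+1)%N by rewrite (proj1 sm).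
  have f51 : nmem s' 51 0 = idx v by rewrite (proj1 sm).
  have [h1 h2 h3] := Ik.
  have skip s2 : keep predT s' s2 -> (r0 u -> arc u v ->
      nmem s2 13 c != 0%N /\ rmem s2 2 c <= D0 u) -> Inv k.+1 s2.
    move=> ks hu; have [g1 g2 g3] := ks c isT; split.
    - by apply: keep_trans h1 _ => i _; apply: ks.
    - by rewrite g1 g2 g3; apply: h2.
    move=> w; rewrite ltnS leq_eqVlt -[X in idx _ == X]uk (inj_eq idx_inj) =>
      /orP[/eqP->//|].
    by rewrite g1 g3; apply: h3.
  have [r1 r2 r3] := h1 _ (nc u).
  apply: runs_if; rewrite /= f60 f51 ik -uk !hB' r1 -ltnNge lt0n -eqn_leq.
    move=> /andP[ru nuv].
    have uvB : (v \in B) = (u \notin B) by move: nuv; case: (u \in B); case: (v \in B).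
    have f50 : nmem s' 50 0 = idx u by rewrite ik uk.
    apply: runs_seqw (arc_runs es' hB' f50 f51 uvB) _ => s2 sm2 a2.
    have k2 : keep predT s' s2 by apply: same_keep sm2 _.
    have g60 : nmem s2 60 0 = base by rewrite (proj1 sm2).
    have g61 : nmem s2 61 0 = (base + N.+1)%N by rewrite (proj1 sm2).
    have g51 : nmem s2 51 0 = idx v by rewrite (proj1 sm2).
    have g50 : nmem s2 50 0 = idx u by rewrite (proj1 sm2).
    have [t1 t2 t3] := k2 (base + idx u)%N isT.
    have [t4 t5 t6] := k2 c isT.
    apply: runs_if; rewrite /= a2 g60 g61 g50 g51 -/c t3 r3 -/(D0 u) -!ltnNge lt0b.
      move=> /andP[auv better].
      apply: runs_seq; apply: runs_nset; rewrite /= g61 g51 -/c.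
      apply: runs_seq; apply: runs_rset;
        rewrite /= /upd /= g60 g61 g50 g51 -/c t3 r3 -/(D0 u).
      apply: runs_nset; rewrite /= /upd /= g61 g50 g51 -/c; rewrite uk.
      apply: InvS; split.
      + move=> i /= ic; rewrite /= /upd /= (negPf ic).
        by have [-> -> ->] := k2 i isT; apply: h1.
      + by move=> _; exists u; rewrite /= /upd /= eqxx uk.
      move=> w; rewrite /= /upd /= eqxx ltnS leq_eqVlt -[X in idx _ == X]uk (inj_eq
        idx_inj).
      move=> /orP[/eqP->//|ltw] rw aw; split=> //.
      have [nz le1] := h3 w ltw rw aw; apply: le_trans le1.
      move: better; rewrite t4 t6 lt0n nz /= !negbK -ltNge.
      exact: ltW.
    move=> nbetter; apply: runs_skip; rewrite uk; apply: InvS; apply: skip => // _ auv.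
    by move: nbetter; rewrite auv /= !negbK lt0n => /andP[].
  move=> h; apply: runs_skip; rewrite uk; apply: InvS; apply: skip => // ru auv.
  by move: h; rewrite -/(r0 u) ru /= (exarc_alt auv); case: (u \in B).
move=> s2 sm2 [h1 h2 h3].
have es2 : env G s2 by apply: env_same sm2 isT es1.
have hB2 : holds 10 B s2 by apply: holds_same sm2 _ hB1.
have g61 : nmem s2 61 0 = (base + N.+1)%N by rewrite (proj1 sm2).
have g51 : nmem s2 51 0 = idx v by rewrite (proj1 sm2).
have [_ _ _ _ [_ _ _ eC]] := es2.
have fin_ s3 : (forall i, nmem s3 13 i = nmem s2 13 i) -> (forall i, nmem s3 14 i =
  nmem s2 14 i) ->
    (forall i, rmem s3 2 i = if i == c then rmem s2 2 c + ell v else rmem s2 2 i) ->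
    keep (predC1 c) s s3 /\ good r0 D0 c v s3.
  move=> i1 i2 i3; split.
    by move=> i ic; rewrite i1 i2 i3 (negPf ic); apply: h1.
  split; rewrite i1 ?i2 i3 eqxx.
    by move=> /h2[u [h4 h5 h6 h7]]; exists u; rewrite h6.
  move=> u ru auv; have [h4 h5] := h3 u (idx_lt u) ru auv.
  by split; rewrite // lerD2r.
apply: runs_if; rewrite /= g51 hB2 -ltnNge lt0b => vB.
  apply: runs_rset; apply: fin_ => // i; rewrite /= /upd /= g61 g51 eC -/c.
  by rewrite /ell vB.
apply: runs_rset; apply: fin_ => // i; rewrite /= /upd /= g61 g51 eC -/c.
by rewrite /ell (negPf vB).
Qed.

Lemma keep_good D r0 D0 c v s s' : keep D s s' -> D c ->
  good r0 D0 c v s -> good r0 D0 c v s'.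
Proof. by rewrite /good => k /k[-> -> ->]. Qed.

Lemma layer_runs s base : env G s -> holds 10 B s -> nmem s 60 0 = base ->
  runs b layer_prog s (fun s' =>
    [/\ keep (fun i => i < base + N.+1)%N s s', nmem s' 61 0 = (base + N.+1)%N
      & forall v, good (fun u => nmem s 13 (base + idx u) != 0%N)
          (fun u => rmem s 2 (base + idx u)) (base + N.+1 + idx v)%N v s']).
Proof.
move=> es hB e60; set r0 := fun u => _ != _; set D0 := fun u => rmem _ _ _.
have [_ _ [_ eS _ _] _ _] := es.
apply: runs_seq; apply: runs_nset; rewrite /= e60 eS; set s1 := setn _ _ _ _.
have sm1 : same [:: 61] [::] s s1 by apply: same_setn.
have es1 : env G s1 by apply: env_same sm1 isT es.
have hB1 : holds 10 B s1 by apply: holds_same sm1 _ hB.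
have k1 D : keep D s s1 by apply: same_keep sm1 _.
have e60' : nmem s1 60 0 = base by [].
have e61' : nmem s1 61 0 = (base + N.+1)%N by [].
clearbody s1; have [_ _ [_ eS1 _ _] _ _] := es1.
pose Inv k s' := keep (fun i => i < base + N.+1)%N s s' /\
  forall v, (idx v < k)%N -> good r0 D0 (base + N.+1 + idx v)%N v s'.
apply: runs_weaken (_ : runs _ _ _ (Inv N.+1)) _; last first.
  move=> s' sm [h1 h2]; split=> //; first by rewrite (proj1 sm).
  by move=> v; apply: h2; apply: idx_lt.
apply: (runs_for (n := N.+1) (Inv := Inv)) => //; first by lia.
  by split=> //; exact: (k1 (fun i => i < base + N.+1)%N).
move=> k s' ltk sm ik [h1 h2]; have [v vk] := idx_surj ltk.
have es' : env G s' by apply: env_same sm isT es1.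
have hB' : holds 10 B s' by apply: holds_same sm _ hB1.
have f60 : nmem s' 60 0 = base by rewrite (proj1 sm).
have f61 : nmem s' 61 0 = (base + N.+1)%N by rewrite (proj1 sm).
rewrite -vk in ik *.
apply: runs_weaken (row_runs es' hB' f60 f61 ik) _ => s2 _ [h3 h4].
have h5 : keep (fun i => i < base + N.+1)%N s s2.
  apply: keep_trans h1 _ => i lti; apply: h3 => /=.
  by rewrite neq_ltn (leq_trans lti) ?leq_addr.
suff : Inv (idx v).+1 s2 by [].
split=> // w; rewrite ltnS leq_eqVlt (inj_eq idx_inj) => /orP[/eqP->|ltw]; last first.
  apply: keep_good h3 _ (h2 w _); last by rewrite -vk.
  by rewrite /= eqn_add2l neq_ltn ltw.
have lt' u : (base + idx u < base + N.+1)%N by rewrite ltn_add2l idx_lt.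
case: h4 => g1 g2; split=> [/g1[u [a1 a2 a3 a4]]|u ru auv].
  by exists u; have [k13 k14 k2] := h1 _ (lt' u); rewrite /r0 /D0 -k13 -k2.
have [k13 k14 k2] := h1 _ (lt' u); rewrite /D0 -k2; apply: g2 => //.
by rewrite k13.
Qed.

Definition wl q : R := \sum_(v <- q) ell v.

Local Notation cwalk q := (closed_walk None (oind (@ind1 _ G)) (oind (@ind2 _ G)) B q).

Definition pchain s q := forall i, (i < size q)%N ->
  nmem s 14 (i.+1 * N.+1 + idx (nth None q i)) = idx (nth None (None :: q) i).

(** The tables range over walks of a given length with possible repetitions, which a recursion on
    the length can compute. That the best closed walk has no repetition follows from
    [extreme_step]. *)
Definition layer_ok s j := forall v,
  (nmem s 13 (j * N.+1 + idx v) != 0%N ->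
     exists q, [/\ walk arc None q, size q = j, last None q = v,
       rmem s 2 (j * N.+1 + idx v) = wl q & pchain s q]) /\
  (forall q, walk arc None q -> size q = j -> last None q = v ->
     nmem s 13 (j * N.+1 + idx v) != 0%N /\ rmem s 2 (j * N.+1 + idx v) <= wl q).

Definition found s j q :=
  [/\ cwalk q, (size q < j)%N,
      nmem s 63 0 = ((size q).+1 * N.+1)%N /\ rmem s 3 0 = wl q,
      nmem s 14 ((size q).+1 * N.+1 + N) = idx (last None q) /\ pchain s q
    & forall q', cwalk q' -> (size q' < j)%N ->
        wl q <= wl q' /\ (wl q' = wl q -> (size q <= size q')%N)].

Definition search_inv j s :=
  [/\ nmem s 60 0 = (j * N.+1)%N, layer_ok s j
    & (nmem s 62 0 = 0%N /\ forall q, cwalk q -> (j <= size q)%N) \/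
      (nmem s 62 0 = 1%N /\ exists q, found s j q)].

Lemma mem_walk q v : walk arc None q -> v \in q -> v != None.
Proof. by move=> /andP[_ nq] vq; apply: contraNneq nq => <-. Qed.

Lemma walk_rcons q v : walk arc None (rcons q v) =
  [&& walk arc None q, arc (last None q) v & v != None].
Proof.
rewrite /walk rcons_path mem_rcons inE negb_or [None == v]eq_sym -!andbA.
by do !bool_congr.
Qed.

Lemma wl_rcons q v : wl (rcons q v) = wl q + ell v.
Proof. by rewrite /wl -cats1 big_cat big_seq1. Qed.

Lemma pchain_keep j s s' q : keep (fun i => i < j.+1 * N.+1)%N s s' ->
  (size q <= j)%N -> pchain s q -> pchain s' q.
Proof.
move=> k leq pq i lti; rewrite -pq //.
have [] // := k (i.+1 * N.+1 + idx (nth None q i))%N;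
  apply: leq_trans (_ : (i.+2 * N.+1 <= _)%N).
  by rewrite [in ltnRHS]mulSn addnC ltn_add2r idx_lt.
by rewrite leq_mul2r /= ltnS (leq_trans lti).
Qed.

Lemma ell_None : ell None = 0.
Proof. by rewrite /ell /= oppr0 if_same. Qed.

Lemma found_same na ra s s' j q : same na ra s s' -> (14 \notin na)%N ->
  nmem s' 63 0 = nmem s 63 0 -> rmem s' 3 0 = rmem s 3 0 ->
  found s j q -> found s' j q.
Proof.
move=> [h _] na14 e63 e3 [a1 a2 [a3 a4] [a5 a6] a7]; split=> //.
- by rewrite e63 e3.
- by split; [rewrite h|move=> i lti; rewrite h // a6].
Qed.

Lemma start_runs s : env G s ->
  runs b start_prog s (search_inv 0).
Proof.
move=> es; have [_ _ [_ eS _ _] _ _] := es.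
apply: runs_seqw (_ : runs _ _ _ (fun s' => forall i, (i < N.+1)%N -> nmem s' 13 i =
  0%N)) _.
  apply: (runs_for (n := N.+1) (Inv := fun k s' =>
    forall i, (i < k)%N -> nmem s' 13 i = 0%N)) => //; first by lia.
  move=> k s' ltk sm ik Ik; apply: runs_nset => i; rewrite /= /upd /= ik ltnS leq_eqVlt.
  by case: eqP => [->|_] //= h; apply: Ik.
move=> s1 sm1 z1; have es1 : env G s1 by apply: env_same sm1 isT es.
have [_ _ [eN _ _ _] _ _] := es1.
apply: runs_seq; apply: runs_nset; apply: runs_seq; apply: runs_rset.
apply: runs_seq; apply: runs_nset; apply: runs_nset.
rewrite /= /upd /= eN; split=> //=; last by left; split.
move=> v; have iN : (idx v == N) = (v == None).
  by rewrite -[N]/(idx (None : T)) (inj_eq idx_inj).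
rewrite mul0n add0n /= /upd /= iN; split.
  have [->|_] := eqVneq v None; last by rewrite z1 ?idx_lt.
  by exists [::]; split; rewrite /wl ?big_nil.
move=> q wq /size0nil q0; rewrite q0 /= => <-; rewrite eqxx /wl big_nil.
by [].
Qed.

Lemma layer_step s s1 j : layer_ok s j ->
  keep (fun i => i < j.+1 * N.+1)%N s s1 ->
  (forall v, good (fun u => nmem s 13 (j * N.+1 + idx u) != 0%N)
     (fun u => rmem s 2 (j * N.+1 + idx u)) (j.+1 * N.+1 + idx v)%N v s1) ->
  forall v, (nmem s1 13 (j.+1 * N.+1 + idx v) != 0%N ->
     exists q, [/\ walk arc None q, size q = j, arc (last None q) v,
       rmem s1 2 (j.+1 * N.+1 + idx v) = wl q + ell v
     & pchain s1 q /\ nmem s1 14 (j.+1 * N.+1 + idx v) = idx (last None q)]) /\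
  (forall q, walk arc None q -> size q = j -> arc (last None q) v ->
     nmem s1 13 (j.+1 * N.+1 + idx v) != 0%N /\
     rmem s1 2 (j.+1 * N.+1 + idx v) <= wl q + ell v).
Proof.
move=> ok ks g v; have [g1 g2] := g v; split=> [/g1[u [ru auv De pe]]|q wq sq aq].
  have [/(_ ru)[q [wq sq lq Dq pq]] _] := ok u; exists q; rewrite lq De Dq pe.
  by split=> //; split=> //; apply: pchain_keep ks _ pq; rewrite sq.
have [_ /(_ q wq sq erefl)[r0 D0]] := ok (last None q).
have [h1 h2] := g2 _ r0 aq; split=> //; apply: le_trans h2 _.
by rewrite lerD2r.
Qed.

Lemma pchain_rcons s q v : pchain s q ->
  nmem s 14 ((size q).+1 * N.+1 + idx v) = idx (last None q) -> pchain s (rcons q v).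
Proof.
move=> pq pv i; rewrite size_rcons ltnS leq_eqVlt => /orP[/eqP->|lti].
  rewrite nth_rcons ltnn eqxx pv; congr idx.
  by rewrite -rcons_cons nth_rcons /= ltnSn -nth_last; case: (q).
rewrite nth_rcons lti pq // -rcons_cons nth_rcons /= ltnS ltnW //.
Qed.

Lemma search_step s j : env G s -> holds 10 B s -> search_inv j s ->
  runs b (Seq layer_prog close_prog) s (search_inv j.+1).
Proof.
move=> es hB [e60 ok best].
apply: runs_seqw (layer_runs es hB e60) _ => s1 sm1.
have -> : (j * N.+1 + N.+1 = j.+1 * N.+1)%N by rewrite mulSn addnC.
move=> [ks f61 g1].
have es1 : env G s1 by apply: env_same sm1 isT es.
have [_ _ [eN _ _ _] _ _] := es1.
have st := layer_step ok ks g1.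
set nb := (j.+1 * N.+1)%N in ks f61 g1 st.
have finE : (nb + N)%N = (nb + idx (None : T))%N by [].
have [cl1 cl2] := st None; rewrite -finE ell_None in cl1 cl2.
have found1 q : found s j q -> found s1 j q.
  move=> [a1 a2 [a3 a4] [a5 a6] a7]; split=> //.
  - by rewrite (proj1 sm1) // (proj2 sm1).
  - split; last by apply: pchain_keep ks _ a6; apply: ltnW.
    rewrite -a5; have [] // := ks ((size q).+1 * N.+1 + N)%N.
    rewrite (@leq_trans ((size q).+2 * N.+1)) // ?[in ltnRHS]mulSn; last first.
      by rewrite leq_mul2r /= ltnS.
    by rewrite [ltnLHS]addnC ltn_add2r.
have foundW q : found s1 j q -> (nmem s1 13 (nb + N) != 0%N -> wl q <= rmem s1 2 (nb +
  N)) ->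
    found s1 j.+1 q.
  move=> [a1 a2 a3 a4 a7] h; split=> //; first exact: ltnW.
  move=> q' cq'; rewrite ltnS leq_eqVlt => /orP[/eqP sq'|]; last exact: a7.
  have /andP[wq' aq'] := cq'; have [r' d'] := cl2 q' wq' sq' aq'.
  rewrite addr0 in d'; split; first exact: le_trans (h r') d'.
  by move=> _; rewrite sq' ltnW.
have new q : cwalk q -> size q = j -> (forall q', cwalk q' -> (size q' < j)%N -> wl q <
  wl q') ->
    wl q = rmem s1 2 (nb + N) ->
    forall q', cwalk q' -> (size q' < j.+1)%N ->
        wl q <= wl q' /\ (wl q' = wl q -> (size q <= size q')%N).
  move=> cq sq lt1 De q' cq'; rewrite ltnS leq_eqVlt => /orP[/eqP sq'|lt']; last first.
    by have lt2 := lt1 q' cq' lt'; split; [exact: ltW|move=> e2; rewrite e2 ltxx in lt2].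
  have /andP[wq' aq'] := cq'; have [r' d'] := cl2 q' wq' sq' aq'.
  by rewrite addr0 -De in d'; rewrite sq sq'.
have best1 : (nmem s1 62 0 = 0%N /\ forall q, cwalk q -> (j <= size q)%N) \/
      (nmem s1 62 0 = 1%N /\ exists q, found s1 j q).
  rewrite (proj1 sm1) //; case: best => [|[h [q fq]]]; [by left|right].
  by split=> //; exists q; apply: found1.
apply: runs_seqw (_ : runs _ _ _ (fun s2 =>
  (nmem s2 62 0 = 0%N /\ forall q, cwalk q -> (j.+1 <= size q)%N) \/
      (nmem s2 62 0 = 1%N /\ exists q, found s2 j.+1 q))) _.
  apply: runs_if; rewrite /= f61 eN -!ltnNge !lt0n ?negbK.
    move=> /andP[nz better].
    have [q [wq sq aq De [pq pe]]] := cl1 nz; rewrite addr0 in De.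
    have cq : cwalk q by rewrite /closed_walk wq.
    apply: runs_seq; apply: runs_nset; apply: runs_seq; apply: runs_rset; apply: runs_nset.
    rewrite /= /upd /= f61 eN; right; split=> //; exists q; split=> //=.
    - by rewrite sq.
    - by rewrite sq.
    - by split; [rewrite sq; exact: pe|exact: pq].
    apply: new => // q' cq' lt'; case: best1 => [[_ h]|[h [q0 [a1 a2 [a3 a4] _ a7]]]].
      by have := h q' cq'; rewrite leqNgt lt'.
    move: better; rewrite h /= -ltNge a4 De => lt0.
    by have [le1 _] := a7 q' cq' lt'; apply: lt_le_trans le1.
  move=> nbetter; apply: runs_skip; case: best1 => [[h1 h2]|[h1 [q fq]]]; [left|right];
    split=> //.
    move=> q cq; rewrite ltn_neqAle h2 // andbT; apply/negP=> /eqP sq.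
    have /andP[wq aq] := cq; have [r' _] := cl2 q wq (esym sq) aq.
    by move: nbetter; rewrite r' h1.
  exists q; apply: foundW => // nz; move: nbetter; rewrite nz h1 /= !negbK.
  by case: fq => _ _ [_ ->].
move=> s2 sm2 best2.
have g61 : nmem s2 61 0 = nb by rewrite (proj1 sm2).
have gN : nmem s2 20 0 = N by rewrite (proj1 sm2).
apply: runs_seq; apply: runs_nset; apply: runs_nset; rewrite /= /upd /= g61 gN.
set s3 := setn _ _ _ _.
have sm3 : same [:: 13; 60] [::] s2 s3.
  by split=> // c i; rewrite !inE negb_or => /andP[/negPf c1 /negPf c2];
    rewrite /= /upd c1 c2.
have e13 i : nmem s3 13 i = if i == (nb + N)%N then 0%N else nmem s1 13 i.
  by rewrite /= /upd /=; case: eqP => // _; rewrite (proj1 sm2).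
have e14 i : nmem s3 14 i = nmem s1 14 i by rewrite (proj1 sm3) // (proj1 sm2).
have e2 i : rmem s3 2 i = rmem s1 2 i by rewrite (proj2 sm3) // (proj2 sm2).
have e60' : nmem s3 60 0 = nb by [].
clearbody s3; split=> //; last first.
  rewrite (proj1 sm3) //; case: best2 => [|[h [q fq]]]; [by left|right].
  split=> //; exists q; have [sn sr] := sm3.
  by apply: (found_same sm3) fq => //; [apply: sn|apply: sr].
move=> v; rewrite -/nb e13 e2 finE eqn_add2l (inj_eq idx_inj).
have [->|vN] := eqVneq v None; split=> //.
- move=> q wq sq lq; have : last None q \in q by move: sq; case/lastP: (q) => // ? ? _;
  rewrite last_rcons mem_rcons mem_head.
  by move=> /(mem_walk wq); rewrite lq.
- have [h1 _] := st v; move=> /h1[q [wq sq aq De [pq pe]]]; exists (rcons q v).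
  split; rewrite ?size_rcons ?sq ?last_rcons ?wl_rcons //.
    by rewrite walk_rcons wq aq.
  by apply: pchain_rcons => [i lti|]; rewrite e14 ?sq // pq.
case/lastP=> [|q w] //; rewrite walk_rcons size_rcons last_rcons wl_rcons.
move=> /and3P[wq aq _] [sq] wv; rewrite wv in aq *.
by have [_ h2] := st v; apply: h2.
Qed.

Lemma search_runs s : env G s -> holds 10 B s ->
  (exists2 q, cwalk q & (size q < N.+1)%N) ->
  runs b search_prog s (fun s' => exists q, found s' N.+1 q).
Proof.
move=> es hB [q0 cq0 sq0]; apply: runs_seqw (start_runs es) _ => s1 sm1 I1.
have es1 : env G s1 by apply: env_same sm1 isT es.
have hB1 : holds 10 B s1 by apply: holds_same sm1 _ hB.
have [_ _ [_ eS _ _] _ _] := es1.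
apply: runs_weaken (_ : runs _ _ _ (search_inv N.+1)) _; last first.
  move=> s' _ [_ _ [[_ h]|[_ //]]].
  by have := h q0 cq0; rewrite leqNgt sq0.
apply: (runs_for (n := N.+1) (Inv := search_inv)) => //; first by lia.
move=> k s' ltk sm ik Ik.
have es' : env G s' by apply: env_same sm isT es1.
have hB' : holds 10 B s' by apply: holds_same sm _ hB1.
by apply: runs_weaken (search_step es' hB' Ik) _.
Qed.

Lemma augment_runs s q : env G s -> holds 10 B s -> uniq q -> (size q < N.+1)%N ->
  nmem s 63 0 = ((size q).+1 * N.+1)%N ->
  nmem s 14 ((size q).+1 * N.+1 + N) = idx (last None q) -> pchain s q ->
  runs b augment_prog s (holds 10 (toggle B q)).
Proof.
move=> es hB uq lq e63 eL pq; have [_ _ [eN eS _ _] _ _] := es.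
apply: runs_seq; apply: runs_nset; apply: runs_seq; apply: runs_nset.
rewrite /= /upd /= e63 eN eS eL; set s1 := setn _ _ _ _.
pose Inv k s' := [/\ nmem s' 63 0 = (k * N.+1)%N /\ nmem s' 21 0 = N.+1,
  nmem s' 64 0 = idx (nth None (None :: q) k),
  forall i, nmem s' 14 i = nmem s 14 i
  & forall x, nmem s' 10 (idx x) = (x \in B) (+) (x \in drop k q)].
apply: runs_weaken (_ : runs _ _ _ (Inv 0%N)) _; last first.
  by move=> s' _ [_ _ _ h] x; rewrite h drop0 inE.
apply: (@runs_while _ _ Inv _ _ (size q)); first by lia.
- split=> //=.
  + by rewrite mulSn addKn.
  + by rewrite -nth_last; case: (q).
  + by move=> x; rewrite drop_size addbF; apply: hB.
- move=> k s' ltk [[f63 f21] f64 f14 f10]; split; first by rewrite /= f63.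
  apply: runs_seq; apply: runs_nset; apply: runs_seq; apply: runs_nset; apply: runs_nset.
  rewrite /= /upd /= f63 f21 f64 f14 /= pq //; split=> //=.
  + by rewrite /upd /= mulSn addKn.
  + move=> x; rewrite /upd /= (inj_eq idx_inj) (drop_nth None ltk) inE f10.
    have [xk|xk] := eqVneq x (nth None q k); last by rewrite f10.
    (* As [q] has no repetition, the element flipped now has not been flipped before. *)
    have nk : x \notin drop k.+1 q.
      by have := drop_uniq k uq; rewrite (drop_nth None ltk) /= xk => /andP[].
    by rewrite -xk (negPf nk) /= addbF addbT; case: (x \in B).
- by move=> s' [[f63 _] _ _ _]; rewrite /= f63.
Qed.

End Search.

(** * The algorithm *)

Definition arc_index (i : nexp) (d c : bool) : nexp :=
  NAdd (NAdd i (if d then vM else NConst 0)) (if c then NAdd vM vM else NConst 0).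

Definition init_arc (d c : bool) : prog :=
  let ix := arc_index (sv 70) d c in
  let tl := NGet (if d then 2 else 1) (sv 70) in
  let hd := NGet (if d then 1 else 2) (sv 70) in
  let off := if c then vn else NConst 0 in
  Seq (NSet 5 ix (NAdd tl off))
 (Seq (NSet 6 ix (NAdd hd off))
 (Seq (NSet 7 ix hd) (RSet 1 ix (RGet 0 (sv 70))))).

Definition init_prog :=
  Seq (assign 20 (NAdd (NAdd (NAdd vM vM) vM) vM))
 (Seq (assign 21 (NAdd (sv 20) (NConst 1)))
 (Seq (assign 22 (NAdd vn vn))
 (Seq (assign 23 (NSub (NAdd vn vn) (NConst 2)))
 (Seq (NSet 10 (sv 20) (NConst 1))
   (For 70 0 1
     (Seq (init_arc false false)
     (Seq (init_arc true false)
     (Seq (init_arc false true) (init_arc true true))))))))).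

Definition output_prog :=
  let cell d c := NGet 10 (arc_index (sv 71) d c) in
  For 71 0 1
    (NSet 4 (sv 71) (NAdd (NAdd (cell false false) (cell true false))
                          (NAdd (cell false true) (cell true true)))).

Definition fgc_prog :=
  Seq init_prog (Seq (For 72 23 0 (Seq search_prog augment_prog)) output_prog).

(** * Correctness of the whole program *)

Section Main.

Variables (R : realFieldType) (G : fgc_instance R).
Local Notation n := (nv G).
Local Notation m := (ne G).
Local Notation E := 'I_(ne G).
Local Notation A := ('I_(ne G) * bool * bool)%type.
Local Notation T := (option A).
Local Notation b := (4 * (nv G + ne G)).+1.
Local Notation N := (m + m + m + m)%N.
Local Notation o1 := (oind (@ind1 _ G)).
Local Notation o2 := (oind (@ind2 _ G)).
Local Notation ext := (extreme None (@tcost _ G) o1 o2).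
Implicit Types (s : state R) (x : T) (I : {set T}) (X : {set A}).

Definition input s :=
  [/\ nmem s 0 0 = n, nmem s 0 1 = m, forall e : E, nmem s 3 e = (e \in safe G),
      (forall e : E, nmem s 1 e = (ends e).1) /\ (forall e : E, nmem s 2 e = (ends e).2)
    & forall e : E, rmem s 0 e = ecost e].

Lemma tabE (U : Type) (x0 : U) k (f : 'I_k -> U) (i : 'I_k) : tab x0 f i = f i.
Proof. by rewrite /tab valK. Qed.

Lemma input_encode : input (encode G).
Proof. by split=> //= [e|/=|e]; [|split=> e|]; rewrite tabE. Qed.

Lemma input_same na ra s s' : same na ra s s' ->
  all (fun i : nat => i \notin na) [:: 0; 1; 2; 3]%N && (0%N \notin ra) ->
  input s -> input s'.
Proof.
move=> [h1 h2] /andP[/and5P[a0 a1 a2 a3 _] r0] [e1 e2 e3 [e4 e5] e6].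
by split; [| | |split|] => *; rewrite ?h1 ?h2.
Qed.

Definition filled (P : pred A) s :=
  (forall a, P a -> [/\ nmem s 5 (idx (Some a)) = lidx (a.2, atl a),
     nmem s 6 (idx (Some a)) = lidx (a.2, ahd a), nmem s 7 (idx (Some a)) = ahd a
   & rmem s 1 (idx (Some a)) = ecost a.1.1]) /\ rmem s 1 N = 0.

Lemma init_arc_runs s P (e : E) d c : input s -> nmem s 70 0 = e -> filled P s ->
  runs b (init_arc d c) s (filled (fun a => P a || (a == (e, d, c)))).
Proof.
move=> [en em _ [e1 e2] eC] e70 [fP fN].
have ixE : neval s (arc_index (sv 70) d c) = idx (Some (e, d, c)).
  by rewrite /arc_index /idx /=; case: d; case: c; rewrite /= ?em e70.
have tlE : neval s (NAdd (NGet (if d then 2 else 1) (sv 70)) (if c then vn else NConst 0))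
    = lidx (c, atl (e, d, c)).
  by rewrite /lidx /atl; case: d {ixE}; case: c; rewrite /= ?en e70 ?e1 ?e2.
have hdE : neval s (NAdd (NGet (if d then 1 else 2) (sv 70)) (if c then vn else NConst 0))
    = lidx (c, ahd (e, d, c)).
  by rewrite /lidx /ahd; case: d {ixE tlE}; case: c; rewrite /= ?en e70 ?e1 ?e2.
have hE : neval s (NGet (if d then 1 else 2) (sv 70)) = ahd (e, d, c).
  by rewrite /ahd; case: d {ixE tlE hdE}; rewrite /= e70 ?e1 ?e2.
exists 4%N; eexists; split.
- apply: (ExecSeq (t := 1)); first exact: ExecNSet.
  apply: (ExecSeq (t := 1)); first exact: ExecNSet.
  apply: (ExecSeq (t := 1)); first exact: ExecNSet.
  exact: ExecRSet.
- by [].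
set s' := State _ _.
have [h5 h6 h7 h1] : [/\ forall i, nmem s' 5 i = if i == idx (Some (e, d, c)) then lidx
  (c, atl (e, d, c)) else nmem s 5 i,
  forall i, nmem s' 6 i = if i == idx (Some (e, d, c)) then lidx (c, ahd (e, d, c))
    else nmem s 6 i,
  forall i, nmem s' 7 i = if i == idx (Some (e, d, c)) then ahd (e, d, c) : nat else
    nmem s 7 i
  & forall i, rmem s' 1 i = if i == idx (Some (e, d, c)) then ecost e else rmem s 1 i].
  rewrite -ixE -tlE -hdE -hE -eC -e70 /s' /arc_index.
  by split=> i; case: d {ixE tlE hdE hE s'}; case: c.
split=> [a|]; last first.
  rewrite h1 ifN // eq_sym neq_ltn.
  by rewrite (leq_trans (idx_Some_lt (e, d, c))).
rewrite h5 h6 h7 h1 (inj_eq idx_inj) (inj_eq Some_inj).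
by have [->|_] := eqVneq a (e, d, c); rewrite ?orbF //; apply: fP.
Qed.

Lemma init_runs : runs b init_prog (encode G) (fun s => env G s /\ holds 10 [set (None
  : T)] s).
Proof.
do 4 (apply: runs_seq; apply: runs_nset); apply: runs_seq; apply: runs_nset.
rewrite /= /upd /=; set s1 := setn _ _ _ _.
have sm1 : same [:: 10; 20; 21; 22; 23] [::] (encode G) s1.
  split=> // a i; rewrite !inE !negb_or => /and5P[/negPf a1 /negPf a2 /negPf a3 /negPf
    a4 /negPf a5].
  by rewrite /= /upd a1 a2 a3 a4 a5.
have in1 : input s1 by apply: input_same sm1 isT input_encode.
have v1 : [/\ nmem s1 20 0 = N, nmem s1 21 0 = N.+1, nmem s1 22 0 = (n + n)%N
        & nmem s1 23 0 = (n.-1).*2].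
  by split; rewrite //= /upd /=; lia.
have h1 : holds 10 [set (None : T)] s1.
  move=> x; rewrite /= /upd /= inE -[X in _ == X]/(idx (None : T)) (inj_eq idx_inj).
  by case: (x == None).
have z1 : rmem s1 1 N = 0 by [].
clearbody s1; have [en em _ _ _] := in1.
pose Inv k s := filled (fun a : A => a.1.1 < k)%N s.
apply: runs_weaken (_ : runs _ _ _ (Inv m)) _; last first.
  move=> s' sm [f fN]; have [en' em' es' _ _] : input s' by apply: input_same sm isT in1.
  split; last by apply: holds_same sm _ h1.
  split=> //; first by have [? ? ? ?] := v1; split; rewrite (proj1 sm).
  by split=> [a|a|a|[a|]] //; have [] := f a (ltn_ord _).
apply: (runs_for (n := m) (Inv := Inv)) => //; first by lia.
move=> k s' ltk sm ik Ik; set e : E := Ordinal ltk.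
have in' : input s' by apply: input_same sm isT in1.
apply: runs_seqw (@init_arc_runs s' _ e false false in' ik Ik) _ => s2 sm2 f2.
have in2 : input s2 by apply: input_same sm2 isT in'.
have i2 : nmem s2 70 0 = e by rewrite (proj1 sm2).
apply: runs_seqw (@init_arc_runs s2 _ e true false in2 i2 f2) _ => s3 sm3 f3.
have in3 : input s3 by apply: input_same sm3 isT in2.
have i3 : nmem s3 70 0 = e by rewrite (proj1 sm3).
apply: runs_seqw (@init_arc_runs s3 _ e false true in3 i3 f3) _ => s4 sm4 f4.
have in4 : input s4 by apply: input_same sm4 isT in3.
have i4 : nmem s4 70 0 = e by rewrite (proj1 sm4).
apply: runs_weaken (@init_arc_runs s4 _ e true true in4 i4 f4) _ => s5 sm5 [f5 fN].
suff : Inv k.+1 s5 by [].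
split=> // a lea; apply: f5; case: a lea => [[e' d] c] /=.
rewrite ltnS leq_eqVlt -[X in _ == X]/(val e) (inj_eq val_inj) => /orP[/eqP->|->//].
by case: d; case: c; rewrite eqxx ?orbT.
Qed.

Lemma output_runs s X : env G s -> holds 10 (None |: Some @: X) s ->
  runs b output_prog s (fun s' => output G s' = used X).
Proof.
move=> es hX; have [_ em _ _ _] := es.
apply: runs_weaken (_ : runs _ _ _ (fun s' => forall e : E, (e < m)%N ->
  (nmem s' 4 e != 0%N) = (e \in used X))) _; last first.
  by move=> s' _ h; apply/setP=> e; rewrite inE h ?ltn_ord.
apply: (runs_for (n := m) (Inv := fun k s' => forall e : E, (e < k)%N ->
  (nmem s' 4 e != 0%N) = (e \in used X))) => //; first by lia.
move=> k s' ltk sm ik Ik; set e0 : E := Ordinal ltk.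
have es' : env G s' by apply: env_same sm isT es.
have hX' : holds 10 (None |: Some @: X) s' by apply: holds_same sm _ hX.
have [_ em' _ _ _] := es'.
have cellE d c : neval s' (NGet 10 (arc_index (sv 71) d c)) = ((e0, d, c) \in X).
  have ixE : neval s' (arc_index (sv 71) d c) = idx (Some (e0, d, c)).
    by rewrite /arc_index /idx /=; case: d; case: c; rewrite /= ?em' ik.
  rewrite -[LHS]/(nmem s' 10 (neval s' (arc_index (sv 71) d c))) ixE hX' in_setU1 /=.
  by rewrite mem_imset //; apply: Some_inj.
apply: runs_nset => e; set j := neval _ _; set w := neval _ _.
have jE : j = k by rewrite /j /= ik.
have wE : (w != 0%N) = (e0 \in used X).
  have -> : w = (((e0, false, false) \in X) + ((e0, true, false) \in X) +
      (((e0, false, true) \in X) + ((e0, true, true) \in X)))%N.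
    by rewrite -!cellE.
  rewrite inE -lt0n; apply/idP/exists_inP=> [|[[[e' d] c] aX /= /eqP ee]]; last first.
    by rewrite ee in aX; move: aX; case: d; case: c => ->; rewrite ?addn1 ?addnS ?addSn.
  by do 4! [case: (boolP (_ \in X)) => [aX _|_]; first by (eexists;
    [exact: aX|exact: eqxx])].
rewrite ltnS leq_eqVlt /= /upd /= jE; have [ek _|ek /= lte] := eqVneq (e : nat) k.
  by rewrite wE (_ : e0 = e) //; apply: val_inj.
exact: Ik.
Qed.

Lemma sum_tcost X : \sum_(x in Some @: X) tcost x = acost X.
Proof. by rewrite big_imset //= => x y _ _ []. Qed.

Lemma preim_Some X : Some @^-1: (Some @: X) = X.
Proof. by apply/setP=> a; rewrite inE mem_imset //; apply: Some_inj. Qed.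

Lemma imset_preim_Some I : None \notin I -> Some @: (Some @^-1: I) = I.
Proof.
move=> nI; apply/setP=> [][a|]; first by rewrite mem_imset ?inE //; apply: Some_inj.
by rewrite (negPf nI); apply/negP=> /imsetP[].
Qed.

Lemma None_imset X : None \notin Some @: X.
Proof. by apply/negP=> /imsetP[]. Qed.

Lemma round_runs s k I X : env G s -> holds 10 (None |: I) s -> ext k I ->
  ind1 X -> ind2 X -> (k < #|X|)%N ->
  runs b (Seq search_prog augment_prog) s (fun s' =>
    exists2 I', ext k.+1 I' & holds 10 (None |: I') s').
Proof.
move=> es hI eI i1 i2 ltk.
have m1 : matroid o1 by apply: oind_matroid; apply: matroid1.
have m2 : matroid o2 by apply: oind_matroid; apply: matroid2.
have u1 (Z : {set T}) : o1 Z -> o1 (None |: Z) by apply: oind_None.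
have u2 (Z : {set T}) : o2 Z -> o2 (None |: Z) by apply: oind_None.
have [cI nI [iI1 iI2] _] := eI.
have ex : exists2 q, closed_walk None o1 o2 (None |: I) q & (size q < N.+1)%N.
  have [|||q cq sq] := @closed_walk_exists _ None o1 o2 m1 m2 u1 u2 I (Some @: X) nI
    iI1 iI2 (None_imset X).
  - by rewrite /oind preim_Some.
  - by rewrite /oind preim_Some.
  - by rewrite cI card_imset //; apply: Some_inj.
  by exists q => //; rewrite -(card_T G).
apply: runs_seqw (search_runs es hI ex) _ => s1 sm1 [q [cq lq [f63 _] [fL pq] qmin]].
have wlE q' : closed_walk None o1 o2 (None |: I) q' -> wl (None |: I) q' = alen (@tcost
  _ G) I q'.
  move=> /andP[/andP[_ nq] _]; apply: eq_big_seq => v vq.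
  have vN : v != None by apply: contraNneq nq => <-.
  by rewrite /ell in_setU1 (negPf vN).
have best : best_walk None (@tcost _ G) o1 o2 I q.
  split=> //; rewrite card_T // => q' cq' lq'; rewrite -!wlE //; exact: qmin.
have [uq eI'] := extreme_step m1 m2 u1 u2 eI best.
have es1 : env G s1 by apply: env_same sm1 isT es.
have hI1 : holds 10 (None |: I) s1 by apply: holds_same sm1 _ hI.
apply: runs_weaken (augment_runs es1 hI1 uq lq f63 fL pq) _ => s2 _ h2.
exists (toggle I q) => // x; rewrite h2 !inE; have [->|//] := eqVneq x None.
by case/andP: cq => /andP[_ /negPf ->].
Qed.

Lemma fgc_runs : fgc_wf G -> (exists F : {set E}, feasible F) ->
  runs b fgc_prog (encode G) (fun s =>
    feasible (output G s) /\ cost (output G s) <= 2 * OPT G).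
Proof.
move=> wf exF; have [n0 _ _ c0] := wf.
have [[F fF costF] _] := OPTP wf exF.
(* The base [X] built from an optimal [F] serves twice: its size guarantees an augmentation in each
   of the [2 (n - 1)] rounds, and its cost, at most twice the optimum, bounds that of the base
   found. *)
have [X [i1 i2 cX XF]] := common_base n0 fF.
apply: runs_seqw init_runs _ => s1 sm1 [es1 h1].
have [_ _ [_ _ _ eK] _ _] := es1.
apply: runs_seqw (_ : runs _ _ _ (fun s => exists2 I, ext (n.-1).*2 I & holds 10 (None
  |: I) s)) _.
  apply: (runs_for (n := (n.-1).*2) (Inv := fun k s =>
    exists2 I, ext k I & holds 10 (None |: I) s)) => //; first by lia.
    exists set0; last by rewrite setU0.
    by apply: extreme0; rewrite /oind preimset0 ?ind1_0 ?ind2_0.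
  move=> k s' ltk sm ik [I eI hI].
  have es' : env G s' by apply: env_same sm isT es1.
  rewrite -cX in ltk.
  by apply: runs_weaken (round_runs es' hI eI i1 i2 ltk) _.
move=> s2 sm2 [I eI hI].
have es2 : env G s2 by apply: env_same sm2 isT es1.
have [cI nI [iI1 iI2] _] := eI.
rewrite -(imset_preim_Some nI) in hI.
apply: runs_weaken (output_runs es2 hI) _ => s3 _ ->; split.
  apply: (used_feasible n0 iI1 iI2); rewrite -cI card_oset (negPf nI).
  by [].
apply: le_trans (cost_used_le _ c0) _; rewrite -costF.
apply: le_trans (acost_le c0 i1 XF); rewrite -!sum_tcost imset_preim_Some //.
apply: (extreme_min eI); rewrite ?None_imset ?/oind ?preim_Some //.
by rewrite card_imset //; apply: Some_inj.
Qed.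

End Main.

Theorem theorem1 :
  exists (A : prog) (p : {poly nat}),
    forall (R : realFieldType) (I : fgc_instance R),
      fgc_wf I -> (exists F : {set 'I_(ne I)}, feasible F) ->
      exists (t : nat) (s : state R),
        [/\ exec A (encode I) t s,
            (t <= p.[(nv I + ne I)%N])%N,
            feasible (output I s)
          & cost (output I s) <= 2 * OPT I].
Proof.
have [p hp] := ptime_poly fgc_prog.
(* The polynomial [p] bounds the time in terms of the loop bound, which is [4 (n + m) + 1]. *)
exists fgc_prog, (p \Po (4%N%:P * 'X + 1)) => R I wf exF.
have [t [s [h1 h2 [h3 h4]]]] := fgc_runs wf exF.
exists t, s; split=> //; apply: leq_trans h2 (leq_trans (hp _) _).
by rewrite horner_comp hornerD hornerM !hornerC hornerX -addn1; exact: leqnn.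
Qed.
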